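(* For every nonzero $\lambda\in Q^+$, the polynomial $m_\lambda(t)$ has a root at $t=1$. For every nonzero $\lambda\in Q^+_{\mathrm{im}}$ this is a double root, in the sense that $m_\lambda(t)$ is divisible by $(1-t)^2$ in $\mathbb{Z}[t]$.
   Context: Setting. $\Phi$ is a Kac-Moody root system (the root system of the Kac-Moody algebra of a generalized Cartan matrix), with simple roots $\alpha_1,\dots,\alpha_r$, simple reflections $s_1,\dots,s_r$, Weyl group $W$ with length function $\ell$, and positive real roots $\Phi^+_{\mathrm{re}}$. $Q=\bigoplus_i\mathbb{Z}\alpha_i$ is the root lattice, $Q^+=\bigoplus_i\mathbb{Z}_{\ge0}\alpha_i$. $Q^+_{\mathrm{im}}$ is the set of non-negative integer combinations of positive imaginary roots (equivalently, the elements of $Q^+$ whose whole $W$-orbit lies in $Q^+$). For a commutative ring $R$, $R[[Q^+]]$ is the ring of formal sums $\sum_{\lambda\in Q^+}c_\lambda e^\lambda$, $c_\lambda\in R$. Put $\Delta_{\mathrm{re}}=\prod_{\alpha\in\Phi^+_{\mathrm{re}}}(1-e^\alpha)$, $\Delta_{t,\mathrm{re}}=\prod_{\alpha\in\Phi^+_{\mathrm{re}}}(1-te^\alpha)$, and $P(t)=\sum_{w\in W}t^{\ell(w)}\in\mathbb{Z}[[t]]$. Definition of $\mathfrak m$. For $\alpha\in\Phi^+_{\mathrm{re}}$ and $w\in W$ set $w(1-t^ne^\alpha)=1-t^ne^{w(\alpha)}$ if $w(\alpha)>0$, and $w(1-t^ne^\alpha)=(-t^ne^{w(\alpha)})(1-t^{-n}e^{-w(\alpha)})$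 if $w(\alpha)<0$; extend multiplicatively to define $w(\Delta_{t,\mathrm{re}}/\Delta_{\mathrm{re}})=\prod_{\alpha\in\Phi^+_{\mathrm{re}}} w(1-te^\alpha)\,w(1-e^\alpha)^{-1}$, an element of $\mathbb{Z}[t,t^{-1}][[Q^+]]$. The sum over $w\in W$ of these converges coefficientwise to a unit of $\mathbb{Z}[[t]][t^{-1}][[Q^+]]$, and $\mathfrak m$ is defined by $$\mathfrak m\sum_{w\in W}w\left(\frac{\Delta_{t,\mathrm{re}}}{\Delta_{\mathrm{re}}}\right)=P(t).$$ The series $\mathfrak m$ has coefficients in $\mathbb{Z}[t]$, constant coefficient $1$, and support in $Q^+_{\mathrm{im}}$, so there are unique integers $m(\lambda,n)$ (for $0\ne\lambda\in Q^+_{\mathrm{im}}$, $n\ge0$), with finitely many nonzero for each $\lambda$, such that $\mathfrak m=\prod_{0\ne\lambda\in Q^+_{\mathrm{im}}}\prod_{n\ge0}(1-t^ne^\lambda)^{-m(\lambda,n)}$. Extend to all nonzero $\lambda\in Q^+$ by: $m(\alpha,0)=1$, $m(\alpha,1)=-1$, $m(\alpha,n)=0$ for $n\ge 2$ if $\alpha$ is a positive real root; $m(\lambda,n)=0$ for all $n$ if $\lambda$ is neither in $Q^+_{\mathrm{im}}$ nor a real root. Put $m_\lambda(t)=\sum_{n\ge0}m(\lambda,n)t^n\in\mathbb{Z}[t]$. *)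

(* Defs.v *)
From HB Require Import structures.
From mathcomp Require Import all_boot all_order all_algebra finmap.
From mathcomp Require Import boolp classical_sets.

Set Implicit Arguments.
Unset Strict Implicit.
Unset Printing Implicit Defensive.

Import GRing.Theory.
Local Open Scope ring_scope.
Local Open Scope classical_set_scope.

(** * Formal power series  R[[ N^I ]]  *)

Record fps (I : finType) (R : Type) := Fps { coef : {ffun I -> nat} -> R }.

HB.instance Definition _ (I : finType) (R : Type) := gen_eqMixin (fps I R).
HB.instance Definition _ (I : finType) (R : Type) := gen_choiceMixin (fps I R).

(* All pairs (a, b) with a + b = l, each listed once. *)
Definition decomps (I : finType) (l : {ffun I -> nat}) :
    seq ({ffun I -> nat} * {ffun I -> nat}) :=
  let box := {ffun I -> 'I_(\max_i l i).+1} in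
  let emb (p : box) : {ffun I -> nat} := [ffun i => val (p i)] in
  [seq q <- [seq (emb a, emb b) | a <- enum box, b <- enum box]
     | q.1 + q.2 == l].

Section FpsRing.
Variables (I : finType) (R : comNzRingType).
Implicit Types (f g h : fps I R) (l a b : {ffun I -> nat}).

Lemma fpsP f g : coef f =1 coef g -> f = g.
Proof. by case: f g => [f] [g] /= e; congr Fps; apply/funext. Qed.

Lemma mem_decomps l a b : ((a, b) \in decomps l) = (a + b == l).
Proof.
rewrite mem_filter /=; case: eqP => //= abl; apply/allpairsP.
have bnd i : (a i <= \max_i l i)%N /\ (b i <= \max_i l i)%N.
  have li := leq_bigmax (F := l) i.
  have : (a + b) i = l i by rewrite abl.
  rewrite ffunE => e; rewrite -e in li.
  by split; apply: leq_trans li; rewrite ?leq_addr ?leq_addl.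
exists ([ffun i => inord (a i)], [ffun i => inord (b i)]).
rewrite /= !mem_enum; split=> //.
by congr pair; apply/ffunP=> i; rewrite !ffunE inordK // ltnS; case: (bnd i).
Qed.

Lemma decomps_uniq l : uniq (decomps l).
Proof.
apply/filter_uniq/allpairs_uniq; rewrite ?enum_uniq //.
move=> [a b] [c d] _ _ [/ffunP e1 /ffunP e2].
congr pair; apply/ffunP=> i; apply/val_inj.
  by have := e1 i; rewrite !ffunE.
by have := e2 i; rewrite !ffunE.
Qed.

Definition fps_zero : fps I R := Fps (fun _ => 0).
Definition fps_opp f := Fps (fun l => - coef f l).
Definition fps_add f g := Fps (fun l => coef f l + coef g l).
Definition fps_one : fps I R := Fps (fun l => (l == 0)%:R).
Definition fps_mul f g :=
  Fps (fun l => \sum_(p <- decomps l) coef f p.1 * coef g p.2).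

Fact fps_addA : associative fps_add.
Proof. by move=> f g h; apply/fpsP=> l /=; rewrite addrA. Qed.
Fact fps_addC : commutative fps_add.
Proof. by move=> f g; apply/fpsP=> l /=; rewrite addrC. Qed.
Fact fps_add0 : left_id fps_zero fps_add.
Proof. by move=> f; apply/fpsP=> l /=; rewrite add0r. Qed.
Fact fps_addN : left_inverse fps_zero fps_opp fps_add.
Proof. by move=> f; apply/fpsP=> l /=; rewrite addNr. Qed.

HB.instance Definition _ :=
  GRing.isZmodule.Build (fps I R) fps_addA fps_addC fps_add0 fps_addN.

Fact fps_mulC : commutative fps_mul.
Proof.
move=> f g; apply/fpsP=> l /=.
rewrite (perm_big [seq (p.2, p.1) | p <- decomps l]) ?big_map /=.
  by apply: eq_bigr => p _; rewrite mulrC.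
have swapI : injective (fun p : {ffun I -> nat} * {ffun I -> nat} => (p.2, p.1)).
  by move=> [a b] [c d] [-> ->].
apply: uniq_perm; rewrite ?map_inj_uniq ?decomps_uniq // => -[a b].
by rewrite (mem_map swapI _ (b, a)) !mem_decomps addrC.
Qed.

Fact fps_mul1 : left_id fps_one fps_mul.
Proof.
move=> f; apply/fpsP=> l /=.
rewrite (bigD1_seq (0, l)) ?decomps_uniq ?mem_decomps ?add0r //= eqxx mul1r.
rewrite big_seq_cond big1 ?addr0 // => -[a b] /=.
rewrite mem_decomps => /andP[/eqP abl].
case: (a =P 0) => [a0|_]; rewrite ?mul0r //.
by rewrite -abl a0 add0r eqxx.
Qed.

Fact fps_mulDl : left_distributive fps_mul fps_add.
Proof.
move=> f g h; apply/fpsP=> l /=.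
by rewrite -big_split; apply: eq_bigr => p _; rewrite mulrDl.
Qed.

Fact fps_mulA : associative fps_mul.
Proof.
move=> f g h; apply/fpsP=> l /=.
transitivity (\sum_(x <- [seq (p.1, q.1, q.2) | p <- decomps l, q <- decomps p.2])
                coef f x.1.1 * (coef g x.1.2 * coef h x.2)).
  by rewrite big_allpairs_dep /=; apply: eq_bigr => p _; rewrite mulr_sumr.
transitivity (\sum_(x <- [seq (q.1, q.2, p.2) | p <- decomps l, q <- decomps p.1])
                coef f x.1.1 * (coef g x.1.2 * coef h x.2)); last first.
  rewrite big_allpairs_dep /=; apply: eq_bigr => p _; rewrite mulr_suml.
  by apply: eq_bigr => q _; rewrite mulrA.
apply: perm_big; apply: uniq_perm.
- apply: allpairs_uniq_dep => [|p _|]; rewrite ?decomps_uniq //.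
  move=> _ _ /allpairsPdep[[a b][[c d][_ + ->]]] /allpairsPdep[[a' b'][[c' d'][_ + ->]]].
  rewrite !mem_decomps /= => /eqP e1 /eqP e2 [ea ec ed].
  by move: e1 e2; rewrite ea ec ed => <- <-.
- apply: allpairs_uniq_dep => [|p _|]; rewrite ?decomps_uniq //.
  move=> _ _ /allpairsPdep[[a b][[c d][_ + ->]]] /allpairsPdep[[a' b'][[c' d'][_ + ->]]].
  rewrite !mem_decomps /= => /eqP e1 /eqP e2 [ea ec ed].
  by move: e1 e2; rewrite ea ec ed => <- <-.
move=> [[a b] c]; apply/allpairsPdep/allpairsPdep.
- move=> [[x y][[u v][+ + []]]]; rewrite !mem_decomps /= => /eqP e1 /eqP e2 -> -> ->.
  exists (x + u, v), (x, u); split=> //; rewrite mem_decomps //.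
  by rewrite -addrA e2 e1.
move=> [[x y][[u v][+ + []]]]; rewrite !mem_decomps /= => /eqP e1 /eqP e2 -> -> ->.
exists (u, v + y), (v, y); split=> //; rewrite mem_decomps //.
by rewrite addrA e2 e1.
Qed.

Fact fps_one_neq0 : fps_one != 0 :> fps I R.
Proof.
apply/eqP => /(congr1 (fun f => coef f 0)) /=.
by rewrite eqxx => /eqP; rewrite oner_eq0.
Qed.

HB.instance Definition _ := GRing.Zmodule_isComNzRing.Build (fps I R)
  fps_mulA fps_mulC fps_mul1 fps_mulDl fps_one_neq0.

(* x^-1 is the inverse of x when one exists, and x otherwise. *)
Definition fps_unit : {pred fps I R} := fun f => `[< exists g, g * f = 1 >].
Definition fps_inv f : fps I R :=
  if pselect (exists g, g * f = 1) is left e then projT1 (cid e) else f.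

Fact fps_mulV : {in fps_unit, left_inverse 1 fps_inv *%R}.
Proof.
move=> f /asboolP uf; rewrite /fps_inv.
by case: pselect => // e; case: (cid e).
Qed.
Fact fps_unitPl f g : g * f = 1 -> fps_unit f.
Proof. by move=> e; apply/asboolP; exists g. Qed.
Fact fps_inv_out : {in [predC fps_unit], fps_inv =1 id}.
Proof.
move=> f /negP uf; rewrite /fps_inv; case: pselect => // e.
by case: uf; apply/asboolP.
Qed.

HB.instance Definition _ := GRing.ComNzRing_hasMulInverse.Build (fps I R)
  fps_mulV fps_unitPl fps_inv_out.

Definition monom a : fps I R := Fps (fun l => (l == a)%:R).
Definition fpsC (c : R) : fps I R := Fps (fun l => if l == 0 then c else 0).

End FpsRing.

Notation Zt := (fps unit int).

(* The root lattice Q is 'cV[int]_r and its positive cone Q^+ is N^r. *)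
Notation Qplus r := {ffun 'I_r -> nat}.
Notation ZtQ r := (fps 'I_r Zt).

Definition tvar r : ZtQ r := fpsC _ (monom int [ffun _ : unit => 1%N]).
Definition expQ r (l : Qplus r) : ZtQ r := monom Zt l.

(* The integer coefficient of t^n e^l. *)
Definition coeft r (F : ZtQ r) (l : Qplus r) (n : nat) : int :=
  coef (coef F l) [ffun _ => n].

(** * Unconditional coefficientwise convergence over an index set [D] *)

Definition eventually_fin (T : choiceType) (D : set T) (P : {fset T} -> Prop) :=
  exists X0 : {fset T}, [set` X0] `<=` D /\
    forall X : {fset T}, [set` X0] `<=` [set` X] -> [set` X] `<=` D -> P X.

Definition is_sum r (T : choiceType) (D : set T) (f : T -> ZtQ r) (F : ZtQ r) :=
  forall l n, eventually_fin D
    (fun X => coeft (\sum_(x <- X) f x) l n = coeft F l n).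

Definition is_prod r (T : choiceType) (D : set T) (f : T -> ZtQ r) (F : ZtQ r) :=
  forall l n, eventually_fin D
    (fun X => coeft (\prod_(x <- X) f x) l n = coeft F l n).

(** * Weyl group and roots of a generalized Cartan matrix *)

Definition gcm r (A : 'M[int]_r) :=
  [/\ forall i, A i i = 2,
      forall i j, i != j -> A i j <= 0
    & forall i j, A i j = 0 -> A j i = 0].

Section Weyl.
Variables (r : nat) (A : 'M[int]_r).

Definition toQ (l : Qplus r) : 'cV[int]_r := \col_i (l i)%:Z.

Definition in_Qplus (v : 'cV[int]_r) : Prop := forall i, 0 <= v i 0.

Definition simple_root (i : 'I_r) : 'cV[int]_r := delta_mx i 0.

(* The matrix of s_i : v |-> v - <v, alpha_i^vee> alpha_i on Q, with
   A i j = <alpha_j, alpha_i^vee>, so that <v, alpha_i^vee> = (A *m v) i 0. *)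
Definition srefl (i : 'I_r) : 'M[int]_r := 1%:M - delta_mx i i *m A.

Definition word_mx (s : seq 'I_r) : 'M[int]_r :=
  \big[mulmx/1%:M]_(i <- s) srefl i.

(* W acts faithfully on Q, so it is taken to be its image in GL(Q). *)
Definition weyl : set 'M[int]_r := [set w | exists s, w = word_mx s].

Definition has_word (w : 'M[int]_r) (n : nat) : bool :=
  `[< exists s : seq 'I_r, size s = n /\ w = word_mx s >].

(* The junk value 0 is only reached outside of W. *)
Definition weyl_length (w : 'M[int]_r) : nat :=
  if pselect (exists n, has_word w n) is left e then ex_minn e else 0.

Definition pos_real_root : set (Qplus r) :=
  [set a | exists w i, weyl w /\ toQ a = w *m simple_root i].

Definition Qim : set (Qplus r) :=
  [set l | forall w, weyl w -> in_Qplus (w *m toQ l)].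

(* For a root v : whichever of v, - v lies in Q^+. *)
Definition abs_root (v : 'cV[int]_r) : Qplus r := [ffun i => absz (v i 0)].

(* w(1 - t e^a) / w(1 - e^a), expanded in Q^+.  If w(a) = - b < 0 this is
     (- t e^-b) (1 - t^-1 e^b) / ((- e^-b) (1 - e^b)),
   in which e^-b cancels and t (1 - t^-1 e^b) = t - e^b. *)
Definition w_factor (w : 'M[int]_r) (a : Qplus r) : ZtQ r :=
  let b := abs_root (w *m toQ a) in
  if `[< in_Qplus (w *m toQ a) >]
  then (1 - tvar r * expQ b) / (1 - expQ b)
  else (tvar r - expQ b) / (1 - expQ b).

(* [D w] is w(Delta_{t,re} / Delta_re), [S] is the sum of these over W and
   [P] is the Poincare series of W. *)
Definition is_correction_factor (m : ZtQ r) : Prop :=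
  exists (D : 'M[int]_r -> ZtQ r) (S P : ZtQ r),
    [/\ forall w, weyl w -> is_prod pos_real_root (w_factor w) (D w),
        is_sum weyl D S,
        is_sum weyl (fun w => tvar r ^+ weyl_length w) P
      & m * S = P].

(* [mult l] is m_l(t), so m(l, n) is its n-th coefficient; its value at l = 0
   is unconstrained. *)
Definition is_t_multiplicity (mult : Qplus r -> {poly int}) : Prop :=
  [/\ exists m, is_correction_factor m /\
        is_prod [set x : Qplus r * nat | x.1 != 0 /\ Qim x.1]
          (fun x => (1 - tvar r ^+ x.2 * expQ x.1) ^ (- (mult x.1)`_x.2)) m,
      forall a, pos_real_root a -> mult a = 1 - 'X
    & forall l : Qplus r, l != 0 -> ~ Qim l -> ~ pos_real_root l -> mult l = 0].

End Weyl.

(* Main.v *)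
Require Import Defs.
From mathcomp Require Import boolp classical_sets.
From mathcomp Require Import all_boot all_order all_algebra finmap.
From mathcomp Require Import ring zify.

(* Write [C] for the product of [(1 - t e^b) / (1 - e^b)] over the positive
   real roots [b], put [x_b = (t - e^b) / (1 - t e^b)], and let [X_w] be the
   product of the [x_b] over the [b > 0] with [w^-1 b < 0].  The summand attached
   to [w] is [C X_w], so [f = (m C)^-1] satisfies [sum_w X_w = f P(t)].  Setting
   [e^(a_i) = 0] for [i] outside [J] gives the same identity for the parabolic
   subgroup [W_J] and the part [f_J] of [f] supported on [J].  As
   [X_(uy) = X_u u(X_y)] for a minimal coset representative [u] of [y] in [W_J],
   the sum of [X_u u(f_J)] over the minimal representatives [u] of [W_I / W_J]
   is [f_I] times the sum of [t^(len u)].  Taking the alternating sum over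
   [J <= I] kills the right-hand side as soon as no element of [W_I] makes all
   the simple roots of [I] negative, which is the case if [I] is the support of
   some [l] in [Qim].  In the coefficient of [e^l] only finitely many [u]
   contribute, [u = 1] contributes [f_l] up to sign, and the other terms involve
   coefficients [f_c] with [c] of smaller support.  Since
   [X_u = t^(len u)] modulo [1 - t], and [f_c] is divisible by [1 - t], even by
   [(1 - t)^2] if [c] is in [Qim], induction shows that [(1 - t)^2] divides
   [f_l], hence the coefficient of [e^l] in [m].  As [C] is 1 modulo [1 - t]
   and only multiples of real roots occur in it modulo [(1 - t)^2], it does not
   disturb the induction. *)

Set Implicit Arguments.
Unset Strict Implicit.
Unset Printing Implicit Defensive.

Import Order.TTheory GRing.Theory Num.Theory.
Local Open Scope ring_scope.

(** * Formal power series *)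

(** The group W is infinite in general, so its sums are truncated by the total degree in t and e
    together: each x_b has order at least 1, hence X_w has order at least the length of w, and only
    finitely many w matter modulo a given degree. Truncated identities can still be divided by a
    Poincare series, which has constant term 1 and so is a unit of Z[[t]]. The conclusion cannot be
    reached by truncation alone. As 1 - t is a unit of Z[[t]], divisibility by it has a meaning only
    in Z[t], so the coefficient of e^l must be an exact finite sum of polynomials, and the length of
    the contributing u must be bounded independently of the degree in t. The alternating sum gives
    this bound: from u(f) it keeps only the exponents u(c) for which the support of c is exactly the
    set of simple roots of I kept positive by u. This bounds the positive columns of u, and the
    positivity of u(l), for l in [Qim], bounds the negative ones. *)

Section Exponents.
Variable I : finType.
Implicit Types (a b l : {ffun I -> nat}).

Definition ht l := (\sum_i l i)%N.
Definition lel a l := [forall i, (a i <= l i)%N].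
Definition dif l a : {ffun I -> nat} := [ffun i => (l i - a i)%N].
Definition supp l : {set I} := [set i | l i != 0%N].

Lemma ffun_addE a b i : (a + b) i = (a i + b i)%N.
Proof. by rewrite ffunE. Qed.

Lemma htD a b : ht (a + b) = (ht a + ht b)%N.
Proof. by rewrite /ht -big_split; apply: eq_bigr => i _; rewrite ffun_addE. Qed.

Lemma ht0 : ht 0 = 0%N.
Proof. by rewrite /ht big1 // => i _; rewrite ffunE. Qed.

Lemma ht_eq0 l : (ht l == 0%N) = (l == 0).
Proof.
apply/idP/eqP => [|->]; last by rewrite ht0.
by rewrite sum_nat_eq0 => /forallP h; apply/ffunP=> i; rewrite ffunE; apply/eqP/h.
Qed.

Lemma ht_gt0 l : l != 0 -> (0 < ht l)%N.
Proof. by rewrite lt0n ht_eq0. Qed.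

Lemma lelP a l : reflect (forall i, (a i <= l i)%N) (lel a l).
Proof. exact: forallP. Qed.

Lemma lel_refl l : lel l l.
Proof. exact/lelP. Qed.

Lemma lel_trans a b l : lel a b -> lel b l -> lel a l.
Proof. by move=> /lelP h /lelP k; apply/lelP=> i; apply: leq_trans (h i) (k i). Qed.

Lemma lel0 l : lel 0 l.
Proof. by apply/lelP => i; rewrite ffunE. Qed.

Lemma lel_addr a b : lel a (a + b).
Proof. by apply/lelP => i; rewrite ffun_addE leq_addr. Qed.

Lemma lel_addl a b : lel b (a + b).
Proof. by rewrite addrC lel_addr. Qed.

Lemma difK a l : lel a l -> a + dif l a = l.
Proof. by move=> /lelP h; apply/ffunP=> i; rewrite !ffunE; rewrite [LHS]subnKC. Qed.

Lemma lel_ht a l : lel a l -> (ht a <= ht l)%N.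
Proof. by move/difK <-; rewrite htD leq_addr. Qed.

Lemma lel_supp a l : lel a l -> supp a \subset supp l.
Proof.
move=> /lelP h; apply/fintype.subsetP=> i; rewrite !inE -!lt0n => h1; exact: leq_trans h1 (h i).
Qed.

Lemma supp_eq0 l : (supp l == set0) = (l == 0).
Proof.
apply/eqP/eqP => [/setP h|->].
  by apply/ffunP=> i; have := h i; rewrite !inE ffunE => /negbFE/eqP.
by apply/setP=> i; rewrite !inE ffunE.
Qed.

Lemma suppD a b : supp (a + b) = supp a :|: supp b.
Proof. by apply/setP=> i; rewrite !inE ffun_addE addn_eq0 negb_and. Qed.

Lemma addq_eq0 a b : (a + b == 0) = (a == 0) && (b == 0).
Proof. by rewrite -!ht_eq0 htD addn_eq0. Qed.

Lemma addqI a : injective (+%R a).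
Proof.
move=> b c /ffunP h; apply/ffunP => i; have := h i.
by rewrite !ffun_addE => /addnI.
Qed.

Lemma lel_seq l : {s : seq {ffun I -> nat} | uniq s & forall a, (a \in s) = lel a l}.
Proof.
exists (undup [seq p.1 | p <- decomps l]); first exact: undup_uniq.
move=> a; rewrite mem_undup; apply/mapP/idP => [[[x y]]|h].
  by rewrite mem_decomps => /eqP <- -> /=; apply: lel_addr.
by exists (a, dif l a); rewrite // mem_decomps difK.
Qed.

End Exponents.

Section FpsCoef.
Variables (I : finType) (R : comNzRingType).
Implicit Types (f g h : fps I R) (l a b : {ffun I -> nat}).

Lemma fcoef0 l : coef (0 : fps I R) l = 0. Proof. by []. Qed.
Lemma fcoefD f g l : coef (f + g) l = coef f l + coef g l. Proof. by []. Qed.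
Lemma fcoefN f l : coef (- f) l = - coef f l. Proof. by []. Qed.
Lemma fcoefB f g l : coef (f - g) l = coef f l - coef g l. Proof. by []. Qed.
Lemma fcoef1 l : coef (1 : fps I R) l = (l == 0)%:R. Proof. by []. Qed.
Lemma fcoefM f g l : coef (f * g) l = \sum_(p <- decomps l) coef f p.1 * coef g p.2.
Proof. by []. Qed.

Lemma fcoef_sum (T : Type) (s : seq T) (P : pred T) (F : T -> fps I R) l :
  coef (\sum_(x <- s | P x) F x) l = \sum_(x <- s | P x) coef (F x) l.
Proof. by elim/big_rec2: _ => [|x _ y _ <-]; rewrite ?fcoefD. Qed.

Lemma fcoef_monom a l : coef (monom R a) l = (l == a)%:R. Proof. by []. Qed.

Lemma decomps0 : decomps (0 : {ffun I -> nat}) = [:: (0, 0)].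
Proof.
apply: perm_small_eq => //; apply: uniq_perm; rewrite ?decomps_uniq // => -[a b].
by rewrite mem_decomps addq_eq0 inE.
Qed.

Lemma fcoef0M f g : coef (f * g) 0 = coef f 0 * coef g 0.
Proof. by rewrite fcoefM decomps0 big_seq1. Qed.

Lemma eq_decomps l (F G : {ffun I -> nat} -> {ffun I -> nat} -> R) :
  (forall a b, a + b = l -> F a b = G a b) ->
  \sum_(p <- decomps l) F p.1 p.2 = \sum_(p <- decomps l) G p.1 p.2.
Proof.
move=> h; rewrite big_seq [RHS]big_seq; apply: eq_bigr => -[a b].
by rewrite mem_decomps => /eqP /h.
Qed.

Lemma sum_decomps0 l (F : {ffun I -> nat} -> {ffun I -> nat} -> R) :
  (forall a b, a + b = l -> F a b = 0) -> \sum_(p <- decomps l) F p.1 p.2 = 0.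
Proof. by move=> h; rewrite (eq_decomps (G := fun _ _ => 0)) // big1. Qed.

Lemma fcoef_monomM a f l :
  coef (monom R a * f) l = if lel a l then coef f (dif l a) else 0.
Proof.
rewrite fcoefM; case: ifP => h.
  rewrite (bigD1_seq (a, dif l a)) ?decomps_uniq ?mem_decomps ?difK //= eqxx mul1r.
  rewrite big_seq_cond big1 ?addr0 // => -[b c] /=; rewrite mem_decomps => /andP[/eqP e ne].
  case: eqP => [eb|]; rewrite ?mul0r //; move: ne; rewrite eb in e *.
  by rewrite (addqI (etrans e (esym (difK h)))) eqxx.
apply: (@sum_decomps0 l (fun b c => (b == a)%:R * coef f c)) => b c e.
case: eqP => [eb|]; rewrite ?mul0r //.
by rewrite -e -eb lel_addr in h.
Qed.

Lemma monomD a b : monom R (a + b) = monom R a * monom R b.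
Proof.
apply/fpsP => l; rewrite fcoef_monomM !fcoef_monom; case: ifP => h.
  by congr (_%:R); congr nat_of_bool; rewrite -{1}(difK h); apply/eqP/eqP => [/addqI|->].
by case: eqP => // e; rewrite e lel_addr in h.
Qed.

Lemma monom0 : monom R (0 : {ffun I -> nat}) = 1. Proof. by []. Qed.

Lemma fcoef_fpsC (c : R) l : coef (fpsC I c) l = if l == 0 then c else 0. Proof. by []. Qed.

Lemma fcoef_fpsCM (c : R) f l : coef (fpsC I c * f) l = c * coef f l.
Proof.
rewrite fcoefM (bigD1_seq (0, l)) ?decomps_uniq ?mem_decomps ?add0r //= eqxx.
rewrite big_seq_cond big1 ?addr0 // => -[b d] /=; rewrite mem_decomps => /andP[/eqP e ne].
case: eqP => [eb|]; rewrite ?mul0r //.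
by move: ne; rewrite -e eb add0r eqxx.
Qed.

Lemma fpsCD (c d : R) : fpsC I (c + d) = fpsC I c + fpsC I d.
Proof. by apply/fpsP => l; rewrite fcoefD !fcoef_fpsC; case: ifP; rewrite ?addr0. Qed.

Lemma fpsCM (c d : R) : fpsC I (c * d) = fpsC I c * fpsC I d.
Proof. by apply/fpsP => l; rewrite fcoef_fpsCM !fcoef_fpsC; case: ifP; rewrite ?mulr0. Qed.

Lemma fpsC1 : fpsC I (1 : R) = 1.
Proof. by apply/fpsP => l; rewrite fcoef1 fcoef_fpsC; case: ifP. Qed.

Lemma fpsC0 : fpsC I (0 : R) = 0.
Proof. by apply/fpsP => l; rewrite fcoef0 fcoef_fpsC if_same. Qed.

Lemma fpsCX (c : R) n : fpsC I (c ^+ n) = fpsC I c ^+ n.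
Proof. by elim: n => [|n IH]; rewrite ?expr0 ?fpsC1 // !exprS fpsCM IH. Qed.

Lemma fpsC_sum (T : Type) (s : seq T) (P : pred T) (F : T -> R) :
  fpsC I (\sum_(x <- s | P x) F x) = \sum_(x <- s | P x) fpsC I (F x).
Proof. by elim/big_rec2: _ => [|x y z _ <-]; rewrite ?fpsC0 ?fpsCD. Qed.

Lemma fcoefX_low f k l : coef f 0 = 0 -> (ht l < k)%N -> coef (f ^+ k) l = 0.
Proof.
move=> f0; elim: k l => // k IH l lk; rewrite exprS fcoefM.
apply: (@sum_decomps0 l (fun a b => coef f a * coef (f ^+ k) b)) => a b e.
case: (a =P 0) => [->|/eqP/ht_gt0 ha]; first by rewrite f0 mul0r.
rewrite IH ?mulr0 //; move: lk; rewrite -e htD ltnS; apply: leq_trans.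
by rewrite -{1}[ht b]add0n ltn_add2r.
Qed.

(** The inverse is the geometric series in [1 - f]. The k-th power has no terms of height below k,
    so the coefficient at [l] can be read off the partial sum with [(ht l).+1] terms. *)
Lemma fps_unit1 f : coef f 0 = 1 -> f \is a GRing.unit.
Proof.
move=> f1; pose h := 1 - f; pose S n := \sum_(k < n) h ^+ k.
have h0 : coef h 0 = 0 by rewrite /h fcoefB f1 fcoef1 eqxx subrr.
have Sf n : S n * f = 1 - h ^+ n.
  have fE : f = 1 - h by rewrite /h opprB addrC subrK.
  elim: n => [|n IH]; first by rewrite /S big_ord0 mul0r expr0 subrr.
  by rewrite /S big_ord_recr mulrDl /= -/(S n) IH [in X in _ + X]fE exprSr mulrBr mulr1 addrA subrK.
have SE a n : (ht a < n)%N -> coef (S n) a = coef (S (ht a).+1) a.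
  move=> /subnKC <-; elim: (n - _)%N => [|k IH]; first by rewrite addn0.
  by rewrite addnS /S big_ord_recr fcoefD /= -/(S _) IH fcoefX_low ?addr0 // leq_addr.
apply/unitrP; exists (Fps (fun l => coef (S (ht l).+1) l)).
suff e : Fps (fun l => coef (S (ht l).+1) l) * f = 1 by rewrite e mulrC.
apply/fpsP => l; rewrite -[RHS]subr0 -(fcoefX_low h0 (ltnSn (ht l))) -fcoefB -Sf !fcoefM.
apply: (eq_decomps (F := fun a b => coef (Fps (fun l => coef (S (ht l).+1) l)) a * coef f b)
   (G := fun a b => coef (S (ht l).+1) a * coef f b)) => a b e /=.
by rewrite -(SE a (ht l).+1) // -e htD ltnS leq_addr.
Qed.

(** The series without monomials below [l] form an ideal, so this congruence is compatible with
    products and inverses. It serves to replace infinite products over roots by finite ones. *)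
Definition eqle l f g := forall a, lel a l -> coef f a = coef g a.

Lemma eqle_refl l f : eqle l f f. Proof. by []. Qed.
Lemma eqle_sym l f g : eqle l f g -> eqle l g f.
Proof. by move=> h a /h. Qed.
Lemma eqle_trans l f g h : eqle l f g -> eqle l g h -> eqle l f h.
Proof. by move=> h1 h2 a al; rewrite h1 // h2. Qed.

Lemma eqleM l f g f' g' : eqle l f f' -> eqle l g g' -> eqle l (f * g) (f' * g').
Proof.
move=> h k a al; rewrite !fcoefM.
apply: (eq_decomps (F := fun a b => coef f a * coef g b)
   (G := fun a b => coef f' a * coef g' b)) => b c e.
by rewrite h ?k //; apply: lel_trans al; rewrite -e ?lel_addl ?lel_addr.
Qed.

Lemma eqle_prod l (T : eqType) (s : seq T) (P : pred T) (F G : T -> fps I R) :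
  (forall x, x \in s -> P x -> eqle l (F x) (G x)) ->
  eqle l (\prod_(x <- s | P x) F x) (\prod_(x <- s | P x) G x).
Proof.
move=> h; rewrite big_seq_cond [X in eqle _ _ X]big_seq_cond.
elim/big_rec2: _ => // x f g /andP[xs Px] e.
exact: eqleM (h _ xs Px) e.
Qed.

Lemma eqle1X l f k : eqle l f 1 -> eqle l (f ^+ k) 1.
Proof.
move=> h; elim: k => // k IH; rewrite exprS -[X in eqle _ _ X]mulr1; exact: eqleM.
Qed.

Lemma eqle1V l f : eqle l f 1 -> eqle l f^-1 1.
Proof.
move=> h; have u : f \is a GRing.unit by apply: fps_unit1; rewrite h ?lel0 // fcoef1 eqxx.
apply: eqle_sym; rewrite -(mulrV u) -[X in eqle _ _ X]mul1r; exact: eqleM.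
Qed.

Lemma eqle1Z l f (z : int) : eqle l f 1 -> eqle l (f ^ z) 1.
Proof. by move=> h; case: z => n; [|apply: eqle1V]; apply: eqle1X. Qed.

Lemma eqle1_prod l (T : eqType) (s : seq T) (P : pred T) (F : T -> fps I R) :
  (forall x, x \in s -> P x -> eqle l (F x) 1) ->
  eqle l (\prod_(x <- s | P x) F x) 1.
Proof.
move=> h; have := eqle_prod (l := l) (s := s) (P := P) (F := F) (G := fun _ => 1) h.
by rewrite [X in eqle _ _ X]big1 => [h1|x _]; [exact: h1|].
Qed.

End FpsCoef.

(** * Coefficients divisible by powers of 1 - t *)

Section PolyCoef.

Definition tv : Zt := monom int [ffun _ : unit => 1%N].

(** Coefficients of [ZtQ r] are power series in t while the theorem is about [Z[t]]; this embedding
    links the two. *)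
Definition ev (q : {poly int}) : Zt := (map_poly intr q).[tv].

Lemma ev_is_additive : {morph ev : p q / p + q}.
Proof. by move=> p q; rewrite /ev rmorphD hornerD. Qed.
Lemma evN : {morph ev : p / - p}.
Proof. by move=> p; rewrite /ev rmorphN hornerN. Qed.
Lemma evM : {morph ev : p q / p * q}.
Proof. by move=> p q; rewrite /ev rmorphM hornerM. Qed.
Lemma ev0 : ev 0 = 0. Proof. by rewrite /ev rmorph0 horner0. Qed.
Lemma ev1 : ev 1 = 1. Proof. by rewrite /ev rmorph1 hornerC. Qed.
Lemma evX : ev 'X = tv. Proof. by rewrite /ev map_polyX hornerX. Qed.

Lemma tvX n : tv ^+ n = monom int [ffun _ : unit => n].
Proof.
elim: n => [|n IH]; first by rewrite expr0 -monom0; congr monom; apply/ffunP=> i; rewrite !ffunE.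
by rewrite exprS IH -monomD; congr monom; apply/ffunP=> i; rewrite ffun_addE !ffunE.
Qed.

Lemma coef_tvXM n (c : Zt) k : coef (tv ^+ n * c) [ffun _ => k] =
  if (n <= k)%N then coef c [ffun _ => (k - n)%N] else 0.
Proof.
rewrite tvX fcoef_monomM; have -> : lel [ffun _ : unit => n] [ffun _ => k] = (n <= k)%N.
  apply/lelP/idP => [/(_ tt)|h i]; by rewrite !ffunE.
by case: ifP => // _; congr coef; apply/ffunP => i; rewrite !ffunE.
Qed.

Lemma coef_intrM (z : int) (c : Zt) l : coef (z%:~R * c) l = z * coef c l.
Proof.
rewrite mulrzl.
have nat_case n : coef (c *+ n) l = coef c l *+ n.
  by elim: n => [|n IH]; rewrite ?mulr0n // !mulrS fcoefD IH.
case: z => n.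
  by rewrite -pmulrn nat_case -mulr_natl natz.
by rewrite NegzE mulrNz fcoefN -pmulrn nat_case -mulr_natl natz mulNr.
Qed.

Lemma coef_ev q n : coef (ev q) [ffun _ => n] = q`_n.
Proof.
rewrite /ev horner_coef fcoef_sum.
rewrite (eq_bigr (fun i : 'I_ _ => if i == n :> nat then q`_i else 0)); last first.
  move=> i _; rewrite coef_map coef_intrM tvX fcoef_monom.
  have -> : ([ffun=> n] == [ffun _ : unit => val i]) = (val i == n).
    by apply/eqP/eqP => [/ffunP/(_ tt)|->] //; rewrite !ffunE.
  by case: eqP; rewrite ?mulr1 ?mulr0.
rewrite -big_mkcond /=; case: (ltnP n (size (map_poly intr q : {poly Zt}))) => h.
  by rewrite (big_pred1 (Ordinal h)).
rewrite big1 => [|i /eqP e]; last by move: (ltn_ord i); rewrite e ltnNge h.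
have inj : injective (intr : int -> Zt).
  move=> a b e; have := congr1 (fun c => coef (c * 1) 0) e.
  by rewrite !coef_intrM fcoef1 eqxx !mulr1.
by rewrite size_map_inj_poly ?rmorph0 // in h; rewrite nth_default.
Qed.

Lemma ev_inj : injective ev.
Proof. by move=> p q e; apply/polyP => n; rewrite -!coef_ev e. Qed.

Lemma ev_coef (q : {poly int}) : ev q = \sum_(n < size q) (q`_n)%:~R * tv ^+ n.
Proof.
have -> : ev q = ev (\sum_(n < size q) q`_n *: 'X^n) by rewrite -poly_def coefK.
rewrite (big_morph ev ev_is_additive ev0); apply: eq_bigr => i _.
rewrite -mul_polyC evM {1}/ev map_polyC hornerC; congr (_ * _).
by elim: (nat_of_ord i) => [|k IH]; rewrite ?expr0 ?ev1 // !exprS evM evX IH.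
Qed.

(* [eps k] is the image of [(1 - t)^k Z[t]] in [Z[[t]]]. *)
Definition eps (k : nat) (c : Zt) := exists q, c = ev (q * (1 - 'X) ^+ k).

Lemma eps_zero k : eps k 0.
Proof. by exists 0; rewrite mul0r ev0. Qed.

Lemma epsD k c d : eps k c -> eps k d -> eps k (c + d).
Proof. by move=> [p ->] [q ->]; exists (p + q); rewrite mulrDl ev_is_additive. Qed.

Lemma epsN k c : eps k c -> eps k (- c).
Proof. by move=> [p ->]; exists (- p); rewrite mulNr evN. Qed.

Lemma epsB k c d : eps k c -> eps k d -> eps k (c - d).
Proof. by move=> h /epsN; apply: epsD. Qed.

Lemma epsM k l c d : eps k c -> eps l d -> eps (k + l) (c * d).
Proof.
move=> [p ->] [q ->]; exists (p * q); rewrite -evM; congr ev.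
by rewrite exprD; ring.
Qed.

Lemma eps_weak k l c : (l <= k)%N -> eps k c -> eps l c.
Proof.
move=> /subnK <- [p ->]; exists (p * (1 - 'X) ^+ (k - l)).
by rewrite exprD mulrA.
Qed.

Lemma eps_sum k (T : eqType) (s : seq T) (P : pred T) (F : T -> Zt) :
  (forall x, x \in s -> P x -> eps k (F x)) -> eps k (\sum_(x <- s | P x) F x).
Proof.
move=> h; rewrite big_seq_cond; elim/big_rec: _ => [|x c /andP[xs Px]].
  exact: eps_zero.
exact/epsD/h.
Qed.

Lemma eps0_1 : eps 0 1. Proof. by exists 1; rewrite mul1r expr0 ev1. Qed.
Lemma eps0_tv : eps 0 tv. Proof. by exists 'X; rewrite mulr1 evX. Qed.
Lemma eps1_tv : eps 1 (1 - tv).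
Proof. by exists 1; rewrite mul1r expr1 ev_is_additive evN ev1 evX. Qed.

Lemma eps0X c n : eps 0 c -> eps 0 (c ^+ n).
Proof.
move=> h; elim: n => [|n IH]; first exact: eps0_1.
by rewrite exprS; apply: (epsM (k := 0) (l := 0)).
Qed.

Lemma epsMl k c d : eps 0 c -> eps k d -> eps k (c * d).
Proof. by move=> /epsM h /h. Qed.
Lemma epsMr k c d : eps k c -> eps 0 d -> eps k (c * d).
Proof. by rewrite mulrC => h1 h2; apply: epsMl. Qed.

End PolyCoef.

(** * Congruences by total degree *)

Section TotalDegree.
Variable r : nat.
Implicit Types (F G : ZtQ r) (l a b : Qplus r).

Lemma coeft0 l n : coeft (0 : ZtQ r) l n = 0. Proof. by []. Qed.
Lemma coeftD F G l n : coeft (F + G) l n = coeft F l n + coeft G l n. Proof. by []. Qed.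
Lemma coeftN F l n : coeft (- F) l n = - coeft F l n. Proof. by []. Qed.
Lemma coeftB F G l n : coeft (F - G) l n = coeft F l n - coeft G l n. Proof. by []. Qed.
Lemma coeft_sum (T : Type) (s : seq T) (P : pred T) (F : T -> ZtQ r) l n :
  coeft (\sum_(x <- s | P x) F x) l n = \sum_(x <- s | P x) coeft (F x) l n.
Proof. by rewrite /coeft !fcoef_sum. Qed.

Lemma unit_ffun (k : {ffun unit -> nat}) : k = [ffun _ => k tt].
Proof. by apply/ffunP => -[]; rewrite ffunE. Qed.

Lemma coef_Zt_eq (c d : Zt) : (forall n, coef c [ffun _ => n] = coef d [ffun _ => n]) -> c = d.
Proof. by move=> h; apply/fpsP => k; rewrite (unit_ffun k). Qed.

(** Neither grading would do alone: the numerator [t - e^b] of x_b has order 0 in t because of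
    [e^b], and order 0 in e because of t. Its total order is at least 1. *)
Definition ordge (N : nat) F := forall l n, (ht l + n < N)%N -> coeft F l n = 0.

Lemma ordge0 F : ordge 0 F. Proof. by []. Qed.
Lemma ordgeD N F G : ordge N F -> ordge N G -> ordge N (F + G).
Proof. by move=> h k l n d; rewrite coeftD h // k. Qed.
Lemma ordgeN N F : ordge N F -> ordge N (- F).
Proof. by move=> h l n d; rewrite coeftN h // oppr0. Qed.
Lemma ordge_weak M N F : (M <= N)%N -> ordge N F -> ordge M F.
Proof. by move=> h k l n d; apply: k; apply: leq_trans h. Qed.
Lemma ordge_sum N (T : eqType) (s : seq T) (P : pred T) (F : T -> ZtQ r) :
  (forall x, x \in s -> P x -> ordge N (F x)) -> ordge N (\sum_(x <- s | P x) F x).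
Proof.
move=> h; rewrite big_seq_cond; elim/big_rec: _ => [|x c /andP[xs Px] hc] //.
exact/ordgeD/hc/h.
Qed.

Lemma ordgeM M N F G : ordge M F -> ordge N G -> ordge (M + N) (F * G).
Proof.
move=> h k l n d; rewrite /coeft fcoefM fcoef_sum.
apply: (@sum_decomps0 _ int l (fun a b => coef (coef F a * coef G b) [ffun=> n])) => a b e.
rewrite fcoefM; apply: (@sum_decomps0 _ int [ffun=> n] (fun x y => coef (coef F a) x * coef (coef G b) y)).
move=> x y exy; have {exy} : (x tt + y tt = n)%N by rewrite -ffun_addE exy ffunE.
rewrite (unit_ffun x) (unit_ffun y) !ffunE => exy.
case: (ltnP (ht a + x tt) M) => [/h|c1]; first by rewrite /coeft => ->; rewrite mul0r.
case: (ltnP (ht b + y tt) N) => [/k|c2]; first by rewrite /coeft => ->; rewrite mulr0.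
by move: d; rewrite -e -exy htD addnACA ltnNge leq_add.
Qed.

Lemma ordgeMl N F G : ordge N G -> ordge N (F * G).
Proof. by move=> h; have := ordgeM (ordge0 F) h. Qed.
Lemma ordgeMr N F G : ordge N F -> ordge N (F * G).
Proof. by move=> h; rewrite mulrC; apply: ordgeMl. Qed.

Definition eqm N F G := ordge N (F - G).

Lemma eqm_sym N F G : eqm N F G -> eqm N G F.
Proof. by rewrite /eqm => /ordgeN; rewrite opprB. Qed.
Lemma eqm_trans N F G H : eqm N F G -> eqm N G H -> eqm N F H.
Proof. by rewrite /eqm => h k; have := ordgeD h k; rewrite addrA subrK. Qed.
Lemma eqmMl N F G H : eqm N G H -> eqm N (F * G) (F * H).
Proof. by rewrite /eqm -mulrBr; apply: ordgeMl. Qed.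
Lemma eqm_sum N (T : eqType) (s : seq T) (P : pred T) (F G : T -> ZtQ r) :
  (forall x, x \in s -> P x -> eqm N (F x) (G x)) ->
  eqm N (\sum_(x <- s | P x) F x) (\sum_(x <- s | P x) G x).
Proof. by move=> h; rewrite /eqm -sumrB; apply: ordge_sum. Qed.
Lemma eqm_coeft N F G l n : eqm N F G -> (ht l + n < N)%N -> coeft F l n = coeft G l n.
Proof. by move=> h d; apply/eqP; rewrite -subr_eq0 -coeftB h. Qed.
Lemma eqmP N F G : (forall l n, (ht l + n < N)%N -> coeft F l n = coeft G l n) -> eqm N F G.
Proof. by move=> h l n d; rewrite coeftB h // subrr. Qed.

Lemma eqm_widen N (T : eqType) (s1 s2 : seq T) (F : T -> ZtQ r) :
  uniq s1 -> uniq s2 -> {subset s1 <= s2} ->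
  (forall x, x \in s2 -> x \notin s1 -> ordge N (F x)) ->
  eqm N (\sum_(x <- s1) F x) (\sum_(x <- s2) F x).
Proof.
move=> u1 u2 s12 h; rewrite [\sum_(x <- s2) _](bigID (mem s1)) /=.
rewrite [X in X + _](_ : _ = \sum_(x <- s1) F x).
  rewrite /eqm opprD addrA subrr sub0r; apply: ordgeN; exact: ordge_sum.
rewrite -big_filter; apply: perm_big; apply: uniq_perm; rewrite ?filter_uniq //.
by move=> x; rewrite mem_filter; apply/andP/idP => [[]//|xs]; split=> //; apply: s12.
Qed.

Definition restrict (J : {set 'I_r}) F : ZtQ r :=
  Fps (fun l => if supp l \subset J then coef F l else 0).

Lemma coef_restrict J F l : coef (restrict J F) l = if supp l \subset J then coef F l else 0.
Proof. by []. Qed.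

Lemma restrictD J F G : restrict J (F + G) = restrict J F + restrict J G.
Proof. by apply/fpsP=> l; rewrite fcoefD !coef_restrict; case: ifP; rewrite ?addr0. Qed.
Lemma restrict0 J : restrict J 0 = 0.
Proof. by apply/fpsP=> l; rewrite coef_restrict if_same. Qed.
Lemma restrictN J F : restrict J (- F) = - restrict J F.
Proof. by apply/fpsP=> l; rewrite fcoefN !coef_restrict; case: ifP; rewrite ?oppr0. Qed.
Lemma restrict1 J : restrict J 1 = 1.
Proof.
apply/fpsP=> l; rewrite coef_restrict !fcoef1; case: ifP => //; case: eqP => // ->.
by rewrite (eqP (_ : supp 0 == finset.set0)) ?supp_eq0 ?sub0set.
Qed.
(** The support of a sum of exponents is the union of the supports, so a product of monomials
    survives exactly when both monomials do. *)
Lemma restrictM J F G : restrict J (F * G) = restrict J F * restrict J G.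
Proof.
apply/fpsP=> l; rewrite coef_restrict !fcoefM; case: ifP => h.
  apply: (eq_decomps (F := fun a b => coef F a * coef G b)
   (G := fun a b => coef (restrict J F) a * coef (restrict J G) b)) => a b e.
  by move: h; rewrite -e suppD subUset !coef_restrict => /andP[-> ->].
symmetry; apply: (@sum_decomps0 _ _ l (fun a b => coef (restrict J F) a * coef (restrict J G) b)) => a b e.
rewrite !coef_restrict; move: h; rewrite -e suppD subUset.
by case: ifP => [_ /= ->|]; rewrite ?mulr0 ?mul0r.
Qed.
Lemma restrict_fpsC J (c : Zt) : restrict J (fpsC _ c) = fpsC _ c.
Proof.
apply/fpsP=> l; rewrite coef_restrict !fcoef_fpsC; case: ifP => //; case: eqP => // ->.
by rewrite (eqP (_ : supp 0 == finset.set0)) ?supp_eq0 ?sub0set.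
Qed.
Lemma restrict_sum J (T : Type) (s : seq T) (P : pred T) (F : T -> ZtQ r) :
  restrict J (\sum_(x <- s | P x) F x) = \sum_(x <- s | P x) restrict J (F x).
Proof. exact: (big_morph _ (restrictD J) (restrict0 J)). Qed.
Lemma restrict_prod J (T : Type) (s : seq T) (P : pred T) (F : T -> ZtQ r) :
  restrict J (\prod_(x <- s | P x) F x) = \prod_(x <- s | P x) restrict J (F x).
Proof. exact: (big_morph _ (restrictM J) (restrict1 J)). Qed.
Lemma ordge_restrict J N F : ordge N F -> ordge N (restrict J F).
Proof. by move=> h l n d; rewrite /coeft coef_restrict; case: ifP => // _; apply: h. Qed.
Lemma eqm_restrict J N F G : eqm N F G -> eqm N (restrict J F) (restrict J G).
Proof. by rewrite /eqm -restrictN -restrictD; apply: ordge_restrict. Qed.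
End TotalDegree.

(** * From unconditional convergence to finite sums and products *)

Section Convergence.
Variables (r : nat) (T : choiceType) (D : set T) (f : T -> ZtQ r) (F : ZtQ r).

(** Convergence provides a finite set, possibly a different one for each coefficient; enlarging it
    by [X1] changes nothing, and its elements outside [X1] contribute factors congruent to 1. *)
Lemma is_prod_eqle (l : Qplus r) (X1 : {fset T}) :
  is_prod D f F -> (forall x, x \in X1 -> D x) ->
  (forall x, D x -> x \notin X1 -> eqle l (f x) 1) ->
  eqle l F (\prod_(x <- X1) f x).
Proof.
move=> hp X1D h a al; apply/coef_Zt_eq => n.
have [X0 [X0D /(_ (X0 `|` X1)%fset) hX]] := hp a n.
have XD : ([set` (X0 `|` X1)%fset] `<=` D)%classic.
  move=> x /=; rewrite in_fsetU => /orP[/X0D //|/X1D //].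
have /hX/(_ XD) : ([set` X0] `<=` [set` (X0 `|` X1)%fset])%classic.
  by move=> x /= xX; rewrite in_fsetU xX.
rewrite /coeft => <-; congr (coef _ _).
rewrite (bigID (mem X1)) /= -[in RHS](mulr1 (\prod_(x <- X1) f x)).
apply: eqleM al; last first.
  apply: eqle1_prod => x xX xX1; apply: h => //; exact: XD.
rewrite -big_filter (perm_big (enum_fset X1)) // uniq_perm ?filter_uniq ?fset_uniq //.
by move=> x; rewrite mem_filter in_fsetU orbC; case: (x \in X1).
Qed.

Lemma is_sum_eqm N (s : seq T) : uniq s ->
  is_sum D f F -> (forall x, x \in s -> D x) ->
  (forall x, D x -> x \notin s -> ordge N (f x)) ->
  eqm N F (\sum_(x <- s) f x).
Proof.
move=> us hs sD h; apply: eqmP => l n d.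
have [X0 [X0D /(_ (X0 `|` [fset x in s])%fset) hX]] := hs l n.
have XD : ([set` (X0 `|` [fset x in s])%fset] `<=` D)%classic.
  move=> x /=; rewrite in_fsetU in_fset => /orP[/X0D //|/sD //].
have /hX/(_ XD) <- : ([set` X0] `<=` [set` (X0 `|` [fset x in s])%fset])%classic.
  by move=> x /= xX; rewrite in_fsetU xX.
apply/esym/(eqm_coeft _ d)/eqm_widen => //.
  by move=> x xs; rewrite in_fsetU in_fset xs orbT.
by move=> x xX xs; apply: h => //; apply: XD.
Qed.

End Convergence.

(** * Sign-coherence of real roots *)

Section Cone.
Variable r : nat.
Implicit Types (u v : 'cV[int]_r).

Lemma Qplus_add u v : in_Qplus u -> in_Qplus v -> in_Qplus (u + v).
Proof. by move=> h k i; rewrite mxE addr_ge0. Qed.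

Lemma Qplus_scale (c : int) v : 0 <= c -> in_Qplus v -> in_Qplus (c *: v).
Proof. by move=> c0 h i; rewrite mxE mulr_ge0. Qed.

Lemma Qplus_sum (T : Type) (s : seq T) (P : pred T) (F : T -> 'cV[int]_r) :
  (forall x, P x -> in_Qplus (F x)) -> in_Qplus (\sum_(x <- s | P x) F x).
Proof.
move=> h; elim/big_rec: _ => [i|x v Px hv]; first by rewrite mxE.
by apply: Qplus_add => //; apply: h.
Qed.

Lemma Qplus_simple i : in_Qplus (simple_root i : 'cV[int]_r).
Proof. by move=> k; rewrite mxE; case: (_ && _). Qed.

Lemma Qplus_antisym v : in_Qplus v -> in_Qplus (- v) -> v = 0.
Proof.
move=> h k; apply/matrixP => i j; rewrite ord1 mxE; apply/eqP.
by rewrite eq_le h andbT -oppr_ge0; have := k i; rewrite mxE.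
Qed.

Lemma simple_neq0 i : simple_root i != 0 :> 'cV[int]_r.
Proof. by apply/eqP => /matrixP/(_ i 0); rewrite !mxE !eqxx. Qed.

Lemma cV_sum_simple v : v = \sum_i v i 0 *: simple_root i.
Proof.
by rewrite {1}[v]matrix_sum_delta; apply: eq_bigr => i _; rewrite big_ord1.
Qed.

Lemma mx_eq_simple n (x y : 'M[int]_(n, r)) :
  (forall i, x *m simple_root i = y *m simple_root i) -> x = y.
Proof.
move=> h; apply/matrixP => i j; have /matrixP/(_ i 0) := h j.
by rewrite /simple_root -!colE !mxE.
Qed.

Lemma mx_eq_cV n (x y : 'M[int]_(n, r)) : (forall v : 'cV_r, x *m v = y *m v) -> x = y.
Proof. by move=> h; apply: mx_eq_simple. Qed.

End Cone.

(** * Words, length and the rank two case *)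

Section Words.
Variables (r : nat) (A : 'M[int]_r) (hA : gcm A).
Implicit Types (i j : 'I_r) (v : 'cV[int]_r) (s z : seq 'I_r) (w u : 'M[int]_r).
Local Notation a := simple_root.
Local Notation S := (srefl A).
Local Notation W := (word_mx A).

Lemma A_diag i : A i i = 2. Proof. by case: hA. Qed.

Lemma sreflE i v : S i *m v = v - (A *m v) i 0 *: a i.
Proof.
rewrite mulmxBl mul1mx -mulmxA; congr (_ - _); apply/matrixP => k l; rewrite ord1 !mxE.
rewrite (bigD1 i) //= big1 ?addr0; last first.
  by move=> j ji; rewrite mxE (negPf ji) andbF mul0r.
by rewrite !mxE eqxx !andbT mulrC.
Qed.

Lemma A_simple i j : (A *m a j) i 0 = A i j.
Proof. by rewrite -colE mxE. Qed.

Lemma srefl_simple i j : S i *m a j = a j - A i j *: a i.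
Proof. by rewrite sreflE A_simple. Qed.

Lemma srefl_self i : S i *m a i = - a i.
Proof. by rewrite srefl_simple A_diag scaler_nat mulr2n opprD addrA subrr sub0r. Qed.

Lemma srefl_entry i k v : k != i -> (S i *m v) k 0 = v k 0.
Proof. by move=> ki; rewrite sreflE !mxE (negPf ki) mulr0 subr0. Qed.

Lemma sreflK i : S i *m S i = 1%:M.
Proof.
apply: mx_eq_cV => v; rewrite -mulmxA mul1mx [S i *m v]sreflE mulmxBr -scalemxAr srefl_self.
by rewrite sreflE scalerN opprK subrK.
Qed.

Lemma word_nil : W [::] = 1%:M. Proof. by rewrite /word_mx big_nil. Qed.
Lemma word_cons i s : W (i :: s) = S i *m W s. Proof. by rewrite /word_mx big_cons. Qed.
Lemma word_cat s z : W (s ++ z) = W s *m W z. Proof.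
by elim: s => [|i s IH]; rewrite ?word_nil ?mul1mx //= !word_cons IH mulmxA.
Qed.
Lemma word_consE i s v : W (i :: s) *m v = S i *m (W s *m v).
Proof. by rewrite word_cons mulmxA. Qed.
Lemma word1 i : W [:: i] = S i. Proof. by rewrite word_cons word_nil mulmx1. Qed.
Lemma word_rcons s i : W (rcons s i) = W s *m S i.
Proof. by rewrite -cats1 word_cat word1. Qed.

Lemma word_revK s : W s *m W (rev s) = 1%:M.
Proof.
elim: s => [|i s IH]; first by rewrite word_nil mulmx1.
by rewrite rev_cons word_cons word_rcons mulmxA -(mulmxA _ (W s)) IH mulmx1 sreflK.
Qed.

Lemma word_inv s : invmx (W s) = W (rev s).
Proof.
have u : W s \in unitmx by rewrite (mulmx1_unit (word_revK s)).1.
by rewrite -[LHS]mulmx1 -(word_revK s) mulmxA mulVmx // mul1mx.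
Qed.

Lemma weyl_word s : weyl A (W s). Proof. by exists s. Qed.
Lemma weyl1 : weyl A 1%:M. Proof. by exists [::]; rewrite word_nil. Qed.
Lemma weylM u w : weyl A u -> weyl A w -> weyl A (u *m w).
Proof. by move=> [s ->] [z ->]; exists (s ++ z); rewrite word_cat. Qed.
Lemma weyl_srefl i : weyl A (S i). Proof. by exists [:: i]; rewrite word1. Qed.
Lemma weyl_inv w : weyl A w -> weyl A (invmx w).
Proof. by move=> [s ->]; exists (rev s); rewrite word_inv. Qed.
Lemma weyl_unit w : weyl A w -> w \in unitmx.
Proof. by move=> [s ->]; rewrite (mulmx1_unit (word_revK s)).1. Qed.

Lemma weyl_mulVK w v : weyl A w -> invmx w *m (w *m v) = v.
Proof. by move=> /weyl_unit u; rewrite mulmxA mulVmx // mul1mx. Qed.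
Lemma weyl_mulKV w v : weyl A w -> w *m (invmx w *m v) = v.
Proof. by move=> /weyl_unit u; rewrite mulmxA mulmxV // mul1mx. Qed.

Lemma weyl_mul_neq0 w v : weyl A w -> v != 0 -> w *m v != 0.
Proof.
by move=> hw; apply: contraNneq => e; rewrite -(weyl_mulVK v hw) e mulmx0.
Qed.

Local Notation len := (weyl_length A).

Lemma len_word w : weyl A w -> exists2 s, w = W s & size s = len w.
Proof.
move=> [s ws]; rewrite /weyl_length; case: pselect => [e|[]]; last first.
  by exists (size s); apply/asboolP; exists s.
by case: ex_minnP => n /asboolP[z [<- ->]] _; exists z.
Qed.

Lemma len_le s : (len (W s) <= size s)%N.
Proof.
rewrite /weyl_length; case: pselect => [e|//]; case: ex_minnP => n _ h.
by apply: h; apply/asboolP; exists s.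
Qed.

Lemma len1 : len 1%:M = 0%N.
Proof. by apply/eqP; rewrite -leqn0; have := len_le [::]; rewrite word_nil. Qed.

Lemma len_eq0 w : weyl A w -> len w = 0%N -> w = 1%:M.
Proof. by move=> /len_word[s -> <-] /size0nil ->; rewrite word_nil. Qed.

Lemma lenM u w : weyl A u -> weyl A w -> (len (u *m w) <= len u + len w)%N.
Proof.
move=> /len_word[s eu <-] /len_word[z ew <-].
by rewrite eu ew -word_cat -size_cat len_le.
Qed.

Lemma len_srefl_le w i : weyl A w -> (len (w *m S i) <= (len w).+1)%N.
Proof.
move=> hw; apply: leq_trans (lenM hw (weyl_srefl i)) _.
by rewrite -addn1 leq_add2l -word1 len_le.
Qed.

Lemma srefl_reflK w i : w *m S i *m S i = w.
Proof. by rewrite -mulmxA sreflK mulmx1. Qed.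

Lemma len_inv w : weyl A w -> len (invmx w) = len w.
Proof.
have h u : weyl A u -> (len (invmx u) <= len u)%N.
  by move=> /len_word[s -> <-]; rewrite word_inv -[X in (_ <= X)%N]size_rev len_le.
move=> hw; apply/eqP; rewrite eqn_leq h //=.
by rewrite -{1}(invmxK w) h //; apply: weyl_inv.
Qed.

(* The alternating word in [i], [j] with [k] letters and last letter [j]. *)
Fixpoint altw i j k : seq 'I_r :=
  if k is k'.+1 then (if odd k' then i else j) :: altw i j k' else [::].

Lemma altw_rcons i j k : altw i j k.+1 = rcons (altw j i k) j.
Proof.
elim: k => // k IH; rewrite [altw j i k.+1]/= rcons_cons -IH /=.
by case: (odd k).
Qed.

Lemma size_altw i j k : size (altw i j k) = k.
Proof. by elim: k => //= k ->. Qed.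

Lemma altw_sub i j k : all (mem [:: i; j]) (altw i j k).
Proof. by elim: k => //= k ->; rewrite andbT; case: (odd k); rewrite !inE eqxx ?orbT. Qed.

Lemma altw_drop i j n m : exists s, [/\ altw i j (n + m) = s ++ altw i j m,
  size s = n & all (mem [:: i; j]) s].
Proof.
elim: n => [|n [s [e ss sa]]]; first by exists [::].
exists ((if odd (n + m) then i else j) :: s); rewrite addSn /= e ss; split=> //.
by rewrite sa andbT; case: odd; rewrite !inE eqxx ?orbT.
Qed.

Definition comb v i j (x y : int) : 'cV[int]_r := v + x *: a i + y *: a j.

Lemma combC v i j x y : comb v i j x y = comb v j i y x.
Proof. by rewrite /comb addrAC. Qed.

Lemma srefl_comb v i j x y :
  S i *m comb v i j x y = comb v i j (- (A *m v) i 0 - x - A i j * y) y.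
Proof.
rewrite /comb !mulmxDr -!scalemxAr srefl_self srefl_simple sreflE.
by apply/matrixP => k l; rewrite !mxE; ring.
Qed.

Lemma srefl_comb' v i j x y :
  S j *m comb v i j x y = comb v i j x (- (A *m v) j 0 - y - A j i * x).
Proof. by rewrite combC srefl_comb combC. Qed.

Definition pos2 i j v := exists x y : int, [/\ 0 <= x, 0 <= y & v = comb 0 i j x y].

(* If [A i j * A j i >= 4], the inequality between the two coordinates that is
   carried through the induction keeps both of them nonnegative; otherwise the
   braid relation holds, of length 2, 3, 4 or 6. *)
Lemma rank2 i j : i != j ->
  (forall k, pos2 i j (W (altw i j k) *m a i)) \/
  (exists m, (forall k, (k < m.+1)%N -> pos2 i j (W (altw i j k) *m a i)) /\
             W (altw i j m.+1) = W (altw j i m.+1)).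
Proof.
move=> ij; have ji : j != i by rewrite eq_sym.
have [_ hneg hzero] := hA.
have a0 := hneg i j ij; have b0 := hneg j i ji.
have z1 := hzero i j; have z2 := hzero j i.
have start : a i = comb 0 i j 1 0 by rewrite /comb add0r scale1r scale0r addr0.
have si x y : S i *m comb 0 i j x y = comb 0 i j (- x - A i j * y) y.
  by rewrite srefl_comb mulmx0 mxE; congr comb; ring.
have sj x y : S j *m comb 0 i j x y = comb 0 i j x (- y - A j i * x).
  by rewrite srefl_comb' mulmx0 mxE; congr comb; ring.
case: (leP 4 (A i j * A j i)) => hab.
  left => k.
  (* The inequality says that the next reflection does not lower the coordinate it changes. The new
     value is then at least half of the right-hand side, and as the product of the two Cartan
     entries is at least 4, this gives the inequality for the reflection after that. *)
  suff [x [y [x0 y0 e c]]] : exists x y : int, [/\ 0 <= x, 0 <= y,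
      W (altw i j k) *m a i = comb 0 i j x y
    & if odd k then 2 * x <= - A i j * y else 2 * y <= - A j i * x].
    by exists x, y.
  elim: k => [|k [x [y [x0 y0 e c]]]].
    by exists 1, 0; split; rewrite // ?word_nil ?mul1mx //=; lia.
  rewrite /= word_cons -mulmxA e; case: (odd k) c => c.
    by exists (- x - A i j * y), y; rewrite si; split=> //=; nia.
  by exists x, (- y - A j i * x); rewrite sj; split=> //=; nia.
right.
have bnd : (A i j, A j i) \in
    [:: (0, 0); (-1, -1); (-1, -2); (-2, -1); (-1, -3); (-3, -1) : int * int].
  rewrite !inE; have [e|ne] := eqVneq (A i j) 0; first by rewrite e z1.
  have ne' : A j i != 0 by apply: contraNneq ne => /z2 ->.
  move: (A i j) (A j i) a0 b0 hab ne ne' => x y *.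
  have : -4 < x by nia.
  have : -4 < y by nia.
  move=> *; have [|[|]] : x = -1 \/ x = -2 \/ x = -3 by lia.
  - move=> ->; have [|[|]] : y = -1 \/ y = -2 \/ y = -3 by lia.
    + by move=> ->.
    + by move=> ->.
    + by move=> ->.
  - move=> e; have -> : y = -1 by nia.
    by rewrite e.
  - move=> e; have -> : y = -1 by nia.
    by rewrite e.
have wi v x y := srefl_comb v i j x y.
have wj v x y := srefl_comb' v i j x y.
(* The braid relation must hold on all of Q, not only on the span of the two simple roots. So [v] is
   kept as an opaque base point and only the coefficients of [a_i] and [a_j] are followed. *)
have startv v : v = comb v i j 0 0 by rewrite /comb !scale0r !addr0.
rewrite !inE !xpair_eqE in bnd.
case/or4P: bnd => [| | |/or3P[]] /andP[/eqP ha /eqP hb];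
  [exists 1%N|exists 2%N|exists 3%N|exists 3%N|exists 5%N|exists 5%N];
  split => [[|[|[|[|[|[|k]]]]]] // _|].
all: try by rewrite /= ?word_consE word_nil ?mul1mx start ?(sj, si) ?hb ?ha;
  do 2 eexists; split; last reflexivity; lia.
all: apply: mx_eq_cV => v; rewrite /= !word_consE word_nil !mul1mx.
all: by move: (startv v); set c := comb _ _ _ _ _ => e;
  rewrite e /c !(wi, wj) ha hb; congr comb; ring.
Qed.

(** Two equal adjacent letters would cancel, so a shortest word alternates; as it does not end in
    [i], its last letter, if any, is [j]. *)
Lemma altw_min i j z : all (mem [:: i; j]) z ->
  (forall z', all (mem [:: i; j]) z' -> W z' = W z -> (size z <= size z')%N) ->
  (forall z', z <> rcons z' i) -> z = altw i j (size z).
Proof.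
elim/last_ind: z i j => // z c IH i j; rewrite all_rcons => /andP[]; rewrite !inE.
move=> /orP[/eqP-> _ _ /(_ z)//|/eqP -> az zmin _].
have sw x : all (mem [:: i; j]) x = all (mem [:: j; i]) x.
  by apply: eq_all => k; rewrite !inE orbC.
rewrite size_rcons altw_rcons -IH -?sw // => [z' az' e|z' e].
  rewrite -ltnS -(size_rcons z j) -(size_rcons z' j); apply: zmin.
    by rewrite all_rcons sw az' !inE eqxx orbT.
  by rewrite !word_rcons e.
move: az (zmin z'); rewrite e all_rcons => /andP[_ az'] /(_ az').
rewrite !word_rcons srefl_reflK => /(_ erefl).
by rewrite !size_rcons => /ltnW; rewrite ltnn.
Qed.

(* Write [w = v z] with [z] a word in [i] and the last letter [j] of a reduced
   word of [w], and [len v] minimal: then [v a_i] and [v a_j] are positive by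
   induction and the claim reduces to the rank 2 case. *)
Theorem len_pos w i : weyl A w -> (len w <= len (w *m S i))%N -> in_Qplus (w *m a i).
Proof.
move: {2}(len w) (erefl (len w)) => n; elim/ltn_ind: n w i => n IH w i lw hw hi.
have [s ws ss] := len_word hw.
case/lastP: s ws ss => [|s j] ws ss.
  by rewrite ws word_nil mul1mx; apply: Qplus_simple.
have ij : i != j.
  apply: contraTneq hi => ->; rewrite ws word_rcons srefl_reflK -ltnNge -word_rcons -ws -ss.
  by rewrite size_rcons ltnS len_le.
pose P k := `[< exists (v : 'M[int]_r) z, [/\ weyl A v, all (mem [:: i; j]) z, w = v *m W z,
   (len v + size z <= len w)%N & len v = k] >].
have exP : exists k, P k.
  exists (len (W s)); apply/asboolP; exists (W s), [:: j]; split=> //.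
  - exact: weyl_word.
  - by rewrite /= !inE eqxx orbT.
  - by rewrite word1 ws word_rcons.
  - by rewrite -ss size_rcons addn1 ltnS len_le.
have {exP} [k0 /asboolP[v [z0 [hv az0 e0 l0 lv]]] kmin] := ex_minnP exP.
have vlt : (len v < n)%N.
  rewrite lv -lw -ss size_rcons ltnS; apply: leq_trans (len_le s); apply: kmin.
  apply/asboolP; exists (W s), [:: j]; split=> //.
  - exact: weyl_word.
  - by rewrite /= !inE eqxx orbT.
  - by rewrite word1 ws word_rcons.
  - by rewrite -ss size_rcons addn1 ltnS len_le.
(* If [v s_c] were shorter than [v], moving the letter [c] from [v] to the word would contradict the
   minimality of [v]. *)
have vpos c : c \in [:: i; j] -> in_Qplus (v *m a c).
  move=> hc; apply: (IH (len v)) => //; rewrite leqNgt; apply/negP => lt.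
  suff /kmin : P (len (v *m S c)) by rewrite -lv leqNgt lt.
  apply/asboolP; exists (v *m S c), (c :: z0); split=> //.
  - exact/weylM/weyl_srefl.
  - by rewrite /= az0 andbT.
  - by rewrite word_cons mulmxA srefl_reflK.
  - by apply: leq_trans l0; rewrite /= addnS -addSn leq_add2r.
pose Q k := `[< exists z, [/\ all (mem [:: i; j]) z, w = v *m W z & size z = k] >].
have exQ : exists k, Q k by exists (size z0); apply/asboolP; exists z0.
have {exQ} [k1 /asboolP[z [az e sz]] zmin] := ex_minnP exQ.
have l1 : (len v + size z <= len w)%N.
  apply: leq_trans l0; rewrite leq_add2l sz; apply: zmin; apply/asboolP; by exists z0.
(* A shorter word here would make [w s_i] shorter than [w], against the assumption on [i]. *)
have short z' : all (mem [:: i; j]) z' -> w *m S i = v *m W z' -> (size z <= size z')%N.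
  move=> _ e'; move: hi; rewrite e' => hi; have := leq_trans l1 hi.
  have := lenM hv (weyl_word z'); have := len_le z'; lia.
have zalt : z = altw i j (size z).
  apply: altw_min => // [z' az' e'|z' e'].
    by rewrite sz; apply: zmin; apply/asboolP; exists z'; rewrite e'.
  have az' : all (mem [:: i; j]) z' by move: az; rewrite e' all_rcons => /andP[].
  have := short z' az'; rewrite e e' word_rcons -mulmxA srefl_reflK size_rcons ltnn.
  by move=> /(_ erefl).
have conclude : pos2 i j (W z *m a i) -> in_Qplus (w *m a i).
  move=> [x [y [x0 y0 ez]]]; rewrite e -mulmxA ez /comb add0r mulmxDr -!scalemxAr.
  by apply: Qplus_add; apply: Qplus_scale => //; apply: vpos; rewrite !inE eqxx ?orbT.
case: (rank2 ij) => [h|[m [h braid]]]; first by apply: conclude; rewrite zalt.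
case: (ltnP (size z) m.+1) => hm; first by apply: conclude; rewrite zalt; apply: h.
have [s' [es ss' as']] := altw_drop i j (size z - m.+1) m.+1.
(* A word at least as long as the braid relation can be rewritten to end in [i]. Cancelling this
   letter expresses [w s_i] by a word that [short] excludes. *)
have ez : W z = W (s' ++ altw i j m) *m S i.
  rewrite zalt -(subnK hm) es word_cat braid altw_rcons word_rcons mulmxA.
  by rewrite word_cat.
have /short : all (mem [:: i; j]) (s' ++ altw i j m) by rewrite all_cat as' altw_sub.
rewrite e ez -mulmxA srefl_reflK size_cat size_altw ss' => /(_ erefl); lia.
Qed.

End Words.

(** * Inversions and parabolic subgroups *)

Section ToQ.
Variable r : nat.
Implicit Types (b c l : Qplus r) (v : 'cV[int]_r).

Lemma toQE l i : toQ l i 0 = (l i)%:Z. Proof. by rewrite mxE. Qed.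

Lemma toQD b c : toQ (b + c) = toQ b + toQ c.
Proof. by apply/matrixP=> i j; rewrite ord1 !mxE ffun_addE PoszD. Qed.

Lemma toQ0 : toQ (0 : Qplus r) = 0.
Proof. by apply/matrixP=> i j; rewrite ord1 !mxE ffunE. Qed.

Lemma toQ_pos l : in_Qplus (toQ l). Proof. by move=> i; rewrite toQE. Qed.

Lemma toQ_inj : injective (@toQ r).
Proof.
by move=> b c /matrixP e; apply/ffunP=> i; have := e i 0; rewrite !toQE => -[].
Qed.

Lemma toQ_eq0 l : (toQ l == 0) = (l == 0).
Proof. by rewrite -toQ0 (inj_eq toQ_inj). Qed.

Lemma abs_rootK v : in_Qplus v -> toQ (abs_root v) = v.
Proof. by move=> h; apply/matrixP=> i j; rewrite ord1 toQE ffunE gez0_abs. Qed.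

Lemma toQK l : abs_root (toQ l) = l.
Proof. by apply/toQ_inj/abs_rootK/toQ_pos. Qed.

Lemma abs_rootN v : abs_root (- v) = abs_root v.
Proof. by apply/ffunP=> i; rewrite !ffunE mxE abszN. Qed.

Definition simpleQ (i : 'I_r) : Qplus r := [ffun k => nat_of_bool (k == i)].

Lemma toQ_simpleQ i : toQ (simpleQ i) = simple_root i.
Proof. by apply/matrixP=> k j; rewrite ord1 toQE !mxE ffunE eqxx andbT; case: (k == i). Qed.

Lemma toQ_supp l (J : {set 'I_r}) :
  supp l \subset J <-> (forall k, k \notin J -> toQ l k 0 = 0).
Proof.
split=> [/fintype.subsetP h k kJ|h].
  by rewrite toQE; have := contra (h k) kJ; rewrite inE negbK => /eqP ->.
apply/fintype.subsetP => k; rewrite inE; apply: contraNT => /h.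
by rewrite toQE => -[->].
Qed.

End ToQ.

Section Inversions.
Variables (r : nat) (A : 'M[int]_r) (hA : gcm A).
Implicit Types (i j : 'I_r) (v : 'cV[int]_r) (w u x y : 'M[int]_r) (b c : Qplus r)
  (I J : {set 'I_r}).
Local Notation a := simple_root.
Local Notation S := (srefl A).
Local Notation W := (word_mx A).
Local Notation len := (weyl_length A).
Local Notation posrt := (pos_real_root A).

Lemma weyl_simple_neq0 w i : weyl A w -> w *m a i != 0.
Proof. by move=> hw; apply: weyl_mul_neq0 hw (simple_neq0 i). Qed.

Lemma len_up w i : weyl A w -> in_Qplus (w *m a i) -> len (w *m S i) = (len w).+1.
Proof.
move=> hw h; apply/eqP; rewrite eqn_leq len_srefl_le //=; rewrite ltnNge; apply/negP => le.
have := @len_pos r A hA (w *m S i) i (weylM hw (weyl_srefl A i)).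
rewrite srefl_reflK // => /(_ le); rewrite -mulmxA srefl_self // mulmxN => h'.
by move/eqP: (weyl_simple_neq0 i hw); apply; apply: Qplus_antisym.
Qed.

Lemma root_sign w i : weyl A w -> in_Qplus (w *m a i) \/ in_Qplus (- (w *m a i)).
Proof.
move=> hw; case: (leqP (len w) (len (w *m S i))) => h; first by left; apply: (len_pos hA hw h).
right; rewrite -mulmxN -(srefl_self hA) mulmxA; apply: (len_pos hA).
  exact/weylM/weyl_srefl.
by rewrite srefl_reflK // ltnW.
Qed.

Lemma len_down w i : weyl A w -> in_Qplus (- (w *m a i)) -> len w = (len (w *m S i)).+1.
Proof.
move=> hw h; rewrite -(@len_up _ i) ?srefl_reflK //; first exact/weylM/weyl_srefl.
by rewrite -mulmxA srefl_self // mulmxN.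
Qed.

Lemma weyl_last w : weyl A w -> w <> 1%:M ->
  exists x i, [/\ weyl A x, w = x *m S i, len w = (len x).+1 & in_Qplus (x *m a i)].
Proof.
move=> hw w1; have [s ws ss] := len_word hw.
case/lastP: s ws ss => [|s i] ws ss; first by rewrite ws word_nil in w1.
exists (W s), i; have hs := weyl_word A s; rewrite -word_rcons -ws.
have e : len w = (len (W s)).+1.
  apply/eqP; rewrite eqn_leq ws word_rcons len_srefl_le //= -word_rcons -ws -ss.
  by rewrite size_rcons ltnS len_le.
by split=> //; apply: (len_pos hA); rewrite // -word_rcons -ws e.
Qed.

Lemma weyl_descent w : weyl A w -> w <> 1%:M -> exists i, in_Qplus (- (w *m a i)).
Proof.
move=> hw /(weyl_last hw)[x [i [_ -> _ h]]]; exists i.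
by rewrite -mulmxA srefl_self // mulmxN opprK.
Qed.

Lemma posrt_simpleQ i : posrt (simpleQ i).
Proof. by exists 1%:M, i; rewrite mul1mx toQ_simpleQ; split=> //; apply: weyl1. Qed.

Lemma posrt_sign w b : weyl A w -> posrt b ->
  in_Qplus (w *m toQ b) \/ in_Qplus (- (w *m toQ b)).
Proof.
by move=> hw [x [i [hx ->]]]; rewrite mulmxA; apply: root_sign; apply: weylM.
Qed.

Lemma posrt_neq0 b : posrt b -> toQ b != 0.
Proof. by move=> [x [i [hx ->]]]; apply: weyl_simple_neq0. Qed.

Lemma posrt_mul w b : weyl A w -> posrt b -> posrt (abs_root (w *m toQ b)).
Proof.
move=> hw hb; have [x [i [hx e]]] := hb.
case: (posrt_sign hw hb) => h.
  by exists (w *m x), i; rewrite abs_rootK // e mulmxA; split=> //; apply: weylM.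
exists (w *m x *m S i), i; rewrite -abs_rootN abs_rootK // e -!mulmxA srefl_self //.
by rewrite !mulmxN; split=> //; rewrite mulmxA; apply: weylM (weylM hw hx) (weyl_srefl A i).
Qed.

Definition isInv w b := posrt b /\ in_Qplus (- (invmx w *m toQ b)).

Lemma isInvN w b : weyl A w -> posrt b -> ~ isInv w b -> in_Qplus (invmx w *m toQ b).
Proof. by move=> hw hb h; case: (posrt_sign (weyl_inv hA hw) hb) => // h'; case: h. Qed.

Lemma isInv_contra w b : weyl A w -> isInv w b -> in_Qplus (invmx w *m toQ b) -> False.
Proof.
move=> hw [hb h] h'; have := weyl_mul_neq0 hA (weyl_inv hA hw) (posrt_neq0 hb).
by rewrite (Qplus_antisym h' h) eqxx.
Qed.

Lemma isInv1 b : ~ isInv 1%:M b.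
Proof.
move=> h; apply: (isInv_contra (weyl1 A) h); rewrite invmx1 mul1mx; exact: toQ_pos.
Qed.

(** Since [s_i] changes only the coordinate [i], the other coordinates of [c] must vanish. So [c] is
    a multiple of [a_i], and the multiple is 1 because some Weyl group element carries [c] to a
    simple root, which has an entry 1. *)
Lemma isInv_srefl i c : isInv (S i) c -> c = simpleQ i.
Proof.
have iS : invmx (S i) = S i by rewrite -(word1 A i) word_inv // word1.
move=> [[x [k [hx e]]]]; rewrite iS => h.
have ci : toQ c = toQ c i 0 *: a i.
  apply/matrixP => j l; rewrite ord1 [RHS]mxE [a i j 0]mxE eqxx andbT.
  case: eqP => [->|/eqP ji]; rewrite ?mulr1 // mulr0; apply/eqP.
  rewrite eq_le toQ_pos andbT -oppr_ge0.
  by have := h j; rewrite mxE srefl_entry.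
apply: toQ_inj; rewrite toQ_simpleQ ci; suff -> : toQ c i 0 = 1 by rewrite scale1r.
have e1 : (invmx x *m toQ c) k 0 = 1 by rewrite e (weyl_mulVK hA _ hx) !mxE !eqxx.
rewrite ci -scalemxAr mxE toQE in e1; rewrite toQE.
move: e1 => /(congr1 absz); rewrite abszM /= => /eqP.
by rewrite muln_eq1 => /andP[/eqP -> _].
Qed.

(** The hypothesis prevents cancellation: if [u^-1 b] is negative, then [- u^-1 b] is no inversion
    of [y], because [u] sends it to [- b]; hence [y^-1] keeps [u^-1 b] negative. *)
Lemma isInv_mul u y b : weyl A u -> weyl A y ->
  (forall c, isInv y c -> in_Qplus (u *m toQ c)) ->
  isInv (u *m y) b <-> isInv u b \/ exists2 c, isInv y c & toQ b = u *m toQ c.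
Proof.
move=> hu hy hyp; have iuy : invmx (u *m y) = invmx y *m invmx u.
  rewrite -[LHS]mulmx1 -[X in _ *m X](mulmxV (weyl_unit hA hu)).
  rewrite -[X in _ *m (X *m _)](mulmx1 u) -[X in _ *m (_ *m X *m _)](mulmxV (weyl_unit hA hy)).
  by rewrite !mulmxA -(mulmxA _ u y) mulVmx ?mul1mx // (weyl_unit hA (weylM hu hy)).
rewrite /isInv iuy; split=> [[hb]|].
  rewrite -mulmxA => h; case: (posrt_sign (weyl_inv hA hu) hb) => h'; last by left.
  right; exists (abs_root (invmx u *m toQ b)); last by rewrite abs_rootK // (weyl_mulKV hA).
  by split; rewrite ?abs_rootK //; apply: posrt_mul => //; apply: weyl_inv.
case=> [[hb h]|[c [hc h] e]].
  split=> //; rewrite -mulmxA; set d := invmx u *m toQ b.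
  have hd : posrt (abs_root d) by apply: posrt_mul => //; apply: weyl_inv.
  have ed : toQ (abs_root d) = - d by rewrite -abs_rootN abs_rootK.
  rewrite -mulmxN -ed; apply: isInvN => // /hyp; rewrite ed mulmxN (weyl_mulKV hA) // => hn.
  by have := posrt_neq0 hb; rewrite (Qplus_antisym (@toQ_pos _ b) hn) eqxx.
split; last by rewrite e -mulmxA (weyl_mulVK hA).
have := posrt_mul hu hc; rewrite -e toQK //.
Qed.

Lemma isInv_disj u y c : weyl A u -> isInv y c -> in_Qplus (u *m toQ c) ->
  ~ isInv u (abs_root (u *m toQ c)).
Proof.
move=> hu _ h h'; apply: (isInv_contra hu h'); rewrite abs_rootK // (weyl_mulVK hA) //.
exact: toQ_pos.
Qed.

(** Induction along a reduced word: appending the letter [i] to [x] adds the single inversion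
    [x a_i] and keeps the others. *)
Lemma inv_list w : weyl A w ->
  exists s : seq (Qplus r), [/\ uniq s, forall b, b \in s <-> isInv w b & size s = len w].
Proof.
move: {2}(len w) (erefl (len w)) => n; elim: n w => [|n IH] w lw hw.
  have -> := len_eq0 hw lw; exists [::]; rewrite len1; split=> // b.
  by rewrite in_nil; split=> // /isInv1.
have [|x [i [hx wx lx pos]]] := weyl_last hw; first by move=> w1; rewrite w1 len1 in lw.
have [||s [us hs ss]] := IH x => //; first by move: lx; rewrite lw => -[].
have yp c : isInv (S i) c -> in_Qplus (x *m toQ c).
  by move/isInv_srefl ->; rewrite toQ_simpleQ.
have invi : isInv (S i) (simpleQ i).
  split; first exact: posrt_simpleQ.
  by rewrite -(word1 A i) word_inv // word1 toQ_simpleQ srefl_self // opprK; apply: Qplus_simple.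
have mulE b := isInv_mul b hx (weyl_srefl A i) yp.
exists (abs_root (x *m toQ (simpleQ i)) :: s); split=> [|b|].
- rewrite /= us andbT; apply/negP => /hs; apply: (isInv_disj hx invi).
  by rewrite toQ_simpleQ.
- rewrite wx mulE inE; split.
    case/orP=> [/eqP ->|/hs]; last by left.
    by right; exists (simpleQ i); rewrite // abs_rootK // toQ_simpleQ.
  case=> [/hs ->|[c /isInv_srefl -> e]]; rewrite ?orbT //.
  by rewrite -e toQK eqxx.
- by rewrite /= ss lx.
Qed.

Definition invs w : seq (Qplus r) :=
  if pselect (exists s : seq (Qplus r), [/\ uniq s, forall b, b \in s <-> isInv w b & size s = len w])
  is left e then projT1 (cid e) else [::].

Lemma invsP w : weyl A w ->
  [/\ uniq (invs w), forall b, b \in invs w <-> isInv w b & size (invs w) = len w].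
Proof.
move=> /inv_list h; rewrite /invs; case: pselect => [e|/(_ h)//]; exact: projT2 (cid e).
Qed.

Lemma invs_uniq w : weyl A w -> uniq (invs w). Proof. by case/invsP. Qed.
Lemma invs_in w b : weyl A w -> b \in invs w <-> isInv w b.
Proof. by case/invsP. Qed.
Lemma invs_size w : weyl A w -> size (invs w) = len w. Proof. by case/invsP. Qed.

Lemma invs_mul u y : weyl A u -> weyl A y ->
  (forall c, isInv y c -> in_Qplus (u *m toQ c)) ->
  perm_eq (invs (u *m y)) (invs u ++ [seq abs_root (u *m toQ c) | c <- invs y]).
Proof.
move=> hu hy hyp; have huy := weylM hu hy; apply: uniq_perm; rewrite ?invs_uniq //.
  rewrite cat_uniq invs_uniq // map_inj_in_uniq ?invs_uniq ?andbT //=.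
    apply/hasPn => _ /mapP[c /(invs_in c hy) hc ->]; apply/negP => /(invs_in _ hu).
    by apply: isInv_disj hc (hyp _ hc).
  move=> c d /(invs_in _ hy)/hyp hc /(invs_in _ hy)/hyp hd e.
  apply: toQ_inj; rewrite -(weyl_mulVK hA (toQ c) hu) -(weyl_mulVK hA (toQ d) hu).
  by rewrite -(abs_rootK hc) -(abs_rootK hd) e.
move=> b; rewrite mem_cat; apply/idP/orP.
  move/(invs_in _ huy)/(isInv_mul _ hu hy hyp) => [/(invs_in _ hu)|[c hc e]]; first by left.
  by right; apply/mapP; exists c; [apply/invs_in|rewrite -e toQK].
move=> h; apply/(invs_in _ huy)/(isInv_mul _ hu hy hyp); case: h => [/(invs_in _ hu)|]; first by left.
move=> /mapP[c /(invs_in _ hy) hc ->]; right; exists c => //; rewrite abs_rootK //; exact: hyp.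
Qed.

Definition inW J w := exists2 s, all (mem J) s & w = W s.

Lemma inW_weyl J w : inW J w -> weyl A w.
Proof. by move=> [s _ ->]; apply: weyl_word. Qed.
Lemma inWT w : weyl A w -> inW [set: 'I_r] w.
Proof. by move=> [s ->]; exists s => //; apply/allP => i; rewrite inE. Qed.
Lemma inW1 J : inW J 1%:M. Proof. by exists [::]; rewrite ?word_nil. Qed.
Lemma inWM J u w : inW J u -> inW J w -> inW J (u *m w).
Proof. by move=> [s hs ->] [z height ->]; exists (s ++ z); rewrite ?word_cat // all_cat hs. Qed.
Lemma inW_srefl J i : i \in J -> inW J (S i).
Proof. by move=> iJ; exists [:: i]; rewrite ?word1 //= iJ. Qed.
Lemma inW_inv J w : inW J w -> inW J (invmx w).
Proof. by move=> [s hs ->]; exists (rev s); rewrite ?word_inv // all_rev. Qed.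
Lemma inW_sub I J w : J \subset I -> inW J w -> inW I w.
Proof.
move=> /fintype.subsetP JI [s /allP hs ->]; exists s => //.
by apply/allP => i /hs /JI.
Qed.

Lemma inW_entry J w k v : inW J w -> k \notin J -> (w *m v) k 0 = v k 0.
Proof.
move=> [s + ->] kJ; elim: s => [|i s IH]; first by rewrite word_nil mul1mx.
move=> /= /andP[iJ /IH e]; rewrite word_consE srefl_entry //.
by apply: contraNneq kJ => ->.
Qed.

Lemma inW_ascent J w k : inW J w -> k \notin J -> in_Qplus (w *m a k).
Proof.
move=> hw kJ; case: (root_sign k (inW_weyl hw)) => // /(_ k).
by rewrite mxE (inW_entry _ hw kJ) !mxE !eqxx.
Qed.

(** Simple roots outside [J] stay positive under [W_J], which leaves their own coordinate equal to
    1; so [w] has no descent at all. *)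
Lemma inW_triv J w : inW J w -> (forall j, j \in J -> in_Qplus (w *m a j)) -> w = 1%:M.
Proof.
move=> hw h; apply: contrapT => /(weyl_descent (inW_weyl hw))[i hi].
have hi' : in_Qplus (w *m a i).
  by case: (boolP (i \in J)) => [/h|] //; apply: inW_ascent.
by have := weyl_simple_neq0 i (inW_weyl hw); rewrite (Qplus_antisym hi' hi) eqxx.
Qed.

(** For [u] in W this characterises the shortest element of the coset [u W_J]. Stated through roots,
    it gives at once the positivity of [u] on the cone spanned by [J]. *)
Definition minJ J u := forall j, j \in J -> in_Qplus (u *m a j).

Lemma minJ_pos J u v : minJ J u -> in_Qplus v -> (forall k, k \notin J -> v k 0 = 0) ->
  in_Qplus (u *m v).
Proof.
move=> hu hv h; rewrite (cV_sum_simple v) mulmx_sumr; apply: Qplus_sum => i _.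
rewrite -scalemxAr; case: (boolP (i \in J)) => [/hu|/h ->]; first exact: Qplus_scale.
by rewrite scale0r => k; rewrite mxE.
Qed.

(** As long as some [j] in [J] is a descent of [w], split off [s_j] on the right; the length drops
    each time. *)
Lemma inW_factor I J w : J \subset I -> inW I w ->
  exists u y, [/\ inW I u, minJ J u, inW J y & w = u *m y].
Proof.
move=> JI; move: {2}(len w) (erefl (len w)) => n; elim/ltn_ind: n w => n IH w lw hw.
case: (pselect (minJ J w)) => [h|].
  by exists w, 1%:M; rewrite mulmx1; split=> //; apply: inW1.
move=> /existsNP[j /not_implyP[jJ hj]]; have hww := inW_weyl hw.
have hj' : in_Qplus (- (w *m a j)) by case: (root_sign j hww).
have sI : inW I (S j) by apply: inW_sub JI (inW_srefl jJ).
have [||u [y [hu mu hy e]]] := IH (len (w *m S j)) _ (w *m S j) erefl.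
- by rewrite -lw (len_down hww hj').
- exact: inWM.
exists u, (y *m S j); split=> //; first exact: inWM hy (inW_srefl jJ).
by rewrite mulmxA -e srefl_reflK.
Qed.

(** With [x = y' y^-1] in [W_J] one has [u = u' x]. If [x] made some [a_j] with [j] in [J] negative,
    so would [u], since [u'] preserves signs on the span of [J]; hence [x = 1]. *)
Lemma inW_factor_uniq J u u' y y' : weyl A u -> weyl A u' -> minJ J u -> minJ J u' ->
  inW J y -> inW J y' -> u *m y = u' *m y' -> u = u' /\ y = y'.
Proof.
move=> hu hu' mu mu' hy hy' e; pose x := y' *m invmx y.
have hx : inW J x by apply: inWM hy' (inW_inv hy).
have ux : u = u' *m x.
  by rewrite mulmxA -e -mulmxA mulmxV ?mulmx1 // (weyl_unit hA (inW_weyl hy)).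
have x1 : x = 1%:M.
  apply: (inW_triv hx) => j jJ; case: (root_sign j (inW_weyl hx)) => // h.
  have := weyl_simple_neq0 j hu; rewrite (Qplus_antisym (mu j jJ)) ?eqxx //.
  rewrite ux -mulmxA -mulmxN; apply: (minJ_pos mu' h) => k kJ.
  rewrite mxE (inW_entry _ hx kJ) mxE; case: eqP => [kj|]; rewrite ?oppr0 //.
  by rewrite kj jJ in kJ.
split; first by rewrite ux x1 mulmx1.
by rewrite -[LHS]mul1mx -x1 /x -mulmxA mulVmx ?mulmx1 // (weyl_unit hA (inW_weyl hy)).
Qed.

Lemma isInv_supp J y c : inW J y -> isInv y c -> supp c \subset J.
Proof.
move=> hy [_ h]; apply/toQ_supp => k kJ; apply/eqP; rewrite eq_le toQ_pos andbT.
by have := h k; rewrite mxE (inW_entry _ (inW_inv hy) kJ) oppr_ge0.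
Qed.

Lemma minJ_inv J u y c : minJ J u -> inW J y -> isInv y c -> in_Qplus (u *m toQ c).
Proof.
move=> mu hy /(isInv_supp hy)/toQ_supp hc; apply: minJ_pos mu (@toQ_pos _ c) hc.
Qed.

Lemma len_factor J u y : weyl A u -> minJ J u -> inW J y -> len (u *m y) = (len u + len y)%N.
Proof.
move=> hu mu hy; have hyw := inW_weyl hy.
rewrite -!invs_size //; last exact: weylM.
by rewrite (perm_size (invs_mul hu hyw _)) ?size_cat ?size_map // => c; apply: minJ_inv mu hy.
Qed.

(** The inversions of [(u y)^-1] are the positive real roots made negative by [u y]. On roots
    supported in [J] the factor [y] stays in the span of [J], where [u] preserves signs. *)
Lemma invs_inv_factor J u y : weyl A u -> minJ J u -> inW J y ->
  perm_eq [seq b <- invs (invmx (u *m y)) | supp b \subset J] (invs (invmx y)).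
Proof.
move=> hu mu hy; have hyw := inW_weyl hy; have hw := weyl_inv hA (weylM hu hyw).
apply: uniq_perm; rewrite ?filter_uniq ?invs_uniq //; first exact: weyl_inv.
move=> b; rewrite mem_filter.
have key : supp b \subset J -> posrt b ->
   (in_Qplus (- (y *m toQ b)) <-> in_Qplus (- (u *m y *m toQ b))).
  move=> /toQ_supp sb hb.
  have sy k : k \notin J -> (y *m toQ b) k 0 = 0.
    by move=> kJ; rewrite (inW_entry _ hy kJ) sb.
  rewrite -mulmxA; split=> h.
    rewrite -mulmxN; apply: (minJ_pos mu h) => k kJ; by rewrite mxE sy ?oppr0.
  case: (posrt_sign hyw hb) => // h'; have := minJ_pos mu h' sy => h''.
  have := weyl_mul_neq0 hA hu (weyl_mul_neq0 hA hyw (posrt_neq0 hb)).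
  by rewrite (Qplus_antisym h'' h) eqxx.
apply/andP/idP.
  move=> [sb /(invs_in _ hw)[hb]]; rewrite invmxK => /(key sb hb) h.
  by apply/(invs_in _ (weyl_inv hA hyw)); split; rewrite ?invmxK.
move=> /(invs_in _ (weyl_inv hA hyw)) h; have sb := isInv_supp (inW_inv hy) h.
case: h => hb; rewrite invmxK => /(key sb hb) h.
by split=> //; apply/(invs_in _ hw); split; rewrite ?invmxK.
Qed.

End Inversions.

(** * Products and inverses of series with coefficients divisible by powers of 1 - t *)

Section FpsSplit.
Variables (I : finType) (R : comNzRingType).
Implicit Types (F G : fps I R) (l a b : {ffun I -> nat}).

Lemma fcoefM_r F G l : coef (F * G) l =
  coef F l * coef G 0 + \sum_(p <- decomps l | p.2 != 0) coef F p.1 * coef G p.2.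
Proof.
rewrite fcoefM (bigID (fun p => p.2 == 0)) /=; congr (_ + _).
rewrite -big_filter (perm_big [:: (l, 0)]) ?big_seq1 //.
apply: uniq_perm => [||[a b]] //; first exact/filter_uniq/decomps_uniq.
rewrite mem_filter mem_decomps inE /= xpair_eqE andbC.
by case: (b =P 0) => [->|]; rewrite ?andbF // addr0.
Qed.

(** Once both end terms are split off, every remaining term multiplies two nonconstant coefficients;
    if each is divisible by [1 - t], the term is divisible by its square. *)
Lemma fcoefM_ends F G l : l != 0 -> coef (F * G) l =
  coef F l * coef G 0 + coef F 0 * coef G l +
  \sum_(p <- decomps l | (p.1 != 0) && (p.2 != 0)) coef F p.1 * coef G p.2.
Proof.
move=> l0; rewrite fcoefM_r -addrA; congr (_ + _).
rewrite (bigID (fun p => p.1 == 0)) /=; congr (_ + _); last first.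
  by apply: eq_bigl => p; rewrite andbC.
rewrite -big_filter (perm_big [:: (0, l)]) ?big_seq1 //.
apply: uniq_perm => [||[a b]] //; first exact/filter_uniq/decomps_uniq.
rewrite mem_filter mem_decomps inE /= xpair_eqE.
by case: (a =P 0) => [->|]; rewrite ?andbF ?andbT // add0r; case: (b =P l) => [->|]; rewrite ?l0 // andbF.
Qed.

Lemma inv_coef0 F G : coef F 0 = 1 -> G * F = 1 -> coef G 0 = 1.
Proof. by move=> F0 /(congr1 (fun H => coef H 0)); rewrite fcoef0M F0 mulr1 fcoef1 eqxx. Qed.

Lemma mem_decomps_lt l p : p \in decomps l -> p.2 != 0 -> (ht p.1 < ht l)%N.
Proof.
case: p => a b; rewrite mem_decomps => /eqP <- /= /ht_gt0 h.
by rewrite htD -[X in (X < _)%N]addn0 ltn_add2l.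
Qed.

Lemma mem_decomps_gt l p : p \in decomps l -> p.1 != 0 -> (ht p.2 < ht l)%N.
Proof.
case: p => a b; rewrite mem_decomps => /eqP <- /= /ht_gt0 h.
by rewrite htD -[X in (X < _)%N]add0n ltn_add2r.
Qed.

Lemma mem_decomps_lel l p : p \in decomps l -> lel p.1 l /\ lel p.2 l.
Proof. by case: p => a b; rewrite mem_decomps => /eqP <-; rewrite lel_addl lel_addr. Qed.

End FpsSplit.

Section Polynomiality.
Variable r : nat.
Implicit Types (F G : ZtQ r) (l a b : Qplus r).

Definition pol F := forall l, eps 0 (coef F l).

Lemma polM F G : pol F -> pol G -> pol (F * G).
Proof.
move=> hF hG l; rewrite fcoefM; apply: eps_sum => p _ _.
exact: (epsM (k := 0) (l := 0)).
Qed.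
Lemma polD F G : pol F -> pol G -> pol (F + G).
Proof. by move=> hF hG l; rewrite fcoefD; apply: epsD. Qed.
Lemma polN F : pol F -> pol (- F).
Proof. by move=> hF l; rewrite fcoefN; apply: epsN. Qed.
Lemma pol_fpsC c : eps 0 c -> pol (fpsC _ c).
Proof. by move=> h l; rewrite fcoef_fpsC; case: ifP => // _; apply: eps_zero. Qed.
Lemma pol_exp b : pol (expQ b).
Proof. by move=> l; rewrite fcoef_monom; case: eqP => _; [apply: eps0_1|apply: eps_zero]. Qed.
Lemma pol1 : pol 1.
Proof. by rewrite -fpsC1; apply/pol_fpsC/eps0_1. Qed.

(** The constant coefficient 1 makes the recursion for the coefficients of the inverse free of
    division, so it stays in [Z[t]]. *)
Lemma pol_inv F G : pol F -> coef F 0 = 1 -> G * F = 1 -> pol G.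
Proof.
move=> hF F0 e l; move: {2}(ht l) (erefl (ht l)) => n; elim/ltn_ind: n l => n IH l hl.
have -> : coef G l = coef (1 : ZtQ r) l - \sum_(p <- decomps l | p.2 != 0) coef G p.1 * coef F p.2.
  by rewrite -e fcoefM_r F0 mulr1 addrK.
apply: epsB; first exact: pol1.
apply: eps_sum => p pl p2; apply: epsMl => //; apply: (IH (ht p.1)) => //.
by rewrite -hl; apply: mem_decomps_lt pl p2.
Qed.
Variable Q : Qplus r -> Prop.
(** The two-level divisibility carried by the induction. As mixed terms of a product gain a factor
    [1 - t] from each side, closure under products and inverses holds for an arbitrary [Q]; no
    additive property of [Q] enters. The bound [l] lets it be applied to what the induction has
    reached so far. *)
Definition good l F := coef F 0 = 1 /\ forall a, lel a l -> a != 0 ->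
  eps 1 (coef F a) /\ (Q a -> eps 2 (coef F a)).
Lemma good_eqle l F G : eqle l F G -> good l F -> good l G.
Proof.
move=> e [F0 h]; split; first by rewrite -e ?lel0.
by move=> a al a0; rewrite -e //; apply: h.
Qed.
Lemma good1 l : good l 1.
Proof.
split=> [|a _ a0]; first by rewrite fcoef1 eqxx.
by rewrite fcoef1 (negPf a0); split=> *; apply: eps_zero.
Qed.
Lemma goodM l F G : good l F -> good l G -> good l (F * G).
Proof.
move=> [F0 hF] [G0 hG]; split; first by rewrite fcoef0M F0 G0 mulr1.
move=> a al a0; rewrite fcoefM_ends // F0 G0 mulr1 mul1r.
have [f1 f2] := hF a al a0; have [g1 g2] := hG a al a0.
have c2 : eps 2 (\sum_(p <- decomps a | (p.1 != 0) && (p.2 != 0)) coef F p.1 * coef G p.2).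
  apply: eps_sum => p pa /andP[p1 p2]; have [l1 l2] := mem_decomps_lel pa.
  apply: (epsM (k := 1) (l := 1)).
    by have [] := hF p.1 (lel_trans l1 al) p1.
  by have [] := hG p.2 (lel_trans l2 al) p2.
split=> [|Qa]; apply: epsD.
- exact: epsD.
- exact: eps_weak c2.
- by apply: epsD; [apply: f2|apply: g2].
- exact: c2.
Qed.
Lemma good_prod l (T : eqType) (s : seq T) (F : T -> ZtQ r) :
  (forall x, x \in s -> good l (F x)) -> good l (\prod_(x <- s) F x).
Proof.
move=> h; rewrite big_seq; elim/big_rec: _ => [|x f xs hf]; first exact: good1.
by apply: goodM => //; apply: h.
Qed.
Lemma good_inv l F G : good l F -> G * F = 1 -> good l G.
Proof.
move=> [F0 hF] e; split; first exact: inv_coef0 F0 e.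
have G0 := inv_coef0 F0 e.
move=> a; move: {2}(ht a) (erefl (ht a)) => n; elim/ltn_ind: n a => n IH a ha al a0.
pose s := \sum_(p <- decomps a | (p.1 != 0) && (p.2 != 0)) coef G p.1 * coef F p.2.
have c2 : eps 2 s.
  apply: eps_sum => p pa /andP[p1 p2]; have [l1 l2] := mem_decomps_lel pa.
  apply: (epsM (k := 1) (l := 1)).
    by have [] := IH (ht p.1) _ p.1 erefl (lel_trans l1 al) p1; rewrite -?ha ?mem_decomps_lt.
  by have [] := hF p.2 (lel_trans l2 al) p2.
have -> : coef G a = - (coef F a + s).
  apply/eqP; rewrite -subr_eq0 opprK addrA; apply/eqP.
  by have := fcoefM_ends G F a0; rewrite e F0 G0 mulr1 mul1r fcoef1 (negPf a0) => <-.
have [f1 f2] := hF a al a0.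
split=> [|Qa]; apply/epsN/epsD => //; [exact: eps_weak c2|exact: f2].
Qed.
End Polynomiality.

(** * The factors attached to a single positive root *)

Section Factors.
Variable r : nat.
Implicit Types (F G : ZtQ r) (l a b c : Qplus r) (J : {set 'I_r}).
Definition numf b : ZtQ r := 1 - tvar r * expQ b.
Definition denf b : ZtQ r := 1 - expQ b.
Definition xf b : ZtQ r := (tvar r - expQ b) / numf b.
Definition yf b : ZtQ r := numf b / denf b.
Lemma tvarE : tvar r = fpsC _ tv. Proof. by []. Qed.
Lemma tvarX n : tvar r ^+ n = fpsC _ (tv ^+ n). Proof. by rewrite fpsCX. Qed.
Lemma numf0 b : b != 0 -> coef (numf b) 0 = 1.
Proof.
move=> b0; rewrite fcoefB fcoef1 fcoef_fpsCM fcoef_monom eqxx.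
by rewrite eq_sym (negPf b0) mulr0 subr0.
Qed.
Lemma denf0 b : b != 0 -> coef (denf b) 0 = 1.
Proof.
move=> b0; rewrite fcoefB fcoef1 fcoef_monom eqxx.
by rewrite eq_sym (negPf b0) subr0.
Qed.
Lemma numf_unit b : b != 0 -> numf b \is a GRing.unit.
Proof. by move=> /numf0/fps_unit1. Qed.
Lemma denf_unit b : b != 0 -> denf b \is a GRing.unit.
Proof. by move=> /denf0/fps_unit1. Qed.
Lemma xfE b : b != 0 -> xf b * numf b = tvar r - expQ b.
Proof. by move=> b0; rewrite /xf divrK // numf_unit. Qed.
(** The right-hand side is [w_factor] at a root made negative, so [xf b] measures the change caused
    by an inversion. *)
Lemma xyf b : b != 0 -> xf b * yf b = (tvar r - expQ b) / denf b.
Proof. by move=> b0; rewrite /xf /yf mulrA divrK // numf_unit. Qed.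
(** Apart from the constant t, everything is a multiple of [1 - t^2]; this shows that the
    nonconstant coefficients of x_b are divisible by [1 - t]. *)
Lemma xf_split b : b != 0 ->
  xf b = tvar r - fpsC _ (1 - tv ^+ 2) * (expQ b / numf b).
Proof.
move=> b0; apply: (mulIr (numf_unit b0)); rewrite xfE // mulrBl.
rewrite -!mulrA mulVr ?numf_unit // mulr1 /numf !fpsCD.
have -> : fpsC 'I_r (- tv ^+ 2) = - (tvar r ^+ 2).
  apply/eqP; rewrite -subr_eq0 opprK tvarX -fpsCD addNr fpsC0 //.
by rewrite fpsC1; ring.
Qed.
Lemma yf_split b : b != 0 -> yf b = 1 + fpsC _ (1 - tv) * (expQ b / denf b).
Proof.
move=> b0; apply: (mulIr (denf_unit b0)); rewrite /yf divrK ?denf_unit // mulrDl.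
rewrite -!mulrA mulVr ?denf_unit // mulr1 /numf /denf !fpsCD.
have -> : fpsC 'I_r (- tv) = - tvar r.
  apply/eqP; rewrite -subr_eq0 opprK tvarE -fpsCD addNr fpsC0 //.
by rewrite fpsC1; ring.
Qed.
Lemma pol_numf b : pol (numf b).
Proof.
apply: polD (@pol1 r) _; apply/polN/polM; last exact: pol_exp.
exact/pol_fpsC/eps0_tv.
Qed.
Lemma pol_denf b : pol (denf b).
Proof. by apply: polD (@pol1 r) _; apply/polN/pol_exp. Qed.
Lemma xf_eps b l : b != 0 -> eps 0 (coef (xf b) l) /\ (l != 0 -> eps 1 (coef (xf b) l)).
Proof.
move=> b0; have e : eps 1 (coef (fpsC 'I_r (1 - tv ^+ 2) * (expQ b / numf b)) l).
  rewrite fcoef_fpsCM; apply: epsMr.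
    rewrite (_ : 1 - tv ^+ 2 = (1 - tv) * (1 + tv)); last by ring.
    by apply: epsMr eps1_tv _; apply: epsD eps0_1 eps0_tv.
  apply: polM; first exact: pol_exp.
  by apply: (pol_inv (@pol_numf b)); rewrite ?numf0 // mulVr // numf_unit.
rewrite xf_split // fcoefB; split=> [|l0].
  apply: epsB; last exact: eps_weak e.
  exact/pol_fpsC/eps0_tv.
by rewrite fcoef_fpsC (negPf l0) sub0r; apply: epsN.
Qed.
Lemma denf_inv_coef b l : b != 0 -> coef (denf b)^-1 l != 0 -> exists k : nat, l = b *+ k.
Proof.
move=> b0; move: {2}(ht l) (erefl (ht l)) => n; elim/ltn_ind: n l => n IH l hl.
have -> : (denf b)^-1 = 1 + expQ b * (denf b)^-1.
  apply: (mulIr (denf_unit b0)); rewrite mulrDl -mulrA mulVr ?denf_unit // mulr1 mul1r.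
  by rewrite /denf subrK.
rewrite fcoefD fcoef1 fcoef_monomM; case: (l =P 0) => [->|_]; first by exists 0%N.
rewrite add0r; case: ifP => [bl|_]; last by rewrite eqxx.
have ltn : (ht (dif l b) < n)%N.
  by rewrite -hl -{2}(difK bl) htD -[X in (X < _)%N]add0n ltn_add2r ht_gt0.
by move=> /(IH _ ltn _ erefl)[k e]; exists k.+1; rewrite mulrS -e difK.
Qed.
(** [yf b - 1] is [1 - t] times a geometric series in [e^b], in which only multiples of [b] occur;
    by assumption none of them lies in [Q]. *)
Lemma yf_good (Q : Qplus r -> Prop) b l : b != 0 ->
  (forall k, b *+ k != 0 -> ~ Q (b *+ k)) -> good Q l (yf b).
Proof.
move=> b0 hQ; rewrite yf_split //; split.
  rewrite fcoefD fcoef1 eqxx fcoef_fpsCM fcoef0M fcoef_monom.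
  by rewrite eq_sym (negPf b0) mul0r mulr0 addr0.
move=> a _ a0; rewrite fcoefD fcoef1 (negPf a0) add0r fcoef_fpsCM.
have e : eps 0 (coef (expQ b / denf b) a).
  apply: polM; first exact: pol_exp.
  by apply: (pol_inv (@pol_denf b)); rewrite ?denf0 // mulVr // denf_unit.
split=> [|Qa]; first exact: epsMr eps1_tv e.
have -> : coef (expQ b / denf b) a = 0; last by rewrite mulr0; apply: eps_zero.
rewrite fcoef_monomM; case: ifP => // ba; apply: contrapT => /eqP/(denf_inv_coef b0)[k ek].
have ea : a = b *+ k.+1 by rewrite mulrS -ek difK.
by rewrite ea in a0 Qa; apply: (hQ _ a0 Qa).
Qed.
Lemma eqle_exp0 b l : ~~ lel b l -> eqle l (expQ b) 0.
Proof.
move=> h a al; rewrite fcoef_monom fcoef0; case: eqP => // ab.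
by rewrite -ab al in h.
Qed.
Lemma eqle_yf1 b l : ~~ lel b l -> eqle l (yf b) 1.
Proof.
move=> h; have b0 : b != 0 by apply: contraNneq h => ->; apply: lel0.
rewrite yf_split // => a al; rewrite fcoefD fcoef_fpsCM fcoef_monomM.
case: ifP => [ba|_]; last by rewrite mulr0 addr0.
by rewrite (lel_trans ba al) in h.
Qed.
Lemma ordge_tvarX n : ordge n (tvar r ^+ n).
Proof.
rewrite tvarX => l k h; rewrite /coeft fcoef_fpsC; case: eqP h => [->|//].
rewrite ht0 add0n => h; have := coef_tvXM n 1 k; rewrite mulr1 => ->.
by rewrite leqNgt h.
Qed.
Lemma ordge_exp b : ordge (ht b) (expQ b).
Proof.
move=> l k h; rewrite /coeft fcoef_monom; case: eqP => // e.
by move: h; rewrite e ltnNge leq_addr.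
Qed.
Lemma ordge_xf b : b != 0 -> ordge 1 (xf b).
Proof.
move=> b0; apply/ordgeMr/ordgeD; first exact: (ordge_tvarX (n := 1)).
apply: ordgeN; apply: ordge_weak (ordge_exp (b := b)); exact: ht_gt0.
Qed.
Lemma restrict_exp J b : restrict J (expQ b) = if supp b \subset J then expQ b else 0.
Proof.
apply/fpsP => l; rewrite coef_restrict fcoef_monom; case: (l =P b) => [->|/eqP h].
  by case: ifP => _ //; rewrite fcoef_monom eqxx.
by case: ifP => _; case: ifP => _ //; rewrite fcoef_monom (negPf h).
Qed.
Lemma restrict_numf J b : restrict J (numf b) = if supp b \subset J then numf b else 1.
Proof.
rewrite restrictD restrict1 restrictN restrictM restrict_fpsC restrict_exp.
by case: ifP; rewrite ?mulr0 ?subr0.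
Qed.
Lemma restrict_xf J b : b != 0 -> restrict J (xf b) = if supp b \subset J then xf b else tvar r.
Proof.
move=> b0; have := congr1 (restrict J) (xfE b0).
rewrite restrictM restrict_numf restrictD restrict_fpsC restrictN restrict_exp.
case: ifP => _; last by rewrite mulr1 subr0.
by rewrite -(xfE b0) => /(mulIr (numf_unit b0)).
Qed.
End Factors.

(** * The terms of the Weyl group sum *)

Section WeylSeries.
Variables (r : nat) (A : 'M[int]_r) (hA : gcm A).
Implicit Types (i j : 'I_r) (v : 'cV[int]_r) (w u x y : 'M[int]_r) (b c l : Qplus r)
  (I J : {set 'I_r}) (F G : ZtQ r).
Local Notation len := (weyl_length A).
Local Notation posrt := (pos_real_root A).
Local Notation a := simple_root.

Lemma posrt_neq0' b : posrt b -> b != 0.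
Proof. by move/(posrt_neq0 hA); rewrite toQ_eq0. Qed.

Definition height v : int := \sum_i v i 0.

Lemma heightD : {morph height : u v / u + v}.
Proof. by move=> u v; rewrite /height -big_split; apply: eq_bigr => i _; rewrite mxE. Qed.
Lemma height0 : height 0 = 0.
Proof. by rewrite /height big1 // => i _; rewrite mxE. Qed.
Lemma heightZ (z : int) v : height (z *: v) = z * height v.
Proof. by rewrite /height mulr_sumr; apply: eq_bigr => i _; rewrite mxE. Qed.
Lemma height_toQ l : height (toQ l) = (ht l)%:Z.
Proof. by rewrite /height /ht (big_morph Posz PoszD (erefl (Posz 0))); apply: eq_bigr => i _; rewrite toQE. Qed.

Lemma height_pos v : in_Qplus v -> v != 0 -> 1 <= height v.
Proof.
move=> h v0; rewrite -(abs_rootK h) height_toQ lez_nat; apply: ht_gt0.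
by rewrite -toQ_eq0 abs_rootK.
Qed.

(** Each simple root of [J] goes to a nonzero vector of the cone, which has height at least 1. Hence
    [act u] does not lower orders on series supported in [J]. *)
Lemma ht_minJ J u b l : weyl A u -> minJ J u -> supp b \subset J -> toQ l = u *m toQ b ->
  (ht b <= ht l)%N.
Proof.
move=> hu mu /toQ_supp sb e; rewrite -lez_nat -!height_toQ e.
rewrite (cV_sum_simple (toQ b)) mulmx_sumr !(big_morph height heightD height0); apply: ler_sum => i _.
rewrite -scalemxAr !heightZ; have -> : height (a i) = 1.
  by rewrite -toQ_simpleQ height_toQ /ht (bigD1 i) //= big1 ?ffunE ?eqxx // => k ki; rewrite ffunE (negPf ki).
case: (boolP (i \in J)) => [iJ|/sb ->]; last by rewrite !mul0r.
apply: ler_wpM2l; first exact: toQ_pos.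
by apply: height_pos; [apply: mu|apply: (weyl_simple_neq0 hA _ hu)].
Qed.

(* [act u] sends [e^c] to [e^(u c)], dropping the terms with [u c] outside
   of the cone. *)
Definition act u F : ZtQ r := Fps (fun l =>
  if `[< in_Qplus (invmx u *m toQ l) >] then coef F (abs_root (invmx u *m toQ l)) else 0).

Arguments act : simpl never.

Lemma coef_actE u F l : coef (act u F) l =
  if `[< in_Qplus (invmx u *m toQ l) >] then coef F (abs_root (invmx u *m toQ l)) else 0.
Proof. by []. Qed.

Lemma coef_act u F l c : weyl A u -> toQ l = u *m toQ c -> coef (act u F) l = coef F c.
Proof.
move=> hu e; rewrite coef_actE e (weyl_mulVK hA) // toQK.
by case: asboolP => // -[]; apply: toQ_pos.
Qed.

Lemma coef_act0 u F l : (forall c, toQ l <> u *m toQ c) -> weyl A u -> coef (act u F) l = 0.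
Proof.
move=> h hu; rewrite coef_actE; case: asboolP => // hi.
by case: (h (abs_root (invmx u *m toQ l))); rewrite abs_rootK // (weyl_mulKV hA).
Qed.

Lemma act_cases u l : weyl A u -> (exists c, toQ l = u *m toQ c) \/ (forall c, toQ l <> u *m toQ c).
Proof. by move=> hu; case: (pselect (exists c, toQ l = u *m toQ c)) => [|/forallNP]; [left|right]. Qed.

Lemma actD u F G : act u (F + G) = act u F + act u G.
Proof. by apply/fpsP => l; rewrite fcoefD !coef_actE; case: asboolP => _; rewrite ?addr0. Qed.
Lemma act0 u : act u 0 = 0.
Proof. by apply/fpsP => l /=; rewrite if_same. Qed.
Lemma actN u F : act u (- F) = - act u F.
Proof. by apply/eqP; rewrite -subr_eq0 opprK -actD addNr act0. Qed.
Lemma act_sum u (T : Type) (s : seq T) (P : pred T) (F : T -> ZtQ r) :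
  act u (\sum_(z <- s | P z) F z) = \sum_(z <- s | P z) act u (F z).
Proof. exact: (big_morph _ (actD u) (act0 u)). Qed.
Lemma act_scale u (c : Zt) F : act u (fpsC _ c * F) = fpsC _ c * act u F.
Proof.
by apply/fpsP => l; rewrite fcoef_fpsCM !coef_actE; case: asboolP => _; rewrite ?fcoef_fpsCM ?mulr0.
Qed.

Lemma act_exp u c d : weyl A u -> toQ d = u *m toQ c -> act u (expQ c) = expQ d.
Proof.
move=> hu e; apply/fpsP => l; rewrite fcoef_monom.
case: (act_cases l hu) => [[b eb]|h]; last first.
  by rewrite coef_act0 //; case: eqP => // ld; case: (h c); rewrite ld.
rewrite (coef_act _ hu eb) fcoef_monom; congr (_%:R); congr nat_of_bool.
apply/eqP/eqP => h; apply: toQ_inj; first by rewrite eb h e.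
by rewrite -(weyl_mulVK hA (toQ b) hu) -eb h e (weyl_mulVK hA).
Qed.

Lemma act1 u : weyl A u -> act u 1 = 1.
Proof.
by move=> hu; rewrite -[1]/(expQ 0); apply: act_exp => //; rewrite toQ0 mulmx0.
Qed.

Definition Jsupp J F := restrict J F = F.

Lemma Jsupp_coef J F l : Jsupp J F -> ~~ (supp l \subset J) -> coef F l = 0.
Proof. by move=> <- h; rewrite coef_restrict (negPf h). Qed.

Lemma Jsupp_restrict J F : Jsupp J (restrict J F).
Proof. by apply/fpsP => l; rewrite !coef_restrict; case: (supp l \subset J). Qed.

(** In general [act u] is not multiplicative, since a dropped term times a kept one may lie in the
    cone again. For [u] minimal and series supported in [J] no term is dropped. *)
Lemma actM J u F G : weyl A u -> minJ J u -> Jsupp J F -> Jsupp J G ->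
  act u (F * G) = act u F * act u G.
Proof.
move=> hu mu hF hG; apply/fpsP => l; rewrite fcoefM.
case: (act_cases l hu) => [[c e]|h]; last first.
  rewrite coef_act0 //; symmetry.
  apply: (@sum_decomps0 _ _ l (fun b c => coef (act u F) b * coef (act u G) c)) => b d bd.
  case: (act_cases b hu) => [[b' eb]|hb]; last by rewrite coef_act0 ?mul0r.
  case: (act_cases d hu) => [[d' ed]|hd]; last by rewrite mulrC coef_act0 ?mul0r.
  by case: (h (b' + d')); rewrite -bd !toQD mulmxDr eb ed.
rewrite (coef_act _ hu e) fcoefM.
pose f (p : Qplus r * Qplus r) := (abs_root (u *m toQ p.1), abs_root (u *m toQ p.2)).
pose P (p : Qplus r * Qplus r) := (supp p.1 \subset J) && (supp p.2 \subset J).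
rewrite (bigID P) [X in _ + X = _]big1 ?addr0; last first.
  move=> [b d]; rewrite andTb negb_and => /orP[h|h].
    by rewrite (Jsupp_coef hF h) mul0r.
  by rewrite (Jsupp_coef hG h) mulr0.
(* There can be more decompositions of [l = u c] than of [c]. A surplus one has a part that is no
   image of an exponent supported in [J], and so contributes 0. *)
rewrite [RHS](bigID (fun p => p \in [seq f q | q <- decomps c & P q])) [X in _ = _ + X]big1_seq ?addr0; last first.
  move=> [b d] /andP[/andP[_ /mapP hn]]; rewrite mem_decomps => /eqP bd.
  rewrite -[(b, d).1]/b -[(b, d).2]/d.
  case: (act_cases b hu) => [[b' eb]|hb]; last by rewrite coef_act0 ?mul0r.
  case: (act_cases d hu) => [[d' ed]|hd]; last by rewrite mulrC coef_act0 ?mul0r.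
  rewrite (coef_act _ hu eb) (coef_act _ hu ed).
  case: (boolP (supp b' \subset J)) => [sb|/(Jsupp_coef hF) ->]; last by rewrite mul0r.
  case: (boolP (supp d' \subset J)) => [sd|/(Jsupp_coef hG) ->]; last by rewrite mulr0.
  case: hn; exists (b', d'); last by rewrite /f /= -eb -ed !toQK.
  rewrite mem_filter /P /= sb sd mem_decomps /=; apply/eqP/toQ_inj.
  by rewrite -(weyl_mulVK hA (toQ c) hu) -e -bd !toQD eb ed -mulmxDr (weyl_mulVK hA).
have posJ b : supp b \subset J -> toQ (abs_root (u *m toQ b)) = u *m toQ b.
  by move=> /toQ_supp sb; rewrite abs_rootK //; apply: minJ_pos mu (@toQ_pos _ b) sb.
have finj : {in [seq q <- decomps c | P q] &, injective f}.
  move=> [b d] [b' d']; rewrite !mem_filter => /andP[/andP[/= s1 s2] _] /andP[/andP[/= s3 s4] _].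
  rewrite /f /= => -[/(congr1 (@toQ r)) e1 /(congr1 (@toQ r)) e2]; rewrite !posJ // in e1 e2.
  congr pair; apply: toQ_inj.
    by rewrite -(weyl_mulVK hA (toQ b) hu) e1 (weyl_mulVK hA).
  by rewrite -(weyl_mulVK hA (toQ d) hu) e2 (weyl_mulVK hA).
rewrite -[RHS]big_filter [RHS](perm_big [seq f q | q <- decomps c & P q]); last first.
  apply: uniq_perm => [||p]; first by apply: filter_uniq; exact: decomps_uniq.
    by rewrite (map_inj_in_uniq finj); apply: filter_uniq; exact: decomps_uniq.
  rewrite mem_filter; apply/andP/idP => [[]//|pf]; split=> //.
  move/mapP: pf => [[b d]]; rewrite mem_filter /P /= mem_decomps => /andP[/andP[sb sd] /eqP bd] ->.
  by rewrite mem_decomps; apply/eqP/toQ_inj; rewrite toQD /= !posJ // -mulmxDr -toQD bd e.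
rewrite big_map big_filter big_seq_cond [RHS]big_seq_cond; apply: eq_bigr => -[b d] /andP[_ /andP[_ /andP[sb sd]]].
by congr (_ * _); apply/esym; [exact: coef_act hu (posJ _ sb)|exact: coef_act hu (posJ _ sd)].
Qed.

Lemma Jsupp_prod J (T : eqType) (s : seq T) (F : T -> ZtQ r) :
  (forall z : T, z \in s -> Jsupp J (F z)) -> Jsupp J (\prod_(z <- s) F z).
Proof. by move=> h; rewrite /Jsupp restrict_prod; apply: eq_big_seq. Qed.

Lemma act_prod J u (T : eqType) (s : seq T) (F : T -> ZtQ r) : weyl A u -> minJ J u ->
  (forall z : T, z \in s -> Jsupp J (F z)) ->
  act u (\prod_(z <- s) F z) = \prod_(z <- s) act u (F z).
Proof.
move=> hu mu; elim: s => [|c s IH] h; first by rewrite !big_nil (act1 hu).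
have hs (d : T) : d \in s -> Jsupp J (F d) by move=> ds; apply: h; rewrite inE ds orbT.
have hc : Jsupp J (F c) by apply: h; rewrite inE eqxx.
by rewrite !big_cons (actM hu mu hc (Jsupp_prod hs)) (IH hs).
Qed.

Lemma ordge_act J u N F : weyl A u -> minJ J u -> Jsupp J F -> ordge N F -> ordge N (act u F).
Proof.
move=> hu mu hF h l n ln; rewrite /coeft.
case: (act_cases l hu) => [[c e]|hc]; last by rewrite coef_act0.
rewrite (coef_act _ hu e); case: (boolP (supp c \subset J)) => [sc|/(Jsupp_coef hF) ->//].
by apply: h; apply: leq_ltn_trans ln; rewrite leq_add2r; apply: ht_minJ hu mu sc e.
Qed.

Lemma Jsupp_xf J c : c != 0 -> supp c \subset J -> Jsupp J (xf c).
Proof. by move=> c0 h; rewrite /Jsupp restrict_xf // h. Qed.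

(** Apply [act u] to [xf c * numf c = t - e^c] and cancel the unit [numf d]. *)
Lemma act_xf J u c d : weyl A u -> minJ J u -> supp c \subset J -> c != 0 ->
  toQ d = u *m toQ c -> act u (xf c) = xf d.
Proof.
move=> hu mu sc c0 e.
have d0 : d != 0 by rewrite -toQ_eq0 e; apply: (weyl_mul_neq0 hA hu); rewrite toQ_eq0.
have an : act u (numf c) = numf d.
  by rewrite actD act1 // actN tvarE act_scale (act_exp hu e).
have jn : Jsupp J (numf c) by rewrite /Jsupp restrict_numf sc.
have := actM hu mu (Jsupp_xf c0 sc) jn.
rewrite xfE // an actD actN (act_exp hu e) tvarE -[fpsC _ tv]mulr1 act_scale act1 // mulr1.
by rewrite -tvarE -(xfE d0) => /(mulIr (numf_unit d0)).
Qed.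

Definition Xw w : ZtQ r := \prod_(b <- invs A w) xf b.

Lemma invs_posrt w b : weyl A w -> b \in invs A w -> posrt b.
Proof. by move=> hw /(invs_in hA _ hw)[]. Qed.

Lemma invs_neq0 w b : weyl A w -> b \in invs A w -> b != 0.
Proof. by move=> hw /(invs_posrt hw)/posrt_neq0'. Qed.

Lemma Xw_ord w : weyl A w -> ordge (len w) (Xw w).
Proof.
move=> hw; rewrite -(invs_size hA hw) /Xw.
have : forall b, b \in invs A w -> b != 0 by move=> b; apply: invs_neq0.
elim: (invs A w) => [|b s IH] h; first by rewrite big_nil.
rewrite big_cons; apply: (ordgeM (M := 1)).
  by apply: ordge_xf; apply: h; rewrite inE eqxx.
by apply: IH => c cs; apply: h; rewrite inE cs orbT.
Qed.

Lemma Xw1 : Xw 1%:M = 1.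
Proof.
rewrite /Xw; have := invs_size hA (weyl1 A); rewrite len1 => /size0nil ->.
by rewrite big_nil.
Qed.

Lemma Xw_Jsupp J y : inW A J y -> Jsupp J (Xw y).
Proof.
move=> hy; rewrite /Jsupp restrict_prod; apply: eq_big_seq => b hb.
have hw := inW_weyl hy; rewrite restrict_xf ?(invs_neq0 hw) //.
by rewrite (isInv_supp hA hy) //; apply/(invs_in hA _ hw).
Qed.

Lemma Xw_mul J u y : weyl A u -> minJ J u -> inW A J y -> Xw (u *m y) = Xw u * act u (Xw y).
Proof.
move=> hu mu hy; have hyw := inW_weyl hy.
have pos c : isInv A y c -> in_Qplus (u *m toQ c).
  by move=> hc; exact: (minJ_inv hA mu hy hc).
rewrite /Xw (perm_big _ (invs_mul hA hu hyw pos)) big_cat big_map; congr (_ * _).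
have inv c : c \in invs A y -> isInv A y c by move/(invs_in hA _ hyw).
have n0 c : c \in invs A y -> c != 0 by case/inv => /posrt_neq0'.
have sc c : c \in invs A y -> supp c \subset J by move/inv/(isInv_supp hA hy).
have js c : c \in invs A y -> Jsupp J (xf c) by move=> hc; apply: Jsupp_xf (n0 _ hc) (sc _ hc).
rewrite (act_prod hu mu js); apply: eq_big_seq => c hc.
exact/esym/(act_xf hu mu (sc _ hc) (n0 _ hc))/abs_rootK/pos/inv.
Qed.

(** A factor x_b with [b] not supported in [J] specialises to t. Of the inversions of [(u y)^-1]
    there are [len u] such [b], the others being the inversions of [y^-1]. This count is the reason
    for working with inverses. *)
Lemma Xw_restrict J u y : weyl A u -> minJ J u -> inW A J y ->
  restrict J (Xw (invmx (u *m y))) = tvar r ^+ len u * Xw (invmx y).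
Proof.
move=> hu mu hy; have hyw := inW_weyl hy; have huy := weylM hu hyw.
have hi := weyl_inv hA huy; have hiy := weyl_inv hA hyw.
have pf := invs_inv_factor hA hu mu hy.
rewrite restrict_prod (bigID (fun b => supp b \subset J)) /= mulrC; congr (_ * _).
  rewrite big_seq_cond (eq_bigr (fun=> tvar r)); last first.
    by move=> b /andP[hb sb]; rewrite restrict_xf ?(invs_neq0 hi) // (negPf sb).
  rewrite -big_seq_cond big_const_seq -Monoid.iteropE; congr (_ ^+ _).
  apply/eqP; rewrite -(eqn_add2l (count (fun b => supp b \subset J) (invs A (invmx (u *m y))))).
  rewrite count_predC (invs_size hA hi) (len_inv hA huy) -size_filter (perm_size pf) (invs_size hA hiy) (len_inv hA hyw).
  by rewrite (len_factor hA hu mu hy) addnC.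
rewrite -big_filter (perm_big _ pf); apply: eq_big_seq => b hb.
rewrite restrict_xf ?(invs_neq0 hiy) // (isInv_supp hA (inW_inv hA hy)) //.
by apply/(invs_in hA _ hiy).
Qed.

Lemma Xw_eps w l : weyl A w ->
  eps 0 (coef (Xw w) l) /\ (l != 0 -> eps 1 (coef (Xw w) l)).
Proof.
move=> hw; rewrite /Xw; have : forall b, b \in invs A w -> b != 0 by move=> b; apply: invs_neq0.
elim: (invs A w) l => [|b s IH] l h.
  rewrite big_nil fcoef1; split=> [|/negPf ->]; last exact: eps_zero.
  by case: eqP => _; [apply: eps0_1|apply: eps_zero].
have b0 : b != 0 by apply: h; rewrite inE eqxx.
have {}IH c := IH c (fun d ds => h d (mem_behead (s := b :: s) ds)).
rewrite big_cons fcoefM; split=> [|l0]; apply: eps_sum => -[c d] /=; rewrite mem_decomps => /eqP e _.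
  by apply: epsMl; [case: (xf_eps c b0)|case: (IH d)].
have [c0|c0] := eqVneq c 0; last by apply: epsMr; [case: (xf_eps c b0) => _; apply|case: (IH d)].
apply: epsMl; first by case: (xf_eps c b0).
by case: (IH d) => _; apply; rewrite -e c0 add0r in l0.
Qed.

(** The elements of length at most [N], which is where sums over W are truncated; different words
    may give the same matrix, hence [undup]. *)
Definition WL (N : nat) : seq 'M[int]_r :=
  undup (flatten [seq [seq word_mx A t | t <- [seq val z | z <- enum {: n.-tuple 'I_r}]] | n <- iota 0 N.+1]).

Lemma WL_uniq N : uniq (WL N). Proof. exact: undup_uniq. Qed.

Lemma mem_WL N w : (w \in WL N) <-> weyl A w /\ (len w <= N)%N.
Proof.
rewrite mem_undup; split=> [/flatten_mapP[n]|[hw lw]].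
  rewrite mem_iota /= add0n ltnS => nN /mapP[s /mapP[z _ ->] ->].
  split; first exact: weyl_word.
  by apply: leq_trans (len_le A _) _; rewrite size_tuple.
have [s ws ss] := len_word hw.
apply/flatten_mapP; exists (len w); first by rewrite mem_iota /= add0n ltnS.
apply/mapP; exists s => //; apply/mapP.
have sz : size s == len w by apply/eqP.
by exists (Tuple sz); rewrite ?mem_enum.
Qed.

Variables (D : 'M[int]_r -> ZtQ r).
Hypothesis hD : forall w, weyl A w -> is_prod posrt (w_factor w) (D w).

Lemma w_factor_pos w b c : toQ c = w *m toQ b -> w_factor w b = yf c.
Proof.
by move=> e; rewrite /w_factor -e toQK; case: asboolP => // -[]; apply: toQ_pos.
Qed.

Lemma w_factor_neg w b c : posrt c -> toQ c = - (w *m toQ b) -> w_factor w b = xf c * yf c.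
Proof.
move=> hc e; have c0 := posrt_neq0' hc; rewrite xyf // /w_factor.
have e' : w *m toQ b = - toQ c by rewrite e opprK.
rewrite e' abs_rootN toQK; case: asboolP => // h.
by move: c0; rewrite -toQ_eq0 (Qplus_antisym (@toQ_pos _ c) h) eqxx.
Qed.

(** Reindex the roots by [b -> |w^-1 b|], a permutation of the positive real roots: the factor there
    is [yf b], times [xf b] if [b] is an inversion of [w]. *)
Lemma D_factor w : weyl A w -> D w = D 1%:M * Xw w.
Proof.
move=> hw; apply/fpsP => l; apply: (_ : eqle l _ _); last exact: lel_refl.
have [s us hs] := lel_seq l.
(* Inversions of [w] must be included even when they are not below [l], since the constant
   coefficient of [xf b] is t rather than 1. *)
have [Z [hZ hZ' wZ]] : exists Z : {fset Qplus r}, [/\ forall b, b \in Z -> posrt b,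
    forall b, posrt b -> b \notin Z -> ~~ lel b l /\ ~ isInv A w b & {subset invs A w <= Z}].
  exists [fset b in [seq b <- s | `[< posrt b >]] ++ invs A w]%fset; split=> b.
  - rewrite in_fset mem_cat => /orP[|/(invs_posrt hw)//].
    by rewrite mem_filter => /andP[/asboolP].
  - move=> hb; rewrite in_fset mem_cat negb_or mem_filter hs => /andP[h1 h2]; split.
      by apply: contra h1 => ->; rewrite andbT; apply/asboolP.
    by move=> /(invs_in hA _ hw) h; rewrite h in h2.
  - by rewrite in_fset mem_cat orbC => ->.
have e1 : eqle l (D 1%:M) (\prod_(b <- Z) yf b).
  have := is_prod_eqle (hD (weyl1 A)) hZ (l := l).
  have wE b : w_factor 1%:M b = yf b by apply: w_factor_pos; rewrite mul1mx.
  rewrite (eq_bigr _ (fun b _ => wE b)); apply => b hb bZ; rewrite wE.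
  by apply: eqle_yf1; case: (hZ' b hb bZ).
have iw := weyl_inv hA hw.
pose g b := abs_root (invmx w *m toQ b); pose g' b := abs_root (w *m toQ b).
have absw y b : weyl A y -> posrt b -> abs_root (invmx y *m toQ (abs_root (y *m toQ b))) = b.
  move=> hy hb; case: (posrt_sign hA hy hb) => h.
    by rewrite abs_rootK // (weyl_mulVK hA) // toQK.
  by rewrite -(abs_rootN (y *m _)) abs_rootK // mulmxN abs_rootN (weyl_mulVK hA) // toQK.
have g'K b : posrt b -> g (g' b) = b by move=> hb; apply: absw.
have gK b : posrt b -> g' (g b) = b.
  by move=> hb; have := absw (invmx w) b iw hb; rewrite invmxK.
have wg b : posrt b -> w_factor w (g b) = (if b \in invs A w then xf b else 1) * yf b.
  move=> hb; case: ifPn => [/(invs_in hA _ hw)[_ h]|/negP h].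
    apply: w_factor_neg => //; rewrite /g -abs_rootN abs_rootK // mulmxN opprK.
    by rewrite (weyl_mulKV hA).
  rewrite mul1r; apply: w_factor_pos; rewrite abs_rootK ?(weyl_mulKV hA) //.
  by apply: (isInvN hA hw hb) => /(invs_in hA _ hw).
pose Z' : {fset Qplus r} := [fset g b | b in Z]%fset.
have e2 : eqle l (D w) (\prod_(b <- Z') w_factor w b).
  apply: is_prod_eqle (hD hw) _ _.
    move=> b /imfsetP[c /= /hZ hc ->]; exact: (posrt_mul hA iw).
  move=> b hb bZ; have hg : posrt (g' b) := posrt_mul hA hw hb.
  have gZ : g' b \notin Z.
    by apply: contra bZ => gZ; apply/imfsetP; exists (g' b); rewrite ?g'K.
  have [h1 h2] := hZ' _ hg gZ.
  rewrite -(g'K b hb) wg //; case: ifP => [/(invs_in hA _ hw)//|_].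
  by rewrite mul1r; apply: eqle_yf1.
apply: eqle_trans e2 _; apply: eqle_sym.
apply: eqle_trans (eqleM e1 (@eqle_refl _ _ l (Xw w))) _.
rewrite big_imfset /=; last first.
  by move=> b c /= /hZ hb /hZ hc e; rewrite -(gK b hb) -(gK c hc) e.
rewrite [X in eqle l _ X](eq_big_seq (fun b => (if b \in invs A w then xf b else 1) * yf b)); last first.
  by move=> b /hZ/wg.
rewrite [X in eqle l _ X]big_split mulrC /= -big_mkcond; suff -> : Xw w = \prod_(b <- Z | b \in invs A w) xf b by [].
rewrite /Xw -[RHS]big_filter; apply: perm_big; apply: uniq_perm; rewrite ?filter_uniq ?fset_uniq ?(invs_uniq hA hw) //.
move=> b; rewrite mem_filter; apply/idP/andP => [h|[]//]; split=> //.
exact: wZ.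
Qed.

Lemma D1_good (Q : Qplus r -> Prop) l :
  (forall b k, posrt b -> b *+ k != 0 -> ~ Q (b *+ k)) -> good Q l (D 1%:M).
Proof.
move=> hQ; have [s us hs] := lel_seq l.
pose Z : {fset Qplus r} := [fset b in [seq b <- s | `[< posrt b >]]]%fset.
have hZ b : b \in Z -> posrt b.
  by rewrite in_fset mem_filter => /andP[/asboolP].
have hZ' b : posrt b -> b \notin Z -> ~~ lel b l.
  move=> hb; rewrite in_fset mem_filter hs; apply: contra => ->.
  by rewrite andbT; apply/asboolP.
have wE b : w_factor 1%:M b = yf b by apply: w_factor_pos; rewrite mul1mx.
have e1 : eqle l (D 1%:M) (\prod_(b <- Z) yf b).
  have := is_prod_eqle (hD (weyl1 A)) hZ (l := l).
  rewrite (eq_bigr _ (fun b _ => wE b)); apply => b hb bZ; rewrite wE.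
  exact/eqle_yf1/hZ'.
apply: good_eqle (eqle_sym e1) _; apply: good_prod => b /hZ hb.
by apply: yf_good => [|k]; [apply: posrt_neq0'|apply: hQ].
Qed.

End WeylSeries.

(** Adding or removing a fixed element of [E] outside [B] is a sign-reversing involution. *)
Lemma sum_sign_subsets (T : finType) (R : pzRingType) (B E : {set T}) :
  \sum_(J : {set T} | (B \subset J) && (J \subset E)) (-1) ^+ #|J| =
  (if B == E then (-1) ^+ #|E| else 0) :> R.
Proof.
case: eqP => [->|/eqP BE].
  by rewrite (big_pred1 E) // => J; rewrite /= finset.eqEsubset andbC.
case: (boolP (B \subset E)) => [sBE|nBE]; last first.
  rewrite big_pred0 // => J; apply/negP => /andP[h1 h2].
  by rewrite (fintype.subset_trans h1 h2) in nBE.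
have /fintype.properP[_ [i iE iB]] : B \proper E by rewrite finset.properEneq BE.
rewrite (bigID (fun J : {set T} => i \in J)) /=.
rewrite (reindex_onto (fun J => i |: J) (fun J => J :\ i)) /=; last first.
  by move=> J /andP[_ iJ]; rewrite finset.setD1K.
rewrite [X in X + _](_ : _ = - \sum_(J : {set T} | (B \subset J) && (J \subset E) && (i \notin J)) (-1) ^+ #|J|) ?addNr //.
rewrite -sumrN; apply: eq_big => [J|J /andP[_ /eqP iJ]]; last first.
  rewrite finset.cardsU1 (_ : i \notin J) ?add1n ?exprS ?mulN1r //.
  by rewrite -iJ finset.setD11.
rewrite finset.setU11 andbT.
apply/andP/andP => [[/andP[h1 h2] /eqP h3]|[/andP[h1 h2] h3]].
  have iJ : i \notin J by rewrite -h3 finset.setD11.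
  split=> //; apply/andP; split.
    apply/fintype.subsetP => j jB; have := fintype.subsetP h1 j jB.
    by rewrite finset.in_setU1 => /orP[/eqP e|//]; rewrite e (negPf iB) in jB.
  by apply: fintype.subset_trans h2; apply: finset.subsetUr.
split; first (apply/andP; split).
- exact: fintype.subset_trans h1 (finset.subsetUr _ _).
- by rewrite finset.subUset finset.sub1set iE h2.
- by rewrite finset.setU1K.
Qed.

Lemma bounded_on_fibers (T : finType) (X : Type) (Pr : X -> Prop) (phi : X -> T) (n : X -> nat) :
  (forall x y, Pr x -> Pr y -> phi x = phi y -> n x = n y) ->
  exists M, forall x, Pr x -> (n x <= M)%N.
Proof.
move=> h.
pose g t := if pselect (exists x, Pr x /\ phi x = t) is left e then n (projT1 (cid e)) else 0%N.
exists (\max_t g t)%N => x hx; apply: leq_trans (leq_bigmax (phi x)); rewrite /g.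
case: pselect => [e|[]]; last by exists x.
by case: (cid e) => y [hy e'] /=; rewrite (h x y).
Qed.

(** * Alternating sums over parabolic subgroups *)

Section Main.
Variables (r : nat) (A : 'M[int]_r) (hA : gcm A).
Implicit Types (i j : 'I_r) (v : 'cV[int]_r) (w u x y : 'M[int]_r) (b c l : Qplus r)
  (I J : {set 'I_r}) (F G : ZtQ r).
Local Notation len := (weyl_length A).
Local Notation posrt := (pos_real_root A).
Local Notation a := simple_root.
Local Notation X := (Xw A).
Local Notation WL := (WL A).
Local Notation inWb J w := (`[< inW A J w >]).

Variables (D : 'M[int]_r -> ZtQ r) (S P m : ZtQ r).
Hypothesis hD : forall w, weyl A w -> is_prod posrt (w_factor w) (D w).
Hypothesis hS : is_sum (weyl A) D S.
Hypothesis hP : is_sum (weyl A) (fun w => tvar r ^+ len w) P.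
Hypothesis hm : m * S = P.
Hypothesis m0 : coef m 0 = 1.
Hypothesis msupp : forall l, ~ Qim A l -> coef m l = 0.

Definition tlen w : ZtQ r := tvar r ^+ len w.

Lemma tlen_ord w : ordge (len w) (tlen w). Proof. exact: ordge_tvarX. Qed.

Definition real_quot := D 1%:M.

(** If [b = w a_i], then [s_i w^-1] sends the multiple to [- k a_i], outside the cone. *)
Lemma Qim_mul b k : posrt b -> b *+ k != 0 -> ~ Qim A (b *+ k).
Proof.
move=> [w [i [hw e]]] bk h.
have toQM n : toQ (b *+ n) = n%:R *: toQ b.
  elim: n => [|n IH]; first by rewrite mulr0n toQ0 scale0r.
  by rewrite mulrS toQD IH mulrS scalerDl scale1r.
have hi := weyl_inv hA hw.
have := h (srefl A i *m invmx w) (weylM (weyl_srefl A i) hi).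
rewrite -mulmxA toQM -scalemxAr e (weyl_mulVK hA) // -scalemxAr srefl_self // => /(_ i).
rewrite !mxE !eqxx mulrN1 oppr_ge0 natz lez_nat leqn0 => /eqP k0.
by rewrite k0 mulr0n eqxx in bk.
Qed.

Lemma real_quot_good l : good (Qim A) l real_quot.
Proof. apply: (D1_good hA hD) => b k; exact: Qim_mul. Qed.

Lemma real_quot0 : coef real_quot 0 = 1. Proof. by case: (real_quot_good 0). Qed.

Lemma mC_unit : m * real_quot \is a GRing.unit.
Proof. by apply: fps_unit1; rewrite fcoef0M m0 real_quot0 mulr1. Qed.

(** The series [f] of the overview, [real_quot] being [C]. *)
Definition inv_mC := (m * real_quot)^-1.

Lemma inv_mC_mul : inv_mC * (m * real_quot) = 1. Proof. by rewrite mulVr // mC_unit. Qed.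

Lemma WL_notin N w : weyl A w -> w \notin WL N -> (N.+1 <= len w)%N.
Proof.
move=> hw h; rewrite ltnNge; apply: contra h => h; exact/mem_WL.
Qed.

Lemma WL_weyl N w : w \in WL N -> weyl A w. Proof. by move/mem_WL => []. Qed.

Lemma weyl_sum N : eqm N.+1 (\sum_(w <- WL N) X w) (inv_mC * \sum_(w <- WL N) tlen w).
Proof.
have hs : eqm N.+1 S (\sum_(w <- WL N) D w).
  apply: is_sum_eqm (WL_uniq A N) hS _ _ => [w /WL_weyl//|w hw /(WL_notin hw) h].
  by rewrite (D_factor hA hD hw); apply/ordgeMl/(ordge_weak h)/Xw_ord.
have hp : eqm N.+1 P (\sum_(w <- WL N) tlen w).
  apply: is_sum_eqm (WL_uniq A N) hP _ _ => [w /WL_weyl//|w hw /(WL_notin hw) h].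
  exact: ordge_weak h (@tlen_ord w).
have eD : \sum_(w <- WL N) D w = real_quot * \sum_(w <- WL N) X w.
  by rewrite mulr_sumr; apply: eq_big_seq => w /WL_weyl hw; rewrite (D_factor hA hD hw).
rewrite eD in hs.
have h1 : eqm N.+1 (m * (real_quot * \sum_(w <- WL N) X w)) (\sum_(w <- WL N) tlen w).
  apply: eqm_trans hp; rewrite -hm; apply: eqmMl; exact: eqm_sym.
have := eqmMl inv_mC h1; by rewrite [m * _]mulrA mulrA inv_mC_mul mul1r.
Qed.

Lemma WL_inv N (h : 'M[int]_r -> ZtQ r) (p : pred 'M[int]_r) :
  (forall w, weyl A w -> p (invmx w) = p w) ->
  \sum_(w <- WL N | p w) h w = \sum_(w <- WL N | p w) h (invmx w).
Proof.
move=> hp; rewrite [LHS](perm_big [seq invmx w | w <- WL N]) ?big_map.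
  rewrite big_seq_cond [RHS]big_seq_cond; apply: eq_bigl => w.
  by case: (boolP (w \in WL N)) => // /WL_weyl /hp ->.
apply: uniq_perm; rewrite ?WL_uniq ?map_inj_uniq ?WL_uniq //; first exact: can_inj (@invmxK _ _).
move=> w; apply/idP/mapP => [/mem_WL[hw lw]|[x /mem_WL[hx lx] ->]].
  exists (invmx w); rewrite ?invmxK //; apply/mem_WL; split; first exact: weyl_inv.
  by rewrite len_inv.
by apply/mem_WL; split; [apply: weyl_inv|rewrite len_inv].
Qed.

(** The subsets [J] of this set are those for which [u] is minimal in [u W_J]; thus, for fixed [u],
    the alternating sum runs over all subsets of one set. *)
Definition ascents u : {set 'I_r} := [set i | `[< in_Qplus (u *m a i) >]].

Lemma minJP J u : reflect (minJ J u) (J \subset ascents u).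
Proof.
apply: (iffP fintype.subsetP) => h j /h; first by rewrite inE => /asboolP.
by move=> hj; rewrite inE; apply/asboolP.
Qed.

(** Lengths add in [w = u y], so pairs with both lengths at most [N] reach every [w] of length at
    most [N]. The longer products that they also reach have terms of order above [N]. *)
Lemma sum_factor N I J (h : 'M[int]_r -> ZtQ r) : J \subset I ->
  (forall w, weyl A w -> ordge (len w) (h w)) ->
  eqm N.+1 (\sum_(w <- WL N | inWb I w) h w)
    (\sum_(u <- WL N | inWb I u && (J \subset ascents u)) \sum_(y <- WL N | inWb J y) h (u *m y)).
Proof.
move=> JI hh.
pose s1 := [seq w <- WL N | inWb I w].
pose t1 := [seq u <- WL N | inWb I u && (J \subset ascents u)].
pose t2 := [seq y <- WL N | inWb J y].
have -> : \sum_(u <- WL N | inWb I u && (J \subset ascents u)) \sum_(y <- WL N | inWb J y) h (u *m y)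
   = \sum_(w <- [seq u *m y | u <- t1, y <- t2]) h w.
  by rewrite big_allpairs_dep big_filter; apply: eq_bigr => u _; rewrite big_filter.
rewrite -big_filter -/s1.
have in1 u : u \in t1 -> [/\ inW A I u, minJ J u, weyl A u & (len u <= N)%N].
  by rewrite mem_filter => /andP[/andP[/asboolP h1 /minJP h2] /mem_WL[]].
have in2 y : y \in t2 -> [/\ inW A J y, weyl A y & (len y <= N)%N].
  by rewrite mem_filter => /andP[/asboolP h1 /mem_WL[]].
apply: eqm_widen => [|||w].
- by apply: filter_uniq; apply: WL_uniq.
- apply: allpairs_uniq; rewrite ?filter_uniq ?WL_uniq //.
  move=> [u y] [u' y'] /allpairsP[[u0 y0] [/in1[_ mu hu _] /in2[hy _ _] [-> ->]]].
  move=> /allpairsP[[u1 y1] [/in1[_ mu' hu' _] /in2[hy' _ _] [-> ->]]] /= e.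
  by have [/= e1 e2] := inW_factor_uniq hA hu hu' mu mu' hy hy' e; rewrite e1 e2.
- move=> w; rewrite mem_filter => /andP[/asboolP hw /mem_WL[_ lw]].
  have [u [y [hu mu hy e]]] := inW_factor hA JI hw.
  have huw := inW_weyl hu; have hyw := inW_weyl hy.
  have le : (len u + len y <= N)%N by rewrite -(len_factor hA huw mu hy) -e.
  apply/allpairsP; exists (u, y); split=> //=; rewrite mem_filter.
    apply/andP; split; first by apply/andP; split; [apply/asboolP|apply/minJP].
    by apply/mem_WL; split=> //; apply: leq_trans (leq_addr _ _) le.
  apply/andP; split; first exact/asboolP.
  by apply/mem_WL; split=> //; apply: leq_trans (leq_addl _ _) le.
move=> /allpairsP[[u y] [/in1[hu mu huw _] /in2[hy hyw _] /= ->]].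
have huy := weylM huw hyw.
rewrite mem_filter negb_and => /orP[/asboolP[]|/(WL_notin huy) le].
  exact: inWM hu (inW_sub JI hy).
exact: ordge_weak le (hh _ huy).
Qed.

Lemma tlen_sum_fpsC N (p : pred 'M[int]_r) :
  \sum_(w <- WL N | p w) tlen w = fpsC 'I_r (\sum_(w <- WL N | p w) tv ^+ len w).
Proof. by rewrite fpsC_sum; apply: eq_bigr => w _; rewrite /tlen tvarX. Qed.

(** Only the identity has length 0, so the constant coefficient in t is 1. *)
Lemma tlen_sum_unit N (p : pred 'M[int]_r) : p 1%:M ->
  exists c : Zt, c * (\sum_(w <- WL N | p w) tv ^+ len w) = 1.
Proof.
move=> p1; set d := \sum_(w <- _ | _) _.
suff u : d \is a GRing.unit by exists d^-1; rewrite mulVr.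
apply: fps_unit1; have zero : (0 : {ffun unit -> nat}) = [ffun _ => 0%N].
  by apply/ffunP => i; rewrite !ffunE.
have e w : coef (tv ^+ len w) 0 = (len w == 0%N)%:R.
  by rewrite zero -[tv ^+ _]mulr1 coef_tvXM leqn0; case: eqP => // ->; rewrite subnn -zero fcoef1 eqxx.
rewrite /d fcoef_sum (eq_bigr _ (fun w _ => e w)).
have in1 : 1%:M \in WL N by apply/mem_WL; rewrite len1; split=> //; apply: weyl1.
rewrite big_mkcond (bigD1_seq 1%:M in1 (WL_uniq A N)) /= p1 len1 eqxx.
rewrite big_seq_cond big1 ?addr0 // => w /andP[/WL_weyl hw w1].
case: ifP => // _; case: eqP => // /(len_eq0 hw) e1; by rewrite e1 eqxx in w1.
Qed.

Lemma eqm_cancel N (c d : Zt) F G : c * d = 1 ->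
  eqm N (fpsC _ d * F) (fpsC _ d * G) -> eqm N F G.
Proof.
move=> e h; have := eqmMl (fpsC _ c) h; by rewrite !mulrA -!fpsCM e !fpsC1 !mul1r.
Qed.

Lemma inW_inv_bool J w : weyl A w -> inWb J (invmx w) = inWb J w.
Proof.
move=> hw; apply/asboolP/asboolP => h; last exact: inW_inv.
by rewrite -(invmxK w); apply: inW_inv.
Qed.

Lemma sum_inWT N (h : 'M[int]_r -> ZtQ r) : \sum_(w <- WL N | inWb [set: 'I_r] w) h w = \sum_(w <- WL N) h w.
Proof.
rewrite big_seq_cond [RHS]big_seq; apply: eq_bigl => w.
case: (boolP (w \in WL N)) => //= /WL_weyl hw; apply/asboolP; exact: inWT.
Qed.

(** Restrict the identity for W to [J], after reindexing by inverses so that [Xw_restrict] applies.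
    Both sides then carry the length series [B] of the minimal representatives of [W / W_J], a unit
    that cancels. *)
Lemma parabolic_sum N J : eqm N.+1 (\sum_(y <- WL N | inWb J y) X y)
   (restrict J inv_mC * \sum_(y <- WL N | inWb J y) tlen y).
Proof.
have JT : J \subset [set: 'I_r] by apply: finset.subsetT.
have h0 := eqm_restrict J (@weyl_sum N).
rewrite restrictM restrict_sum tlen_sum_fpsC restrict_fpsC -tlen_sum_fpsC in h0.
rewrite (WL_inv N _ (p := xpredT)) // in h0.
rewrite -[X in eqm _ X _]sum_inWT -[X in eqm _ _ (_ * X)]sum_inWT in h0.
have o1 w : weyl A w -> ordge (len w) (restrict J (X (invmx w))).
  move=> hw; apply: ordge_restrict; rewrite -(len_inv hA hw).
  exact/Xw_ord/weyl_inv.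
have s1 := @sum_factor N _ _ _ JT o1.
have s2 := @sum_factor N _ _ _ JT (fun w _ => @tlen_ord w).
pose q u := inWb [set: 'I_r] u && (J \subset ascents u).
pose B := \sum_(u <- WL N | q u) tv ^+ len u.
have e1 : \sum_(u <- WL N | q u) \sum_(y <- WL N | inWb J y) restrict J (X (invmx (u *m y)))
  = fpsC _ B * \sum_(y <- WL N | inWb J y) X (invmx y).
  rewrite -tlen_sum_fpsC mulr_suml; apply: eq_bigr => u /andP[/asboolP hu /minJP mu].
  rewrite mulr_sumr; apply: eq_bigr => y /asboolP hy.
  by rewrite (Xw_restrict hA (inW_weyl hu) mu hy).
have e2 : \sum_(u <- WL N | q u) \sum_(y <- WL N | inWb J y) tlen (u *m y)
  = fpsC _ B * \sum_(y <- WL N | inWb J y) tlen y.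
  rewrite -tlen_sum_fpsC mulr_suml; apply: eq_bigr => u /andP[/asboolP hu /minJP mu].
  rewrite mulr_sumr; apply: eq_bigr => y /asboolP hy.
  by rewrite /tlen (len_factor hA (inW_weyl hu) mu hy) exprD.
rewrite e1 in s1; rewrite e2 in s2.
have [|c hc] := @tlen_sum_unit N q.
  apply/andP; split; first by apply/asboolP/inW1.
  by apply/minJP => j _; rewrite mul1mx; apply: Qplus_simple.
rewrite (WL_inv N _ (inW_inv_bool J)); apply: (eqm_cancel hc).
apply: eqm_trans (eqm_sym s1) _; apply: eqm_trans h0 _.
by rewrite mulrCA; apply: eqmMl.
Qed.

(** Multiply by the length series of [W_J]: on the left, each [X_u u(f_J)] becomes the sum of
    [X_(uy)] over [y] in [W_J], so that the identity for [W_I] applies. The series is a unit and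
    cancels. *)
Lemma coset_sum N I J : J \subset I ->
  eqm N.+1 (\sum_(u <- WL N | inWb I u && (J \subset ascents u)) X u * act u (restrict J inv_mC))
    (restrict I inv_mC * \sum_(u <- WL N | inWb I u && (J \subset ascents u)) tlen u).
Proof.
move=> JI; pose q u := inWb I u && (J \subset ascents u).
pose d := \sum_(y <- WL N | inWb J y) tv ^+ len y.
have [|c hc] := @tlen_sum_unit N (fun y => inWb J y); first exact/asboolP/inW1.
apply: (eqm_cancel hc).
have s1 := @sum_factor N _ _ _ JI (fun w hw => Xw_ord hA hw).
have s2 := @sum_factor N _ _ _ JI (fun w _ => @tlen_ord w).
have e2 : \sum_(u <- WL N | q u) \sum_(y <- WL N | inWb J y) tlen (u *m y)
  = fpsC _ d * \sum_(u <- WL N | q u) tlen u.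
  rewrite -tlen_sum_fpsC mulr_sumr; apply: eq_bigr => u /andP[/asboolP hu /minJP mu].
  rewrite mulr_suml; apply: eq_bigr => y /asboolP hy.
  by rewrite /tlen (len_factor hA (inW_weyl hu) mu hy) exprD mulrC.
rewrite e2 in s2.
have s3 : eqm N.+1 (\sum_(u <- WL N | q u) \sum_(y <- WL N | inWb J y) X (u *m y))
  (fpsC _ d * \sum_(u <- WL N | q u) X u * act u (restrict J inv_mC)).
  rewrite mulr_sumr; apply: eqm_sum => u _ /andP[/asboolP hu /minJP mu].
  have huw := inW_weyl hu.
  rewrite (eq_bigr (fun y => X u * act u (X y))); last first.
    by move=> y /asboolP hy; rewrite (Xw_mul hA huw mu hy).
  rewrite -mulr_sumr -act_sum mulrCA -act_scale; apply: eqmMl.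
  rewrite /eqm -actN -actD; apply: (ordge_act hA huw mu).
    rewrite /Jsupp restrictD restrictN restrictM restrict_fpsC Jsupp_restrict.
    congr (_ - _); rewrite restrict_sum; apply: eq_bigr => y /asboolP hy.
    exact: Xw_Jsupp.
  rewrite -/(eqm _ _ _) /d -tlen_sum_fpsC mulrC; exact: parabolic_sum.
apply: eqm_trans (eqm_sym s3) _; apply: eqm_trans (eqm_sym s1) _.
apply: eqm_trans (@parabolic_sum N I) _; rewrite mulrCA; exact: eqmMl.
Qed.

Definition alt_act I u : ZtQ r :=
  \sum_(J : {set 'I_r} | J \subset I :&: ascents u) fpsC _ ((-1) ^+ #|J|) * act u (restrict J inv_mC).

Lemma alternating_sum N I : (forall u, inW A I u -> I :&: ascents u != finset.set0) ->
  eqm N.+1 (\sum_(u <- WL N | inWb I u) X u * alt_act I u) 0.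
Proof.
move=> hne.
have h : eqm N.+1
  (\sum_(J : {set 'I_r} | J \subset I) fpsC _ ((-1) ^+ #|J|) *
     \sum_(u <- WL N | inWb I u && (J \subset ascents u)) X u * act u (restrict J inv_mC))
  (\sum_(J : {set 'I_r} | J \subset I) fpsC _ ((-1) ^+ #|J|) *
     (restrict I inv_mC * \sum_(u <- WL N | inWb I u && (J \subset ascents u)) tlen u)).
  by apply: eqm_sum => J _ JI; apply: eqmMl; apply: coset_sum.
rewrite [X in eqm _ X _](_ : _ = \sum_(u <- WL N | inWb I u) X u * alt_act I u) in h; last first.
  rewrite (eq_bigr _ (fun J _ => mulr_sumr _ _ _ _)).
  rewrite (exchange_big_dep (fun u => inWb I u)) /=; last by move=> J u _ /andP[].
  apply: eq_bigr => u hu; rewrite /alt_act mulr_sumr; apply: eq_big => [J|J _].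
    by rewrite hu finset.subsetI.
  by rewrite mulrCA.
rewrite [X in eqm _ _ X](_ : _ = 0) // in h.
rewrite (eq_bigr (fun J : {set 'I_r} => restrict I inv_mC * \sum_(u <- WL N | inWb I u && (J \subset ascents u)) fpsC _ ((-1) ^+ #|J|) * tlen u)); last first.
  by move=> J _; rewrite mulrCA mulr_sumr.
rewrite -mulr_sumr (exchange_big_dep (fun u => inWb I u)) /=; last by move=> J u _ /andP[].
rewrite big1 ?mulr0 // => u /asboolP hu; rewrite -mulr_suml -fpsC_sum.
rewrite (eq_bigl (fun J : {set 'I_r} => (finset.set0 \subset J) && (J \subset I :&: ascents u))); last first.
  move=> J; rewrite finset.sub0set finset.subsetI; congr (_ && _).
  by case: asboolP.
by rewrite sum_sign_subsets eq_sym (negPf (hne u hu)) fpsC0 mul0r.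
Qed.

(** The exponent [c] is present in [f_J] when [J] contains its support. The signs therefore cancel
    unless that support is the whole of [I :&: ascents u]. *)
Lemma coef_alt_act I u b c : weyl A u -> toQ b = u *m toQ c ->
  coef (alt_act I u) b = if supp c == I :&: ascents u then (-1) ^+ #|I :&: ascents u| * coef inv_mC c else 0.
Proof.
move=> hu e; rewrite /alt_act fcoef_sum.
rewrite (eq_bigr (fun J : {set 'I_r} => (if supp c \subset J then (-1) ^+ #|J| else 0) * coef inv_mC c)); last first.
  move=> J _; rewrite fcoef_fpsCM (coef_act hA _ hu e) coef_restrict.
  by case: ifP; rewrite ?mulr0 ?mul0r.
rewrite -mulr_suml -big_mkcondr /= (eq_bigl (fun J : {set 'I_r} => (supp c \subset J) && (J \subset I :&: ascents u))).
  by rewrite sum_sign_subsets; case: ifP; rewrite ?mul0r.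
by move=> J; rewrite andbC.
Qed.

Lemma coef_alt_act0 I u b : weyl A u -> (forall c, toQ b <> u *m toQ c) -> coef (alt_act I u) b = 0.
Proof.
move=> hu h; rewrite /alt_act fcoef_sum big1 // => J _.
by rewrite fcoef_fpsCM (coef_act0 hA _ h) // mulr0.
Qed.

Lemma cV_subE (u v : 'cV[int]_r) i : (u - v) i 0 = u i 0 - v i 0.
Proof. by rewrite mxE [in X in _ + X]mxE. Qed.

Lemma simple_entry i j : (a j : 'cV[int]_r) i 0 = (i == j)%:R.
Proof. by rewrite mxE eqxx andbT. Qed.

(** Necessary for the term of [u] to reach [e^l]: a monomial [e^b] of [alt_act] must divide [e^l],
    with [X_u] supplying the rest, and [coef_alt_act] prescribes the support of its preimage [c]. *)
Definition contributes l u := inW A (supp l) u /\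
  exists b c, [/\ supp c = supp l :&: ascents u, lel b l & toQ b = u *m toQ c].

Lemma alt_act_contributes l u : inW A (supp l) u -> ~ contributes l u ->
  coef (X u * alt_act (supp l) u) l = 0.
Proof.
move=> hu hn; have huw := inW_weyl hu; rewrite fcoefM.
apply: (@sum_decomps0 _ _ l (fun b c => coef (X u) b * coef (alt_act (supp l) u) c)) => b c bc.
case: (act_cases c huw) => [[d e]|h]; last by rewrite coef_alt_act0 // mulr0.
rewrite (coef_alt_act _ huw e); case: eqP => sd; last by rewrite mulr0.
by case: hn; split=> //; exists c, d; split=> //; rewrite -bc lel_addl.
Qed.

(* The positive columns [u a_i] are bounded by [b]; as [u l >= 0] is a
   combination of all columns with positive coefficients, the negative ones are
   bounded too. *)
Lemma contributes_entry l u i k : Qim A l -> contributes l u -> i \in supp l ->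
  `|(u *m a i) k 0| <= ((ht l) ^ 2)%:Z.
Proof.
move=> hl [hu [b [c [sc bl e]]]] il; have huw := inW_weyl hu.
have mu : minJ (supp l :&: ascents u) u by apply/minJP; apply: finset.subsetIr.
have lk j : (l j <= ht l)%N by rewrite /ht (bigD1 j) //= leq_addr.
have up j : (u *m a j) k 0 <= (ht l)%:Z \/ l j = 0%N.
  case: (boolP (j \in supp l)) => jl; last by right; move: jl; rewrite inE negbK => /eqP.
  left; case: (boolP (j \in ascents u)) => jE; last first.
    have : in_Qplus (- (u *m a j)).
      by case: (root_sign hA j huw) => // h; move: jE; rewrite inE => /asboolP.
    by move=> /(_ k); rewrite mxE oppr_ge0 => /le_trans; apply.
  have jc : j \in supp c by rewrite sc finset.in_setI jl.
  (* As [j] is in the support of [c], the vector [c - a_j] is still in the cone spanned by [J],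
     where [u] is positive; hence [u a_j <= u c = b <= l]. *)
  have h : in_Qplus (u *m (toQ c - a j)).
    apply: (minJ_pos mu) => [q|q qJ].
      rewrite cV_subE simple_entry toQE; case: eqP => [->|_]; last by rewrite subr0.
      by rewrite subr_ge0; move: jc; rewrite inE -lt0n.
    have cq : c q = 0%N by apply/eqP; move: qJ; rewrite -sc inE negbK.
    rewrite cV_subE simple_entry toQE cq; case: eqP => [qj|_]; last by rewrite subr0.
    by move: qJ; rewrite qj finset.in_setI jl jE.
  have bk : (b k <= ht l)%N by apply: leq_trans (lk k); have /lelP := bl.
  have := h k; rewrite mulmxBr -e cV_subE toQE subr_ge0 => /le_trans; apply.
  by rewrite lez_nat.
have ht1 : (0 < ht l)%N by apply: leq_trans (lk i); rewrite lt0n; move: il; rewrite inE.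
have li : (0 < l i)%N by rewrite lt0n; move: il; rewrite inE.
have upi : (u *m a i) k 0 <= (ht l)%:Z by case: (up i) => // z; rewrite z in li.
have hl2 : (ht l)%:Z <= ((ht l) ^ 2)%:Z by rewrite lez_nat -mulnn leq_pmull.
rewrite ler_norml; apply/andP; split; last exact: le_trans upi hl2.
(* In entry [k] of [u l >= 0] the columns other than [i] contribute at most the sum of the [l_j]
   times [ht l], hence at most [(ht l)^2]. As [l_i >= 1], entry [k] of [u a_i] is at least
   [- (ht l)^2]. *)
have := hl u huw k; rewrite (cV_sum_simple (toQ l)) mulmx_sumr summxE (bigD1 i) //= => h0.
have h1 : \sum_(j < r | j != i) (u *m (toQ l j 0 *: a j)) k 0 <= \sum_(j < r | j != i) (l j)%:Z * (ht l)%:Z.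
  apply: ler_sum => j _; rewrite -scalemxAr mxE toQE.
  by case: (up j) => [h|->]; [apply: ler_wpM2l|rewrite !mul0r].
have h2 : \sum_(j < r | j != i) (l j)%:Z * (ht l)%:Z <= ((ht l) ^ 2)%:Z.
  rewrite -mulr_suml -mulnn PoszM; apply: ler_wpM2r => //.
  rewrite -(big_morph Posz PoszD (erefl (Posz 0))) lez_nat.
  by rewrite /ht [X in (_ <= X)%N](bigD1 i) //= leq_addl.
rewrite -scalemxAr mxE toQE in h0.
have h3 := le_trans h0 (lerD (lexx _) (le_trans h1 h2)).
move: h3 li; move: ((u *m a i) k 0) (l i) => z n h3 n0.
have h4 : 0 <= ((ht l) ^ 2)%:Z by [].
move: h3 h4; move: (((ht l) ^ 2)%:Z) => q h3 h4; nia.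
Qed.

(** The columns of [u] indexed by the support of [l] take finitely many values, and they determine
    [u]: an element of the parabolic subgroup fixing these simple roots is the identity. *)
Lemma contributes_len l : Qim A l -> exists M, forall u, contributes l u -> (len u <= M)%N.
Proof.
move=> hl; pose B := ((ht l) ^ 2)%N.
(* Adding [B] moves the entries from [[-B, B]] to [[0, 2B]], so that [absz] and [inord] lose nothing
   on the columns that matter. *)
pose phi u : {ffun 'I_r * 'I_r -> 'I_(2 * B).+1} := [ffun p => inord (absz ((u *m a p.1) p.2 0 + B%:Z))].
apply: (@bounded_on_fibers _ _ (contributes l) phi) => x y hx hy /ffunP e.
have xy i : i \in supp l -> x *m a i = y *m a i.
  move=> il; apply/matrixP => k j; rewrite ord1.
  have := contributes_entry k hl hx il; have := contributes_entry k hl hy il.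
  have := congr1 val (e (i, k)); rewrite !ffunE /= -/B.
  move: ((x *m a i) k 0) ((y *m a i) k 0) => p q.
  rewrite !ler_norml => + /andP[q1 q2] /andP[p1 p2].
  rewrite !inordK; first by move=> h; lia.
    by rewrite ltnS; lia.
  by rewrite ltnS; lia.
have [[hxI _] [hyI _]] := (hx, hy); congr weyl_length.
have hxw := inW_weyl hxI; have hyw := inW_weyl hyI.
have e1 : invmx y *m x = 1%:M.
  apply: (inW_triv hA (inWM (inW_inv hA hyI) hxI)) => i il.
  by rewrite -mulmxA xy // (weyl_mulVK hA) //; apply: Qplus_simple.
by rewrite -[LHS]mul1mx -(mulmxV (weyl_unit hA hyw)) -mulmxA e1 mulmx1.
Qed.

Lemma Qim_act l u c : weyl A u -> Qim A l -> toQ l = u *m toQ c -> Qim A c.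
Proof.
move=> hu hl e w hw.
have := hl (w *m invmx u) (weylM hw (weyl_inv hA hu)).
by rewrite e -mulmxA (weyl_mulVK hA).
Qed.

(** If all simple roots in the support of [l] became negative, so would [u l], which lies in the
    cone and is nonzero. *)
Lemma Qim_ne l u : l != 0 -> Qim A l -> inW A (supp l) u -> supp l :&: ascents u != finset.set0.
Proof.
move=> l0 hl hu; have huw := inW_weyl hu; apply/eqP => e.
have neg : in_Qplus (- (u *m toQ l)).
  rewrite (cV_sum_simple (toQ l)) mulmx_sumr -sumrN; apply: Qplus_sum => i _.
  rewrite -scalemxAr -scalerN; case: (boolP (i \in supp l)) => il; last first.
    by move: il; rewrite inE negbK toQE => /eqP ->; rewrite scale0r => k; rewrite mxE.
  apply: Qplus_scale; first exact: toQ_pos.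
  case: (root_sign hA i huw) => // h; have /setP/(_ i) := e.
  by rewrite finset.in_setI il !inE /=; case: asboolP.
have := weyl_mul_neq0 hA huw (_ : toQ l != 0); rewrite toQ_eq0 l0 => /(_ isT).
by rewrite (Qplus_antisym (hl u huw) neg) eqxx.
Qed.

Lemma inv_mC_eps2 l : l != 0 -> Qim A l ->
  (forall c, c != 0 -> supp c \proper supp l -> (ht c <= ht l)%N ->
     eps 1 (coef inv_mC c) /\ (Qim A c -> eps 2 (coef inv_mC c))) ->
  eps 2 (coef inv_mC l).
Proof.
move=> l0 hl ih; set I := supp l.
have hne u : inW A I u -> I :&: ascents u != finset.set0 by apply: Qim_ne.
have [M hM] := contributes_len hl.
have vanish u : inW A I u -> (M < len u)%N -> coef (X u * alt_act I u) l = 0.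
  by move=> hu lu; apply: alt_act_contributes => // /hM; rewrite leqNgt lu.
(* For each power [t^n] the truncated identity is used with [N] large enough; terms of length above
   [M] vanish at [e^l], so the list [WL M] serves all [n] and the relation is exact in [Z[[t]]]. *)
have sum0 : \sum_(u <- WL M | inWb I u) coef (X u * alt_act I u) l = 0.
  apply: coef_Zt_eq => n; rewrite fcoef0 fcoef_sum.
  pose N := maxn M (ht l + n); have := eqm_coeft (@alternating_sum N I hne) (l := l) (n := n).
  rewrite coeft0 coeft_sum ltnS leq_maxr => /(_ isT) e; apply: etrans e.
  rewrite [RHS](bigID (fun u => u \in WL M)) [X in _ = _ + X]big1_seq ?addr0; last first.
    move=> u /andP[/andP[/asboolP hu /(WL_notin (inW_weyl hu)) h] _].
    by rewrite /coeft vanish.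
  rewrite /coeft -[LHS]big_filter -[RHS]big_filter; apply: perm_big; apply: uniq_perm.
  - exact/filter_uniq/WL_uniq.
  - exact/filter_uniq/WL_uniq.
  move=> u; rewrite !mem_filter; case: (inWb I u) => //=.
  case: (boolP (u \in WL M)) => //= /mem_WL[hu lu]; apply/esym/mem_WL; split=> //.
  by apply: leq_trans lu _; rewrite leq_maxl.
have in1 : 1%:M \in WL M by apply/mem_WL; rewrite len1; split=> //; apply: weyl1.
move: sum0; rewrite big_mkcond (bigD1_seq 1%:M in1 (WL_uniq A M)).
have -> : inWb I 1%:M by apply/asboolP/inW1.
have E1I : I :&: ascents 1%:M = I.
  apply/finset.setIidPl/minJP => j _; rewrite mul1mx; exact: Qplus_simple.
rewrite Xw1 // mul1r (coef_alt_act I (weyl1 A) (c := l)) ?mul1mx // E1I eqxx.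
move/eqP; rewrite addr_eq0 => /eqP e.
have sgn (n : nat) (z : Zt) : (-1) ^+ n * ((-1) ^+ n * z) = z.
  by rewrite mulrA -exprD addnn -mul2n exprM sqrrN expr1n expr1n mul1r.
have eps_sgn n k (z : Zt) : eps k z -> eps k ((-1) ^+ n * z).
  by move=> h; apply: epsMl => //; apply: eps0X; apply/epsN/eps0_1.
rewrite -[coef inv_mC l](sgn #|I|) e; apply/eps_sgn/epsN; apply: eps_sum => u uM u1.
case: asboolP => [hu|_]; last exact: eps_zero.
have huw := inW_weyl hu.
(* Only the identity keeps all simple roots of [I] positive, so every other [u] leads to exponents
   of smaller support. *)
have prop : I :&: ascents u \proper I.
  rewrite finset.properEneq finset.subsetIl andbT; apply/eqP => h.
  move/eqP: u1; apply; apply: (inW_triv hA hu) => j jI.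
  by move: jI; rewrite -h finset.in_setI inE => /andP[_]; rewrite inE => /asboolP.
rewrite fcoefM; apply: eps_sum => -[b c] /=; rewrite mem_decomps => /eqP bc _.
case: (act_cases c huw) => [[d ed]|h]; last by rewrite coef_alt_act0 // mulr0; apply: eps_zero.
rewrite (coef_alt_act _ huw ed); case: eqP => sd; last by rewrite mulr0; apply: eps_zero.
have d0 : d != 0 by rewrite -supp_eq0 sd hne.
have hd : (ht d <= ht l)%N.
  have mu : minJ (I :&: ascents u) u by apply/minJP; apply: finset.subsetIr.
  apply: leq_trans (ht_minJ hA huw mu _ ed) _; first by rewrite sd.
  by rewrite -bc htD leq_addl.
have sp : supp d \proper supp l by rewrite sd.
have [f1 f2] := ih d d0 sp hd.
have [x0 x1] := Xw_eps hA b huw.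
(* If [b = 0], then [l = u d], so [d] is in [Qim] and its coefficient already carries the square.
   Otherwise [X_u] and [f] each supply one factor [1 - t]. *)
case: (eqVneq b 0) => [b0|b0].
  apply: epsMl => //; apply/eps_sgn/f2; apply: Qim_act huw hl _.
  by rewrite -ed -bc b0 add0r.
by apply: (epsM (k := 1) (l := 1)); [apply: x1|apply: eps_sgn].
Qed.

Theorem correction_factor_eps2 l : l != 0 -> eps 2 (coef m l).
Proof.
(* The alternating sum leads to smaller support without greater height, the products with [C] and
   [f] to smaller height without larger support. This measure drops in both cases. *)
move: {2}(ht l + #|supp l|)%N (erefl (ht l + #|supp l|)%N) => n.
elim/ltn_ind: n l => n IH l hn l0.
case: (pselect (Qim A l)) => hl; last by rewrite msupp //; apply: eps_zero.
have mgood c : (forall b, lel b c -> (ht b + #|supp b| < n)%N) -> good (Qim A) c m.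
  move=> h; split=> // b bc b0; have e : eps 2 (coef m b) by apply: IH (h b bc) b erefl b0.
  by split=> // ; apply: eps_weak e.
have fgood c : good (Qim A) c m -> good (Qim A) c inv_mC.
  move=> h; exact: good_inv (goodM h (real_quot_good c)) inv_mC_mul.
have hf : eps 2 (coef inv_mC l).
  apply: inv_mC_eps2 => // c c0 sc hc.
  suff h : good (Qim A) c m by have [_ /(_ c (lel_refl c) c0)] := fgood c h.
  apply: mgood => b bc; rewrite -hn -addnS; apply: leq_add; first exact: leq_trans (lel_ht bc) hc.
  exact: leq_ltn_trans (subset_leq_card (lel_supp bc)) (fintype.proper_card sc).
have below c : c != l -> lel c l -> good (Qim A) c m.
  move=> cl hc; apply: mgood => b bc; rewrite -hn -addSn; apply: leq_add.
    apply: leq_ltn_trans (lel_ht bc) _; rewrite -(difK hc) htD -[X in (X < _)%N]addn0 ltn_add2l.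
    by apply: ht_gt0; apply: contraNneq cl => e; rewrite -(difK hc) e addr0.
  exact/subset_leq_card/lel_supp/(lel_trans bc hc).
have parts p : p \in decomps l -> (p.1 != 0) && (p.2 != 0) -> good (Qim A) p.1 m /\ good (Qim A) p.2 m.
  case: p => b c pl /= /andP[b0 c0]; have [h1 h2] := mem_decomps_lel pl.
  have lt1 := mem_decomps_lt pl c0; have lt2 := mem_decomps_gt pl b0.
  by split; apply: below => //; [apply: contraTneq lt1|apply: contraTneq lt2] => /= ->; rewrite ltnn.
have [c1 c2] := (real_quot_good l).2 l (lel_refl l) l0.
have mC0 : coef (m * real_quot) 0 = 1 by rewrite fcoef0M m0 real_quot0 mulr1.
have f0 : coef inv_mC 0 = 1 := inv_coef0 mC0 inv_mC_mul.
have hF : eps 2 (coef (m * real_quot) l).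
  have := fcoefM_ends inv_mC (m * real_quot) l0; rewrite inv_mC_mul mC0 f0 mulr1 mul1r fcoef1 (negPf l0).
  set s := \sum_(p <- _ | _) _ => e.
  have -> : coef (m * real_quot) l = - (coef inv_mC l + s).
    by apply/eqP; rewrite -subr_eq0 opprK addrA [_ + coef inv_mC l]addrC -e.
  apply/epsN/epsD => //; apply: eps_sum => p pl p12; have [g1 g2] := parts p pl p12.
  case/andP: p12 => p1 p2; apply: (epsM (k := 1) (l := 1)).
    by case: ((fgood _ g1).2 p.1 (lel_refl _) p1).
  by case: ((goodM g2 (real_quot_good _)).2 p.2 (lel_refl _) p2).
have := fcoefM_ends m real_quot l0; rewrite m0 real_quot0 mulr1 mul1r.
set s := \sum_(p <- _ | _) _ => e.
have -> : coef m l = coef (m * real_quot) l - (coef real_quot l + s) by rewrite e -[_ + coef real_quot l + s]addrA addrK.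
apply: epsB => //; apply: epsD; first exact: c2.
apply: eps_sum => p pl p12; have [g1 g2] := parts p pl p12.
case/andP: p12 => p1 p2; apply: (epsM (k := 1) (l := 1)).
  by case: (g1.2 p.1 (lel_refl _) p1).
by case: ((real_quot_good p.2).2 p.2 (lel_refl _) p2).
Qed.

End Main.

Lemma exprz_mul (R : comUnitRingType) (x y : R) (z : int) :
  x \is a GRing.unit -> y \is a GRing.unit -> (x * y) ^ z = x ^ z * y ^ z.
Proof. by move=> ux uy; apply: exprMz_comm => //; apply: mulrC. Qed.

Lemma exprz_ratio (R : comUnitRingType) (x y w : R) (z : int) :
  x \is a GRing.unit -> y \is a GRing.unit -> w \is a GRing.unit ->
  (x * y / w ^+ 2) ^ (- z) = x ^ (- z) * (y ^ (- z) * w ^ (- - (z + z))).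
Proof.
move=> ux uy uw; have uw2 : (w ^+ 2)^-1 \is a GRing.unit by rewrite unitrV unitrX.
rewrite -mulrA exprz_mul ?unitrMr // exprz_mul //; congr (_ * (_ * _)).
by rewrite exprz_inv exprnP exprz_exp; congr (_ ^ _); lia.
Qed.

(** * From the correction factor to the multiplicities *)

Section Multiplicities.
Variable r : nat.
Implicit Types (b c l : Qplus r) (F G : ZtQ r) (p q : {poly int}).
Local Notation good2 := (good (fun _ : Qplus r => True)).

Definition efactor b n : ZtQ r := 1 - tvar r ^+ n * expQ b.

Lemma efactor0 b n : b != 0 -> coef (efactor b n) 0 = 1.
Proof.
move=> b0; rewrite fcoefB fcoef1 eqxx tvarX fcoef_fpsCM fcoef_monom.
by rewrite eq_sym (negPf b0) mulr0 subr0.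
Qed.

Lemma efactor_unit b n : b != 0 -> efactor b n \is a GRing.unit.
Proof. by move=> /efactor0 h; apply: fps_unit1. Qed.

Lemma efactor_eqle1 b n l : ~~ lel b l -> eqle l (efactor b n) 1.
Proof.
move=> h c cl; rewrite fcoefB tvarX fcoef_fpsCM (eqle_exp0 h cl) fcoef0 mulr0.
by rewrite subr0.
Qed.

(** For [p = m_b(t)] this is the part of the product expansion belonging to [b]. A bound [N]
    independent of [p] makes it a homomorphism from addition to multiplication. *)
Definition psi b N p : ZtQ r := \prod_(n < N) efactor b n ^ (- p`_n).

Lemma psiD b N p q : b != 0 -> psi b N (p + q) = psi b N p * psi b N q.
Proof.
move=> b0; rewrite /psi -big_split; apply: eq_bigr => n _.
by rewrite coefD opprD exprzDr // efactor_unit.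
Qed.

Lemma psi0 b N : psi b N 0 = 1.
Proof. by rewrite /psi big1 // => n _; rewrite coef0 oppr0 expr0z. Qed.

Lemma psi_Xn b N k (z : int) : (k < N)%N -> psi b N (z *: 'X^k) = efactor b k ^ (- z).
Proof.
move=> kN; rewrite /psi (bigD1 (Ordinal kN)) //= coefZ coefXn eqxx mulr1.
rewrite big1 ?mulr1 // => n nk; rewrite coefZ coefXn.
by rewrite (_ : (n == k :> nat) = false) ?mulr0 ?oppr0 ?expr0z //; apply: negPf nk.
Qed.

Lemma psi_widen b N p : (size p <= N)%N -> psi b N p = psi b (size p) p.
Proof.
move=> h; rewrite /psi [RHS](big_ord_widen N (fun n => efactor b n ^ (- p`_n))) //.
rewrite [RHS]big_mkcond; apply: eq_bigr => n _; case: ltnP => // /(nth_default 0) ->.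
by rewrite oppr0 expr0z.
Qed.

Lemma psi_sq b N k (z : int) : b != 0 -> (k.+2 < N)%N ->
  psi b N (z *: 'X^k * (1 - 'X) ^+ 2) =
  (efactor b k * efactor b k.+2 / efactor b k.+1 ^+ 2) ^ (- z).
Proof.
move=> b0 kN; have u n := efactor_unit n b0.
have -> : (z *: ('X^k : {poly int})) * (1 - 'X) ^+ 2 =
   z *: 'X^k + (z *: 'X^(k.+2) + (- (z + z)) *: 'X^(k.+1)).
  by rewrite -!mul_polyC polyCN polyCD !exprS; ring.
rewrite !psiD // !psi_Xn ?(ltnW kN) ?(ltnW (ltnW kN)) //.
exact/esym/exprz_ratio.
Qed.

Lemma good2_inv F : coef F 0 = 1 -> (forall l, good2 l F) -> forall l, good2 l F^-1.
Proof.
by move=> F0 h l; apply: good_inv (h l) _; rewrite mulVr // fps_unit1.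
Qed.

Lemma good2_exprz F (z : int) : (forall l, good2 l F) -> forall l, good2 l (F ^ z).
Proof.
move=> h; have hX n l : good2 l (F ^+ n).
  elim: n => [|n IH]; first by rewrite expr0; apply: good1.
  by rewrite exprS; apply: goodM.
case: z => n l; first exact: hX.
by apply: good2_inv => // ; case: (hX n.+1 0).
Qed.

(* [(1 - t^k e) (1 - t^(k+2) e) = (1 - t^(k+1) e)^2 - t^k (1 - t)^2 e]. *)
Lemma efactor_ratio_good b k l : b != 0 -> good2 l (efactor b k * efactor b k.+2 / efactor b k.+1 ^+ 2).
Proof.
move=> b0; have u : efactor b k.+1 ^+ 2 \is a GRing.unit by rewrite unitrX // efactor_unit.
have -> : efactor b k * efactor b k.+2 / efactor b k.+1 ^+ 2 =
    1 - fpsC _ ((1 - tv) ^+ 2 * tv ^+ k) * (expQ b / efactor b k.+1 ^+ 2).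
  apply: (mulIr u); rewrite divrK //.
  rewrite [RHS]mulrBl mul1r -(mulrA (fpsC _ _)) divrK //.
  have e1 : fpsC 'I_r (1 - tv) = 1 - tvar r.
    by apply/eqP; rewrite eq_sym subr_eq tvarE -fpsCD subrK fpsC1.
  by rewrite /efactor fpsCM !fpsCX e1 -tvarE !exprS; ring.
have g0 : coef (efactor b k.+1 ^+ 2) 0 = 1 by rewrite expr2 fcoef0M efactor0 // mulr1.
have pg : pol (efactor b k.+1).
  apply: polD (@pol1 r) _; apply/polN/polM; last exact: pol_exp.
  by rewrite tvarX; apply/pol_fpsC/eps0X/eps0_tv.
have e c : eps 0 (coef (expQ b / efactor b k.+1 ^+ 2) c).
  apply: polM; first exact: pol_exp.
  by apply: (pol_inv (polM pg pg)); rewrite // -expr2 mulVr.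
split=> [|c _ c0].
  rewrite fcoefB fcoef1 eqxx fcoef_fpsCM fcoef0M fcoef_monom.
  by rewrite eq_sym (negPf b0) mul0r mulr0 subr0.
have e2 : eps 2 (coef (1 - fpsC 'I_r ((1 - tv) ^+ 2 * tv ^+ k) * (expQ b / efactor b k.+1 ^+ 2)) c).
  rewrite fcoefB fcoef1 (negPf c0) sub0r fcoef_fpsCM; apply/epsN/epsMr => //.
  apply: epsMr; last exact/eps0X/eps0_tv.
  by rewrite expr2; apply: (epsM (k := 1) (l := 1)); apply: eps1_tv.
by split=> // ; apply: eps_weak e2.
Qed.

(** Expanding [q] in powers of t writes the product as integer powers of the ratios belonging to
    [t^k (1 - t)^2], and these are covered by [efactor_ratio_good]. *)
Lemma psi_good b q l : b != 0 ->
  good2 l (psi b (size (q * (1 - 'X) ^+ 2)) (q * (1 - 'X) ^+ 2)).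
Proof.
move=> b0; pose N := maxn (size (q * (1 - 'X) ^+ 2)) (size q).+2.
rewrite -(@psi_widen b N) ?leq_maxl //.
have -> : q * (1 - 'X) ^+ 2 = \sum_(k < size q) q`_k *: 'X^k * (1 - 'X) ^+ 2.
  by rewrite -mulr_suml -poly_def coefK.
rewrite (big_morph (psi b N) (fun p p' => psiD N p p' b0) (psi0 b N)).
apply: good_prod => k _; rewrite psi_sq //.
  by apply: good2_exprz => l'; apply: efactor_ratio_good.
by apply: leq_trans (leq_maxr _ _); rewrite !ltnS ltn_ord.
Qed.

Definition lin b (c : Zt) : ZtQ r := 1 + fpsC _ c * expQ b.

Lemma lin_mul b (c d : Zt) : b != 0 -> eqle b (lin b c * lin b d) (lin b (c + d)).
Proof.
move=> b0; have nb : ~~ lel (b + b) b.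
  apply/negP => /lel_ht; rewrite htD -[X in (_ <= X)%N]addn0 leq_add2l leqn0 ht_eq0.
  by rewrite (negPf b0).
have -> : lin b c * lin b d = lin b (c + d) + fpsC _ (c * d) * expQ (b + b).
  by rewrite /lin fpsCD fpsCM /expQ monomD; ring.
by move=> x xb; rewrite fcoefD fcoef_fpsCM (eqle_exp0 nb xb) fcoef0 mulr0 addr0.
Qed.

Lemma lin0 b : lin b 0 = 1.
Proof. by rewrite /lin fpsC0 mul0r addr0. Qed.

Lemma lin_unit b (c : Zt) : b != 0 -> lin b c \is a GRing.unit.
Proof.
move=> b0; apply: fps_unit1; rewrite fcoefD fcoef1 fcoef_fpsCM fcoef_monom eqxx.
by rewrite eq_sym (negPf b0) mulr0 addr0.
Qed.

Lemma lin_exprz b (c : Zt) (z : int) : b != 0 -> eqle b (lin b c ^ z) (lin b (z%:~R * c)).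
Proof.
move=> b0; have pos n : eqle b (lin b c ^+ n) (lin b (n%:R * c)).
  elim: n => [|n IH]; first by rewrite mul0r lin0.
  have -> : n.+1%:R * c = c + n%:R * c by rewrite mulrS mulrDl mul1r.
  rewrite exprS; apply: eqle_trans (lin_mul c (n%:R * c) b0).
  exact: eqleM (@eqle_refl _ _ b (lin b c)) IH.
case: z => n; first exact: pos.
rewrite NegzE -exprnN; set F := lin b c ^+ n.+1.
have u : F \is a GRing.unit by rewrite unitrX // lin_unit.
rewrite -[X in eqle b X]mulr1 -(lin0 b) -(subrr (n.+1%:R * c)).
apply: eqle_trans (eqleM (@eqle_refl _ _ b F^-1) (eqle_sym (lin_mul _ _ b0))) _.
apply: eqle_trans (eqleM (@eqle_refl _ _ b F^-1) (eqleM (eqle_sym (pos n.+1)) (@eqle_refl _ _ b _))) _.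
by rewrite mulrA mulVr // mul1r mulrNz mulNr.
Qed.

(** As [e^(2b)] vanishes modulo [eqle b], products of the [1 + c e^b] add the [c], and the exponents
    [- p_n] on [1 - t^n e^b] sum up to [p(t)]. *)
Lemma psi_lin b p : b != 0 -> eqle b (psi b (size p) p) (lin b (ev p)).
Proof.
move=> b0; rewrite ev_coef /psi; elim/big_rec2: _ => [|n F c _ IH]; first by rewrite lin0.
apply: eqle_trans (lin_mul _ _ b0); apply: eqleM => //.
have -> : efactor b n = lin b (- tv ^+ n).
  rewrite /efactor /lin tvarX; congr (_ + _); rewrite -mulNr; congr (_ * _).
  by apply/eqP; rewrite eq_sym -subr_eq0 opprK -fpsCD addNr fpsC0.
apply: eqle_trans (lin_exprz _ _ b0) _.
by rewrite mulrNz mulrNN.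
Qed.

End Multiplicities.

(** * Extracting the multiplicities from the product expansion *)

Section Expansion.
Variables (r : nat) (A : 'M[int]_r) (hA : gcm A).
Implicit Types (b c l k : Qplus r) (F G : ZtQ r).

Lemma Qim0 : Qim A 0.
Proof. by move=> w _ i; rewrite toQ0 mulmx0 mxE. Qed.

Lemma QimD b c : Qim A b -> Qim A c -> Qim A (b + c).
Proof. by move=> hb hc w hw; rewrite toQD mulmxDr; apply: Qplus_add; [apply: hb|apply: hc]. Qed.

Definition imsupp F := coef F 0 = 1 /\ forall l, ~ Qim A l -> coef F l = 0.

Lemma imsupp1 : imsupp 1.
Proof.
split=> [|l hl]; first by rewrite fcoef1 eqxx.
by rewrite fcoef1; case: eqP => // l0; case: hl; rewrite l0; apply: Qim0.
Qed.

Lemma imsuppM F G : imsupp F -> imsupp G -> imsupp (F * G).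
Proof.
move=> [F0 hF] [G0 hG]; split=> [|l hl]; first by rewrite fcoef0M F0 G0 mulr1.
rewrite fcoefM; apply: (@sum_decomps0 _ _ l (fun b c => coef F b * coef G c)) => b c bc.
case: (pselect (Qim A b)) => [hb|/hF ->]; last by rewrite mul0r.
case: (pselect (Qim A c)) => [hc|/hG ->]; last by rewrite mulr0.
by case: hl; rewrite -bc; apply: QimD.
Qed.

Lemma imsuppV F : imsupp F -> imsupp F^-1.
Proof.
move=> [F0 hF]; have e : F^-1 * F = 1 by rewrite mulVr // fps_unit1.
split=> [|l]; first exact: inv_coef0 F0 e.
move: {2}(ht l) (erefl (ht l)) => n; elim/ltn_ind: n l => n IH l hn hl.
have -> : coef F^-1 l = coef (1 : ZtQ r) l - \sum_(p <- decomps l | p.2 != 0) coef F^-1 p.1 * coef F p.2.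
  by rewrite -e fcoefM_r F0 mulr1 addrK.
rewrite (imsupp1.2 l hl) sub0r big1_seq ?oppr0 // => -[b c] /andP[/= c0 bc].
case: (pselect (Qim A c)) => [hc|/hF ->]; last by rewrite mulr0.
rewrite (IH (ht b)) ?mul0r //; first by rewrite -hn; apply: mem_decomps_lt bc c0.
by move=> hb; apply: hl; move: bc; rewrite mem_decomps => /eqP <-; apply: QimD.
Qed.

Lemma imsuppZ F (z : int) : imsupp F -> imsupp (F ^ z).
Proof.
move=> h; have hX n : imsupp (F ^+ n).
  elim: n => [|n IH]; first by rewrite expr0; apply: imsupp1.
  by rewrite exprS; apply: imsuppM.
by case: z => n; [apply: hX|apply/imsuppV/hX].
Qed.

Lemma imsupp_prod (T : eqType) (s : seq T) (F : T -> ZtQ r) :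
  (forall x, x \in s -> imsupp (F x)) -> imsupp (\prod_(x <- s) F x).
Proof.
move=> h; rewrite big_seq; elim/big_rec: _ => [|x f xs hf]; first exact: imsupp1.
by apply: imsuppM => //; apply: h.
Qed.

Lemma imsupp_efactor b n : b != 0 -> Qim A b -> imsupp (efactor b n).
Proof.
move=> b0 hb; split=> [|l hl]; first exact: efactor0.
rewrite fcoefB (imsupp1.2 l hl) tvarX fcoef_fpsCM fcoef_monom sub0r.
by case: eqP => [lb|]; rewrite ?mulr0 ?oppr0 //; case: hl; rewrite lb.
Qed.

Variables (mult : Qplus r -> {poly int}) (m : ZtQ r).
Hypothesis hprod : is_prod [set x : Qplus r * nat | x.1 != 0 /\ Qim A x.1]%classic
  (fun x => (1 - tvar r ^+ x.2 * expQ x.1) ^ (- (mult x.1)`_x.2)) m.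

Lemma m_expand l : exists K : seq (Qplus r), [/\ uniq K,
  forall k, k \in K <-> [/\ lel k l, k != 0 & Qim A k] &
  eqle l m (\prod_(k <- K) psi k (size (mult k)) (mult k))].
Proof.
have [s us hs] := lel_seq l.
pose K := [seq k <- s | (k != 0) && `[< Qim A k >]].
have hK k : k \in K <-> [/\ lel k l, k != 0 & Qim A k].
  rewrite mem_filter hs; split=> [/andP[/andP[k0 /asboolP hk] kl] //|[kl k0 hk]].
  by rewrite kl k0 andbT; apply/asboolP.
exists K; split=> //; first exact: filter_uniq.
(* Finitely many pairs suffice: the exponent is 0 for [n] beyond the size of [mult k], and the
   factor is congruent to 1 if [k] is not below [l]. *)
pose L := [seq (k, n) | k <- K, n <- iota 0 (size (mult k))].
have hL x : x \in [fset z in L]%fset -> x.1 != 0 /\ Qim A x.1.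
  rewrite in_fset => /allpairsPdep[k [n [/hK[_ k0 hk] _ ->]]] //.
have hn x : x.1 != 0 /\ Qim A x.1 -> x \notin [fset z in L]%fset ->
    eqle l ((1 - tvar r ^+ x.2 * expQ x.1) ^ (- (mult x.1)`_x.2)) 1.
  case: x => k n /= [k0 hk]; rewrite in_fset => hx.
  case: (boolP (lel k l)) => kl; last exact/eqle1Z/efactor_eqle1.
  rewrite nth_default ?oppr0 ?expr0z // leqNgt; apply: contra hx => hn.
  apply/allpairsPdep; exists k, n; split=> //; first exact/hK.
  by rewrite mem_iota.
apply: eqle_trans (is_prod_eqle hprod hL hn) _.
rewrite (perm_big L) /=; last first.
  apply: uniq_perm; rewrite ?fset_uniq //; last by move=> x; rewrite in_fset.
  apply: allpairs_uniq_dep => [|k _|]; rewrite ?iota_uniq ?filter_uniq //.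
  by move=> [k n] [k' n'] _ _ /= [-> ->].
rewrite big_allpairs_dep.
rewrite (eq_bigr (fun k => psi k (size (mult k)) (mult k))) // => k _.
rewrite /psi (_ : iota 0 _ = index_iota 0 (size (mult k))) ?big_mkord //.
by rewrite /index_iota subn0.
Qed.

(** Derived from the product expansion: its factors are supported in [Qim], which is closed under
    addition. *)
Lemma m_imsupp : imsupp m.
Proof.
have h l : exists2 F, imsupp F & coef m l = coef F l /\ coef m 0 = coef F 0.
  have [K [_ hK e]] := m_expand l.
  exists (\prod_(k <- K) psi k (size (mult k)) (mult k)); last first.
    by rewrite !e ?lel_refl ?lel0.
  apply: imsupp_prod => k /hK[_ k0 hk]; apply: imsupp_prod => n _.
  exact/imsuppZ/imsupp_efactor.
split=> [|l hl]; first by have [F [F0 _] [_ ->]] := h 0.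
by have [F [_ hF] [-> _]] := h l; apply: hF.
Qed.

(** At [e^l] the series [m] has the coefficient [m_l(t)] plus that of the product over the smaller
    exponents, which is divisible by induction. Injectivity of [ev] brings the conclusion back to
    [Z[t]]. *)
Lemma mult_divisible : (forall l, l != 0 -> eps 2 (coef m l)) ->
  forall l, l != 0 -> Qim A l -> exists q, mult l = q * (1 - 'X) ^+ 2.
Proof.
move=> hm l; move: {2}(ht l) (erefl (ht l)) => n; elim/ltn_ind: n l => n IH l hn l0 hl.
have [K [uK hK e]] := m_expand l.
have lK : l \in K by apply/hK; split=> //; apply: lel_refl.
pose Y k := psi k (size (mult k)) (mult k).
have el : coef m l = coef (Y l * \prod_(k <- K | k != l) Y k) l.
  by rewrite e ?lel_refl // (bigD1_seq l).
set R := \prod_(k <- K | k != l) Y k in el.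
have Rg : good (fun _ : Qplus r => True) l R.
  rewrite /R -big_filter; apply: good_prod => k; rewrite mem_filter => /andP[kl /hK[kl' k0 hk]].
  have [|q eq] := IH (ht k) _ k erefl k0 hk.
    rewrite -hn -(difK kl') htD -[X in (X < _)%N]addn0 ltn_add2l; apply: ht_gt0.
    by apply: contraNneq kl => e0; rewrite -(difK kl') e0 addr0.
  by rewrite /Y eq; apply: psi_good.
have eY : eqle l (Y l) (lin l (ev (mult l))) by apply: psi_lin.
have lin_coef (c : Zt) : coef (lin l c) 0 = 1 /\ coef (lin l c) l = c.
  rewrite /lin !fcoefD !fcoef1 !fcoef_fpsCM !fcoef_monom !eqxx (negPf l0) eq_sym (negPf l0).
  by rewrite mulr0 addr0 mulr1 add0r.
have lin_mid (c : Zt) b : b != 0 -> b != l -> coef (lin l c) b = 0.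
  by move=> b0 bl; rewrite fcoefD fcoef1 fcoef_fpsCM fcoef_monom (negPf b0) (negPf bl) mulr0 addr0.
have [R0 R2] := Rg; have [_ /(_ I) Rl] := R2 l (lel_refl l) l0.
have hY0 : coef (Y l) 0 = 1 by rewrite eY ?lel0 // (lin_coef _).1.
have hYl : coef (Y l) l = ev (mult l) by rewrite eY ?lel_refl // (lin_coef _).2.
have := hm l l0; rewrite el fcoefM_ends // hY0 hYl R0 mulr1 mul1r.
(* Below [l] the factor of [l] is [1 + m_l(t) e^l], without intermediate terms, so all mixed terms
   vanish. *)
rewrite big1_seq ?addr0; last first.
  move=> [b c] /andP[/= /andP[b0 c0] bc]; have [bl _] := mem_decomps_lel bc.
  rewrite eY // lin_mid ?mul0r //; have := mem_decomps_lt bc c0 => /= lt.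
  by apply: contraTneq lt => ->; rewrite ltnn.
move=> h; have := epsB h Rl; rewrite addrK => -[q /ev_inj eq]; by exists q.
Qed.

End Expansion.

Theorem theorem7p6 (r : nat) (A : 'M[int]_r) (hA : gcm A)
    (mult : Qplus r -> {poly int}) (hmult : is_t_multiplicity A mult) :
  (forall l : Qplus r, l != 0 -> root (mult l) 1) /\
  (forall l : Qplus r, l != 0 -> Qim A l ->
     exists q : {poly int}, mult l = q * (1 - 'X) ^+ 2).
Proof.
have [[m [[D [S [P [hD hS hP hm]]]] hprod]] hre h0] := hmult.
have [m0 msupp] := m_imsupp hprod.
have div := mult_divisible hprod (correction_factor_eps2 hA hD hS hP hm m0 msupp).
split=> // l l0; case: (pselect (Qim A l)) => hl.
  have [q ->] := div l l0 hl; rewrite expr2 mulrA rootM; apply/orP; right.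
  by apply/rootP; rewrite !hornerE subrr.
case: (pselect (pos_real_root A l)) => hr; last by rewrite h0 // root0.
by rewrite (hre l hr); apply/rootP; rewrite !hornerE subrr.
Qed.
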